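(* Let $\{B^s:s\in S\}$ be a finite collection of locally finite dimensional nonnegatively graded connected algebras (with $S$ an index set) such that $B^s$ is multi-Koszul for each $s\in S$. Then the free product (i.e. the coproduct in the category of graded algebras) $A=\coprod_{s\in S}B^s$ of the collection $\{B^s:s\in S\}$ is a multi-Koszul algebra.
   Context: Definition of multi-Koszul algebra. $k$ is a field. Let $A=\bigoplus_{n\ge 0}A_n$ be a locally finite dimensional nonnegatively graded connected algebra ($A_0=k$, $\dim A_n<\infty$), written $A=T(V)/\langle R\rangle$, where $V\simeq A_{>0}/(A_{>0}\cdot A_{>0})$ is a positively graded vector space with finite dimensional components, $T(V)$ is its tensor algebra with the grading induced from $V$, and $R\subseteq \bigoplus_{n\ge2}V^{\otimes n}$ is a space of relations: a graded subspace with $R\cap(T(V)_{>0}\otimes R\otimes T(V)+T(V)\otimes R\otimes T(V)_{>0})=0$, $T(V)_{>0}=\bigoplus_{n\ge1}V^{\otimes n}$. $\pi:T(V)\to A$ is the projection. $V^{(n)}=V^{\otimes n}$, $V^{(0)}=k$. For subspaces $W_1,\dots,W_m$ of $T(V)$, $W_1\otimes\dots\otimes W_m$ denotes the subspace of $T(V)$ spanned by products $w_1\cdots w_m$; $R^{(i)}=R\otimes\dots\otimes R$ ($i$ factors), $R^{(0)}=k$. The spaces $J_i\subseteq T(V)$. $J_0=k$, $J_2=R$, $J_{2i+1}=(V\otimes J_{2i})\cap(J_{2i}\otimes V)$ for $i\ge0$ (so $J_1=V$), and for $i\ge1$ $$J_{2(i+1)}=\Big(\sum_{N\ge1}\ \bigcap_{\bar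 n,\bar m}V^{(m_1)}\otimes J_{2n_1}\otimes\dots\otimes V^{(m_i)}\otimes J_{2n_i}\otimes V^{(m_{i+1})}\Big)\cap R^{(i+1)},$$ where $\bar n=(n_1,\dots,n_i)$ runs over $i$-tuples of nonnegative integers with sum $i$ and $\bar m=(m_1,\dots,m_{i+1})$ over $(i+1)$-tuples of nonnegative integers with sum $N$. Complexes. $K_{L-R}(A)_i=A\otimes J_i\otimes A$, with $A$-bimodule maps $\delta_i^b:K_{L-R}(A)_i\to K_{L-R}(A)_{i-1}$: if $i=2j+1$ and $\omega=\sum\bar\omega_{(1)}\omega_{(2)}=\sum\omega'_{(1)}\bar\omega'_{(2)}\in J_{2j+1}$ with $\bar\omega_{(1)},\bar\omega'_{(2)}\in V$, $\omega_{(2)},\omega'_{(1)}\in J_{2j}$, then $\delta_i^b(1\otimes\omega\otimes1)=\sum\bar\omega_{(1)}\otimes\omega_{(2)}\otimes1-\sum1\otimes\omega'_{(1)}\otimes\bar\omega'_{(2)}$; if $i=2j\ge2$, then $J_{2j}\subseteq\bigoplus_{N\ge0}\bigcap_{l=0}^N V^{(l)}\otimes J_{2j-1}\otimes V^{(N-l)}$, and writing $\omega=\sum_N\omega^N$ accordingly and $\omega^N=\sum\omega^{N,l}_{(1)}\omega^{N,l}_{(2)}\omega^{N,l}_{(3)}\in V^{(l)}\otimes J_{2j-1}\otimes V^{(N-l)}$ for each $0\le l\le N$, $\delta_i^b(1\otimes\omega\otimes1)=\sum_N\sum_{l=0}^N\sum\pi(\omega^{N,l}_{(1)})\otimes\omega^{N,l}_{(2)}\otimes\pi(\omega^{N,l}_{(3)})$.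 The left (resp. right) multi-Koszul complex is $K_{L-R}(A)_\bullet\otimes_A k$ (resp. $k\otimes_A K_{L-R}(A)_\bullet$), augmented to $k$. $A$ is multi-Koszul if the augmented left multi-Koszul complex is a resolution of the trivial left module $k$ (equivalently, the right one is a resolution of the trivial right module $k$). *)

(* Defs.v *)
From HB Require Import structures.
From mathcomp Require Import all_boot all_algebra.
From mathcomp Require Import boolp classical_sets.
From mathcomp Require Import finmap monalg.

Set Implicit Arguments.
Unset Strict Implicit.
Unset Printing Implicit Defensive.

Import GRing.Theory.
Local Open Scope classical_set_scope.
Local Open Scope quotient_scope.
Local Open Scope ring_scope.

Section Span.
Variables (k : fieldType) (U : lmodType k).

Definition span (P : set U) : set U :=
  [set x | exists s : seq (k * U),
    (forall p, p \in s -> P p.2) /\ x = \sum_(p <- s) p.1 *: p.2].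

Lemma span_incl (P : set U) x : P x -> span P x.
Proof.
move=> Px; exists [:: (1, x)]; split=> [p|]; first by rewrite inE => /eqP->.
by rewrite big_seq1 scale1r.
Qed.

Definition subspace (W : set U) : Prop :=
  W 0 /\ forall c x y, W x -> W y -> W (c *: x + y).

Lemma subspace_closed (W : set U) : subspace W -> submod_closed (in_set W).
Proof.
move=> [W0 WD]; split=> [|c x y]; first exact: mem_set.
by move=> /set_mem Wx /set_mem Wy; apply/mem_set/WD.
Qed.

Lemma subspace_span (P : set U) : subspace (span P).
Proof.
split=> [|a x y]; first by exists [::]; split=> //; rewrite big_nil.
move=> [s [sP ->]] [t [tP ->]].
exists ([seq (a * p.1, p.2) | p <- s] ++ t); split=> [p|].
  by rewrite mem_cat => /orP[/mapP[q qs ->]|]; [exact: (sP q) | exact: tP].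
rewrite big_cat big_map /= scaler_sumr; congr (_ + _).
by apply: eq_bigr => p _; rewrite scalerA.
Qed.

Lemma subspaceI (P Q : set U) :
  subspace P -> subspace Q -> subspace (P `&` Q).
Proof.
move=> [P0 PD] [Q0 QD]; split=> // c x y [Px Qx] [Py Qy].
by split; [exact: PD | exact: QD].
Qed.

Lemma span_sub (P W : set U) : subspace W -> P `<=` W -> span P `<=` W.
Proof.
move=> [W0 WD] PW x [s [sP ->]]; elim: s sP => [|p s IHs] sP.
  by rewrite big_nil.
rewrite big_cons; apply: WD; first by apply/PW/sP; rewrite mem_head.
by apply: IHs => q qs; apply: sP; rewrite in_cons qs orbT.
Qed.

Definition span_pred (P : set U) : {pred U} := in_set (span P).

HB.instance Definition _ (P : set U) :=
  GRing.isSubmodClosed.Build k U (span_pred P)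
    (subspace_closed (subspace_span P)).

End Span.

(* The quotient of U by the subspace spanned by P. *)
Section LmodQuotient.
Variables (k : fieldType) (U : lmodType k) (P : set U).

Definition lquot : Type := {ideal_quot (span_pred P)}.

HB.instance Definition _ : EqQuotient U _ lquot := EqQuotient.on lquot.
HB.instance Definition _ := Choice.on lquot.
HB.instance Definition _ := GRing.Zmodule.on lquot.
HB.instance Definition _ : @isZmodQuotient U _ 0 -%R +%R lquot :=
  ZmodQuotient.on lquot.

Implicit Types (x y : U) (u v : lquot).

Definition lpi x : lquot := \pi_lquot x.

Lemma lpiP x y : lpi x = lpi y <-> span P (x - y).
Proof.
have E : (lpi x == lpi y) = (x - y \in span_pred P).
  by rewrite (Quotient.idealrBE (span_pred P)).
split=> [/eqP|xy]; first by rewrite E => /set_mem.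
by apply/eqP; rewrite E; apply: mem_set.
Qed.

Lemma lpiK u : lpi (repr u) = u. Proof. exact: reprK. Qed.

Lemma lpiD x y : lpi (x + y) = lpi x + lpi y. Proof. exact: raddfD. Qed.

Definition lquot_scale (c : k) u : lquot := lpi (c *: repr u).

Lemma lquot_scale_pi c x : lquot_scale c (lpi x) = lpi (c *: x).
Proof.
apply/lpiP; have /lpiP [s [sP E]] := lpiK (lpi x).
rewrite -scalerBr E scaler_sumr.
exists [seq (c * p.1, p.2) | p <- s]; split=> [_ /mapP[q qs ->]|].
  exact: (sP q).
by rewrite big_map; apply: eq_bigr => p _; rewrite scalerA.
Qed.

Lemma lquot_scaleA a b u :
  lquot_scale a (lquot_scale b u) = lquot_scale (a * b) u.
Proof. by rewrite -[u]lpiK !lquot_scale_pi scalerA. Qed.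

Lemma lquot_scale1 : left_id 1 lquot_scale.
Proof. by move=> u; rewrite -[u]lpiK lquot_scale_pi scale1r. Qed.

Lemma lquot_scaleDr : right_distributive lquot_scale +%R.
Proof.
move=> a u v; rewrite -[u]lpiK -[v]lpiK -lpiD !lquot_scale_pi -lpiD.
by rewrite scalerDr.
Qed.

Lemma lquot_scaleDl u : {morph lquot_scale^~ u : a b / a + b}.
Proof. by move=> a b; rewrite -[u]lpiK !lquot_scale_pi -lpiD scalerDl. Qed.

HB.instance Definition _ := GRing.Zmodule_isLmodule.Build k lquot
  lquot_scaleA lquot_scale1 lquot_scaleDr lquot_scaleDl.

Lemma lpi_linear : linear lpi.
Proof. by move=> c x y; rewrite lpiD -lquot_scale_pi. Qed.

HB.instance Definition _ := GRing.isLinear.Build k U lquot *:%R lpi lpi_linear.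

End LmodQuotient.

(* M ⊗_A N for a right A-module M (action ra) and a left A-module N (action la):
   the free k-space on M * N modulo k-bilinearity and A-balancedness. *)
Section Tensor.
Variables (k : fieldType) (A : algType k) (M N : lmodType k).
Variables (ra : M -> A -> M) (la : A -> N -> N).

Local Notation F := {malg k[(M * N)%type]}.

Inductive tens_rel : set F :=
| TensLinL c m m' n :
    tens_rel (<<(c *: m + m', n)>> - (c *: <<(m, n)>> + <<(m', n)>>))
| TensLinR c m n n' :
    tens_rel (<<(m, c *: n + n')>> - (c *: <<(m, n)>> + <<(m, n')>>))
| TensBal a m n :
    tens_rel (<<(ra m a, n)>> - <<(m, la a n)>>).

Definition tens : Type := lquot tens_rel.

HB.instance Definition _ := GRing.Lmodule.on tens.

Definition pure (m : M) (n : N) : tens := lpi _ <<(m, n)>>.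

Variable P : lmodType k.
Implicit Types (f : M -> N -> P) (x y : F) (u v : tens).

Definition balanced f : Prop :=
  [/\ forall c m m' n, f (c *: m + m') n = c *: f m n + f m' n,
      forall c m n n', f m (c *: n + n') = c *: f m n + f m n' &
      forall a m n, f (ra m a) n = f m (la a n)].

Definition lin_ext f x : P := \sum_(p <- msupp x) x@_p *: f p.1 p.2.

(* The map induced by f; meaningful when f is balanced, see tlift_pure. *)
Definition tlift f u : P := lin_ext f (repr u).

Lemma lin_extEw f x (d : {fset M * N}) :
  (msupp x `<=` d)%fset -> lin_ext f x = \sum_(p <- d) x@_p *: f p.1 p.2.
Proof.
move=> sd; apply: big_fset_incl => // p _ px.
by rewrite (mcoeff_outdom px) scale0r.
Qed.

Lemma lin_ext_linear f : linear (lin_ext f).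
Proof.
move=> c x y; pose d := (msupp x `|` msupp y `|` msupp (c *: x + y))%fset.
rewrite (@lin_extEw _ _ d) ?fsubsetUr // (@lin_extEw _ x d); last first.
  by rewrite /d -fsetUA fsubsetUl.
rewrite (@lin_extEw _ y d); last by rewrite /d -fsetUA fsetUCA fsubsetUl.
rewrite scaler_sumr -big_split; apply: eq_bigr => p _ /=.
by rewrite mcoeffD mcoeffZ scalerDl scalerA.
Qed.

HB.instance Definition _ f :=
  GRing.isLinear.Build k F P *:%R (lin_ext f) (lin_ext_linear f).

Lemma lin_extU f m n : lin_ext f <<(m, n)>> = f m n.
Proof.
by rewrite (lin_extEw _ msuppU_le) big_seq_fset1 mcoeffU eqxx scale1r.
Qed.

Lemma tlift_pi f x : balanced f -> tlift f (lpi _ x) = lin_ext f x.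
Proof.
move=> [fl fr fb]; apply/eqP; rewrite -subr_eq0 -linearB.
have /lpiP : lpi tens_rel (repr (lpi tens_rel x)) = lpi tens_rel x.
  exact: lpiK.
set z := _ - x => zR; apply/eqP.
apply: (@span_sub _ _ _ [set z | lin_ext f z = 0]) zR => [|_ [] /=].
- split=> [|c z' t /= z0 t0]; first exact: linear0.
  by rewrite /= linearP /= z0 t0 scaler0 addr0.
- by move=> c m m' n; rewrite linearB linearP /= !lin_extU fl subrr.
- by move=> c m n n'; rewrite linearB linearP /= !lin_extU fr subrr.
- by move=> a m n; rewrite linearB /= !lin_extU fb subrr.
Qed.

Lemma tlift_linear f : balanced f -> linear (tlift f).
Proof.
move=> fb c u v; rewrite -[u]lpiK -[v]lpiK -linearP !tlift_pi //.
exact: linearP.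
Qed.

Lemma tlift_pure f m n : balanced f -> tlift f (pure m n) = f m n.
Proof. by move=> fb; rewrite tlift_pi // lin_extU. Qed.

End Tensor.

Lemma pure_balanced (k : fieldType) (A : algType k) (M N : lmodType k)
    (ra : M -> A -> M) (la : A -> N -> N) :
  balanced ra la (pure ra la).
Proof.
have E x y : tens_rel ra la (x - y) ->
    lpi (tens_rel ra la) x = lpi (tens_rel ra la) y.
  by move=> xy; apply/lpiP/span_incl.
split=> [c m m' n|c m n n'|a m n]; rewrite /pure.
- by rewrite -lpi_linear; apply: E; exact: TensLinL.
- by rewrite -lpi_linear; apply: E; exact: TensLinR.
- by apply: E; exact: TensBal.
Qed.

Section TensorK.
Variables (k : fieldType) (M N : lmodType k).

Definition tensk : Type :=
  tens (A := k^o) (fun (m : M) c => c *: m) (fun c (n : N) => c *: n).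

HB.instance Definition _ := GRing.Lmodule.on tensk.

Definition purek (m : M) (n : N) : tensk := pure _ _ m n.

Variable P : lmodType k.
Implicit Types f : M -> N -> P.

Definition tliftk f (u : tensk) : P := tlift f u.

Definition bilin f : Prop :=
  (forall c m m' n, f (c *: m + m') n = c *: f m n + f m' n) /\
  (forall c m n n', f m (c *: n + n') = c *: f m n + f m n').

Lemma bilin_balanced f : bilin f ->
  balanced (A := k^o) (fun (m : M) c => c *: m) (fun c (n : N) => c *: n) f.
Proof.
move=> [fl fr]; split=> // a m n.
have f0n : f 0 n = 0.
  by have := fl (-1) 0 0 n; rewrite scaler0 addr0 scaleN1r addNr.
have fm0 : f m 0 = 0.
  by have := fr (-1) m 0 0; rewrite scaler0 addr0 scaleN1r addNr.
by rewrite -[a *: m]addr0 -[a *: n]addr0 fl fr f0n fm0.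
Qed.

Lemma tliftk_linear f : bilin f -> linear (tliftk f).
Proof. by move=> /bilin_balanced/tlift_linear. Qed.

Lemma tliftk_pure f m n : bilin f -> tliftk f (purek m n) = f m n.
Proof. by move=> /bilin_balanced/tlift_pure; apply. Qed.

End TensorK.

Lemma purek_bilin (k : fieldType) (M N : lmodType k) : bilin (@purek k M N).
Proof. by have [] := pure_balanced (A := k^o) (fun (m : M) c => c *: m)
  (fun c (n : N) => c *: n). Qed.

(* Graded by the natural numbers, not assumed connected or locally finite. *)
Record gralg (k : fieldType) := GrAlg {
  gr_sort :> algType k;
  gr : nat -> set gr_sort;
  gr_subspace : forall n, subspace (gr n);
  gr1 : gr 0%N 1;
  grM : forall m n a b, gr m a -> gr n b -> gr (m + n)%N (a * b);
  gr_span : forall a, exists N (c : nat -> gr_sort),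
    (forall n, gr n (c n)) /\ a = \sum_(n < N) c n;
  gr_direct : forall N (c : nat -> gr_sort),
    (forall n, gr n (c n)) -> \sum_(n < N) c n = 0 ->
    forall n, (n < N)%N -> c n = 0
}.

Arguments gr {k} g n _.
Arguments gr_span {k} g a.

Section GradedAlgebra.
Variable k : fieldType.
Local Notation gralg := (gralg k).

Definition connected (A : gralg) : Prop :=
  gr A 0%N = [set c%:A | c in [set: k]].

Definition locally_finite (A : gralg) : Prop :=
  forall n, exists s : seq A, gr A n = span [set` s].

Definition gr_pos (A : gralg) : set A :=
  span (\bigcup_(n in [set n | (0 < n)%N]) gr A n).

(* The projection of A onto A_0 = k along A_{>0}; the scalar exists and is
   unique when A is connected. *)
Definition aug (A : gralg) (a : A) : k :=
  xget 0 [set c | gr_pos (a - c%:A)].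

Definition graded (A B : gralg) (f : A -> B) : Prop :=
  forall n a, gr A n a -> gr B n (f a).

(* Coproduct in the category of graded algebras. *)
Definition is_coproduct (S : Type) (B : S -> gralg) (A : gralg)
    (inj : forall s, {lrmorphism B s -> A}) : Prop :=
  (forall s, graded (inj s)) /\
  forall (C : gralg) (f : forall s, {lrmorphism B s -> C}),
    (forall s, graded (f s)) ->
    exists g : {lrmorphism A -> C},
      [/\ graded g,
          forall s b, g (inj s b) = f s b &
          forall g' : {lrmorphism A -> C}, graded g' ->
            (forall s b, g' (inj s b) = f s b) -> forall a, g' a = g a].

End GradedAlgebra.

(* T(V) is the free algebra {malg k[{fmonom X}]} on a homogeneous basis X of V. *)
Section TensorAlgebra.
Variables (k : fieldType) (X : choiceType).

Local Notation T := {malg k[{fmonom X}]}.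

Definition tmul (W1 W2 : set T) : set T :=
  span [set x | exists w1 w2, [/\ W1 w1, W2 w2 & x = w1 * w2]].

Definition tone : set T := span [set 1].

Definition tpow (W : set T) (n : nat) : set T := \big[tmul/tone]_(i < n) W.

Definition gens : set T := span [set <<fmu x>> | x in [set: X]].

Definition tlen_ge (n : nat) : set T :=
  span (\bigcup_(i in [set i | (n <= i)%N]) tpow gens i).

Definition tgr (deg : X -> nat) (n : nat) : set T :=
  [set t : T | forall w : {fmonom X}, w \in msupp t ->
     (\sum_(x <- w) deg x)%N = n].

Definition tideal (R : set T) : set T := tmul (tmul setT R) setT.

End TensorAlgebra.

Arguments tmul {k X} W1 W2 _.
Arguments tone k X _ : clear implicits.
Arguments gens k X _ : clear implicits.
Arguments tlen_ge k X n _ : clear implicits.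

Section MultiKoszul.
Variable k : fieldType.

(* A = T(V)/<R>; proj_gens says that proj induces V ≃ A_{>0}/(A_{>0} A_{>0}). *)
Record presentation (A : gralg k) := Presentation {
  gen : choiceType;
  deg : gen -> nat;
  relsp : set {malg k[{fmonom gen}]};
  proj : {lrmorphism {malg k[{fmonom gen}]} -> A};
  deg_gt0 : forall x, (0 < deg x)%N;
  deg_fin : forall n, exists s : seq gen, forall x, deg x = n -> x \in s;
  rel_subspace : subspace relsp;
  rel_graded : relsp `<=` span (\bigcup_n (relsp `&` tgr deg n));
  rel_ge2 : relsp `<=` tlen_ge k gen 2;
  rel_min :
    relsp `&` span (tmul (tmul (tlen_ge k gen 1) relsp) setT `|`
                  tmul (tmul setT relsp) (tlen_ge k gen 1)) = [set 0];
  proj_graded : forall n t, tgr deg n t -> gr A n (proj t);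
  proj_surj : forall a, exists t, proj t = a;
  proj_ker : forall t, proj t = 0 <-> tideal relsp t;
  proj_gens :
    let A2 := span [set x | exists a b : A,
                      [/\ gr_pos a, gr_pos b & x = a * b]] in
    (forall a, gr_pos a -> exists2 v, gens k gen v & A2 (a - proj v)) /\
    (forall v, gens k gen v -> A2 (proj v) -> v = 0)
}.

Arguments gen {A} p.
Arguments deg {A} p _.
Arguments relsp {A} p _.
Arguments proj {A} p.

Section JSpaces.
Variables (A : gralg k) (p : presentation A).

Local Notation T := {malg k[{fmonom (gen p)}]}.
Local Notation V := (gens k (gen p)).
Local Notation R := (relsp p).

(* Jnext i E is J_{2(i+1)} if E n is J_{2n} for n <= i. The tuples n and m are
   functions on nat of which only the first i (resp. i+1) values matter. *)
Definition Jnext (i : nat) (E : nat -> set T) : set T :=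
  span (\bigcup_(N in [set N | (0 < N)%N])
    [set w | forall n m : nat -> nat,
       (\sum_(j < i) n j)%N = i -> (\sum_(j < i.+1) m j)%N = N ->
       tmul (\big[tmul/tone k (gen p)]_(j < i)
               tmul (tpow V (m j)) (E (n j)))
            (tpow V (m i)) w])
  `&` tpow R i.+1.

(* Jtab i n is J_{2n} for n <= i.+1. *)
Fixpoint Jtab (i : nat) : nat -> set T :=
  match i with
  | 0 => fun n => if n is 0 then tone k (gen p) else R
  | i'.+1 => fun n => if (n <= i'.+1)%N then Jtab i' n
                      else Jnext i'.+1 (Jtab i')
  end.

Definition Jeven (n : nat) : set T := Jtab n n.

Definition Jodd (n : nat) : set T := tmul V (Jeven n) `&` tmul (Jeven n) V.

Lemma JevenE0 : Jeven 0 = tone k (gen p). Proof. by []. Qed.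

Lemma JevenE1 : Jeven 1 = R. Proof. by []. Qed.

Lemma Jtab_stable i n : (n <= i.+1)%N -> Jtab i n = Jeven n.
Proof.
rewrite /Jeven; elim: i n => [|i IHi] n; first by case: n => [|[|n]].
case: n => [|n] len; first by rewrite /= IHi.
rewrite [LHS]/=; case: ifP => [lei|gti]; first by rewrite IHi.
have -> : n = i.+1 by apply/eqP; rewrite eqn_leq -ltnS len ltnNge -ltnS gti.
by rewrite /= leqnn ltnn.
Qed.

Lemma Jnext_ext i E E' :
  (forall n, (n <= i)%N -> E n = E' n) -> Jnext i E = Jnext i E'.
Proof.
move=> EE'; rewrite /Jnext; congr (span _ `&` _).
apply: eq_bigcupr => N _; apply: eq_set => w; apply: eq_forall => n.
apply: eq_forall => m; apply: propext.
have H : (\sum_(j < i) n j)%N = i ->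
    \big[tmul/tone k (gen p)]_(j < i)
       tmul (tpow V (m j)) (E (n j)) =
    \big[tmul/tone k (gen p)]_(j < i)
       tmul (tpow V (m j)) (E' (n j)).
  move=> sn; apply: eq_bigr => j _; rewrite EE' //.
  by rewrite -[leqRHS]sn (bigD1 j) //= leq_addr.
by split=> h sn sm; [rewrite -H // | rewrite H //]; apply: h.
Qed.

Lemma JevenE i : (0 < i)%N -> Jeven i.+1 = Jnext i Jeven.
Proof.
case: i => // i _; rewrite -(@Jtab_stable i.+1) // [LHS]/= ltnn.
by apply: Jnext_ext => n len; apply: Jtab_stable.
Qed.

Definition J (i : nat) : set T := if odd i then Jodd i./2 else Jeven i./2.

Lemma Jeven_subspace n : subspace (Jeven n).
Proof.
case: n => [|[|n]]; [exact: subspace_span | exact: rel_subspace |].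
rewrite JevenE //; apply: subspaceI; first exact: subspace_span.
by rewrite /tpow big_ord_recl; apply: subspace_span.
Qed.

Lemma J_subspace i : subspace (J i).
Proof.
rewrite /J; case: odd; last exact: Jeven_subspace.
by apply: subspaceI; apply: subspace_span.
Qed.

Definition J_pred (i : nat) : {pred T} := in_set (J i).

HB.instance Definition _ i :=
  GRing.isSubmodClosed.Build k T (J_pred i) (subspace_closed (J_subspace i)).

Definition Jsp (i : nat) : Type := {w : T | w \in J_pred i}.

HB.instance Definition _ i := SubChoice.on (Jsp i).
HB.instance Definition _ i := [SubChoice_isSubLmodule of Jsp i by <:].

(* K_i = A ⊗ J_i ⊗ A *)
Definition K (i : nat) : Type := tensk (tensk A (Jsp i)) A.

HB.instance Definition _ i := GRing.Lmodule.on (K i).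

Definition bim (i : nat) (a : A) (w : Jsp i) (b : A) : K i :=
  purek (purek a w) b.

Definition lactK (i : nat) (a : A) (x : K i) : K i :=
  tliftk (fun (y : tensk A (Jsp i)) (b : A) =>
    purek (tliftk (fun (a' : A) (w : Jsp i) => purek (a * a') w) y) b) x.

Definition ractK (i : nat) (x : K i) (a : A) : K i :=
  tliftk (fun (y : tensk A (Jsp i)) (b : A) => purek y (b * a)) x.

Lemma lactK_bilin i a : bilin (fun (y : tensk A (Jsp i)) (b : A) =>
  purek (tliftk (fun (a' : A) (w : Jsp i) => purek (a * a') w) y) b).
Proof.
have lb : bilin (fun (a' : A) (w : Jsp i) => purek (a * a') w).
  have [pl pr] := purek_bilin A (Jsp i).
  by split=> c u v w; rewrite ?mulrDr -?scalerAr ?pl ?pr.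
have [pl pr] := purek_bilin (tensk A (Jsp i)) A.
by split=> c y y' b; [rewrite (tliftk_linear lb) pl | rewrite pr].
Qed.

Lemma lactK_bim i a a' (w : Jsp i) b :
  lactK a (bim a' w b) = bim (a * a') w b.
Proof.
rewrite /lactK /bim (tliftk_pure _ _ (lactK_bilin i a)) tliftk_pure //.
have [pl pr] := purek_bilin A (Jsp i).
by split=> c u v z; rewrite ?mulrDr -?scalerAr ?pl ?pr.
Qed.

Lemma ractK_bilin i a :
  bilin (fun (y : tensk A (Jsp i)) (b : A) => purek y (b * a)).
Proof.
have [pl pr] := purek_bilin (tensk A (Jsp i)) A.
by split=> c u v z; rewrite ?mulrDl -?scalerAl ?pl ?pr.
Qed.

Lemma ractK_bim i a' (w : Jsp i) b a :
  ractK (bim a' w b) a = bim a' w (b * a).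
Proof. by rewrite /ractK (tliftk_pure _ _ (ractK_bilin i a)). Qed.

Definition bimodule_map (i j : nat) (f : K i -> K j) : Prop :=
  (forall a x, f (lactK a x) = lactK a (f x)) /\
  (forall x a, f (ractK x a) = ractK (f x) a).

Implicit Type d : forall i : nat, {linear K i.+1 -> K i}.

Definition delta_odd d : Prop :=
  forall (j : nat) (w : Jsp j.*2.+1)
    (s : seq (T * Jsp j.*2)) (s' : seq (Jsp j.*2 * T)),
    (forall q, q \in s -> V q.1) -> \val w = \sum_(q <- s) q.1 * \val q.2 ->
    (forall q, q \in s' -> V q.2) -> \val w = \sum_(q <- s') \val q.1 * q.2 ->
    d j.*2 (bim 1 w 1) =
      \sum_(q <- s) bim (proj p q.1) q.2 1 -
      \sum_(q <- s') bim 1 q.1 (proj p q.2).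

(* This is delta_{2j+2}; t N l decomposes the component wN N of w in
   V^(l) ⊗ J_{2j+1} ⊗ V^(N-l). *)
Definition delta_even d : Prop :=
  forall (j : nat) (w : Jsp j.*2.+2) (M : nat) (wN : nat -> T)
    (t : nat -> nat -> seq (T * Jsp j.*2.+1 * T)),
    \val w = \sum_(N < M) wN N ->
    (forall N l, (N < M)%N -> (l <= N)%N ->
       (forall q, q \in t N l -> tpow V l q.1.1 /\ tpow V (N - l)%N q.2) /\
       wN N = \sum_(q <- t N l) q.1.1 * \val q.1.2 * q.2) ->
    d j.*2.+1 (bim 1 w 1) =
      \sum_(N < M) \sum_(l < N.+1) \sum_(q <- t N l)
        bim (proj p q.1.1) q.1.2 (proj p q.2).

Definition is_delta d : Prop :=
  [/\ forall i, bimodule_map (d i), delta_odd d & delta_even d].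

(* L_i = K_i ⊗_A k *)
Definition L (i : nat) : Type :=
  tens (N := k^o) (@ractK i) (fun a c => aug a * c).

HB.instance Definition _ i := GRing.Lmodule.on (L i).

Definition dL d (i : nat) (u : L i.+1) : L i :=
  tlift (fun (x : K i.+1) (c : k^o) => pure _ _ (d i x) c) u.

Lemma dL_balanced d i : bimodule_map (d i) ->
  balanced (N := k^o) (@ractK i.+1) (fun a c => aug a * c)
    (fun (x : K i.+1) (c : k^o) => pure _ _ (d i x) c : L i).
Proof.
move=> [_ dr].
have [pl pr pb] := pure_balanced (N := k^o) (@ractK i) (fun a c => aug a * c).
by split=> [c x y e|c x e e'|a x c]; rewrite ?linearP ?pl ?pr ?dr ?pb.
Qed.

Lemma dL_pure d i x c : bimodule_map (d i) ->
  dL d (pure _ _ x c : L i.+1) = pure _ _ (d i x) c.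
Proof. by move=> /dL_balanced/tlift_pure; apply. Qed.

(* L_0 -> k, (a ⊗ w ⊗ b) ⊗ c |-> aug a * w * aug b * c, where w is in J_0 = k. *)
Definition augL (u : L 0) : k^o :=
  tlift (fun (x : K 0) (c : k^o) =>
    (tliftk (fun (y : tensk A (Jsp 0)) (b : A) =>
       (tliftk (fun (a : A) (w : Jsp 0) => (aug a * (\val w : T)@_mone : k^o)) y
        * aug b : k^o)) x * c : k^o)) u.

Definition left_resolution d : Prop :=
  [/\ forall c : k, exists u, augL u = c,
      forall u, augL u = 0 <-> exists v, dL d v = u &
      forall (i : nat) (u : L i.+1), dL d u = 0 <-> exists v, dL d v = u].

End JSpaces.

Definition multi_Koszul (A : gralg k) : Prop :=
  [/\ connected A, locally_finite A &
      exists (p : presentation A) (d : forall i, {linear K p i.+1 -> K p i}),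
        is_delta d /\ left_resolution d].

End MultiKoszul.

(* Main.v *)
(* If B_s = T(V_s)/<R_s>, then A = T(V)/<R> with V the sum of the V_s and R the
   sum of the R_s. An element of J_{2i} lies in every V^(l) (x) R (x) V^(N-l), and
   two consecutive windows of length at least 2 share a letter, so all its words
   have their letters in a single V_s; hence J_i(A) is the sum of the J_i(B_s) for
   i > 0, and the bimodule differentials of the B_s assemble into that of A.
   As A is free as a right B_s-module, the splitting theta_s : A -> A (x) B_s,
   which detaches the longest suffix lying in B_s, carries a contracting homotopy
   h_s of the left complex of B_s to A (x) J_i(B_s); the sum over s of
   (1 (x) h_s) theta_s contracts the left complex of A. *)

From HB Require Import structures.
From mathcomp Require Import all_boot all_algebra.
From mathcomp Require Import boolp classical_sets.
From mathcomp Require Import finmap monalg.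
Require Import Defs.

Set Implicit Arguments.
Unset Strict Implicit.
Unset Printing Implicit Defensive.

Import GRing.Theory.
Local Open Scope classical_set_scope.
Local Open Scope ring_scope.

(** * Linear algebra and tensor products *)

(** [A] is given by its universal property alone, so no normal form of its elements is at hand.
    Freeness of [A] over [B s] is not proved; what is kept of it is a right [B s]-linear section
    [theta] of the multiplication [mu], obtained from an action of the free algebra that kills the
    relations, together with the fact that every word maps to some [a * inj s b] with
    [theta a = tp a 1]. Two obstacles shape the rest. The differential is prescribed on every
    decomposition of an element of [J], and a decomposition may contain tensors that mix letters of
    several V_s; these have to cancel, and they do because a tensor in V^(l) (x) J (x) V^(m) is
    determined by its product. Moreover J_0 = k is common to all factors instead of being a direct
    sum, so in degree 0 every index contributes to the sum over [s]; the homotopies of the factors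
    are therefore normalised to vanish on 1 (x) 1, which leaves just enough terms. *)

Section Linear.
Variable k : fieldType.
Implicit Types U V E F : lmodType k.

Definition mklin U V (f : U -> V) (fl : linear f) : {linear U -> V} :=
  HB.pack f (GRing.isLinear.Build k U V *:%R f fl).

Lemma mklinE U V (f : U -> V) (fl : linear f) x : mklin fl x = f x.
Proof. by []. Qed.

Lemma lin0 U V (f : U -> V) : linear f -> f 0 = 0.
Proof. by move=> fl; exact: (linear0 (mklin fl)). Qed.

Lemma linZ U V (f : U -> V) c x : linear f -> f (c *: x) = c *: f x.
Proof. by move=> fl; rewrite -[c *: x]addr0 fl lin0 // addr0. Qed.

Lemma lZ U V (f : {linear U -> V}) c x : f (c *: x) = c *: f x.
Proof. exact: linZ (linearP f). Qed.

Section Subspace.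
Variables (U : lmodType k) (W : set U).
Hypothesis Wsub : subspace W.

Lemma subspace0 : W 0. Proof. by case: Wsub. Qed.

Lemma subspaceP c x y : W x -> W y -> W (c *: x + y).
Proof. by case: Wsub => _; apply. Qed.

Lemma subspaceD x y : W x -> W y -> W (x + y).
Proof. by move=> Wx Wy; rewrite -[x]scale1r; apply: subspaceP. Qed.

Lemma subspaceZ c x : W x -> W (c *: x).
Proof. by move=> Wx; rewrite -[_ *: _]addr0; apply: subspaceP subspace0. Qed.

Lemma subspaceN x : W x -> W (- x).
Proof. by move=> Wx; rewrite -scaleN1r; apply: subspaceZ. Qed.

Lemma subspaceB x y : W x -> W y -> W (x - y).
Proof. by move=> Wx Wy; apply/subspaceD/subspaceN. Qed.

Lemma subspace_sum I (r : seq I) (P : pred I) (G : I -> U) :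
  (forall i, P i -> W (G i)) -> W (\sum_(i <- r | P i) G i).
Proof. by move=> WG; apply: big_ind => //; [exact: subspace0 | exact: subspaceD]. Qed.

Lemma subspace_sum_seq (I : eqType) (r : seq I) (G : I -> U) :
  (forall i, i \in r -> W (G i)) -> W (\sum_(i <- r) G i).
Proof. by move=> WG; rewrite big_seq; apply: subspace_sum. Qed.

End Subspace.

Lemma subspace_eqlin U V (f g : {linear U -> V}) :
  subspace [set x | f x = g x].
Proof.
split=> [|c x y /= fx fy]; first by rewrite /= !linear0.
by rewrite /= !linearP fx fy.
Qed.

Lemma subspace_preim U V (f : {linear U -> V}) (W : set V) :
  subspace W -> subspace [set x | W (f x)].
Proof.
move=> Wsub; split=> [|c x y /= fx fy]; first by rewrite /= linear0; exact: subspace0.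
by rewrite /= linearP; exact: subspaceP.
Qed.

(* By Zorn: E need not be finite dimensional. *)
Lemma complementP E (K : set E) : subspace K ->
  exists C : set E, [/\ subspace C, forall x, C x -> K x -> x = 0 &
    forall x, exists c, C c /\ K (x - c)].
Proof.
move=> Ks.
pose P (A : set E) := (forall c x y, A x -> A y -> A (c *: x + y)) /\
   (forall x, A x -> K x -> x = 0).
have [|A [[AD AK] Amax]] := @Zorn_bigcup E P.
  move=> G GP Gtot; split=> [c x y [A GA Ax] [A' GA' A'y]|x [A GA Ax]]; last first.
    exact: (GP A GA).2.
  have [AA'|A'A] := Gtot _ _ GA GA'.
    by exists A' => //; apply: (GP A' GA').1 => //; exact: AA'.
  by exists A => //; apply: (GP A GA).1 => //; exact: A'A.
(* The union of the empty chain is empty, so [P] cannot demand [A 0]. [A0] adds the zero vector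
   until [A 0] is established. *)
pose A0 a := A a \/ a = 0.
have A0D c x y : A0 x -> A0 y -> A0 (c *: x + y).
  rewrite /A0 => -[Ax|->] [Ay|->]; rewrite ?scaler0 ?addr0 ?add0r; auto.
  left; have A00 : A (0 : E) by rewrite -[0](addNr x) -scaleN1r; apply: AD.
  by rewrite -[_ *: _]addr0; exact: AD.
(* If [v] is outside [A], maximality excludes A + kv; that set is closed under combinations, so it
   must meet [K] in a nonzero vector. *)
have key v : A v \/ exists a c, [/\ A0 a, K (a + c *: v) & a + c *: v != 0].
  have [Av|nAv] := pselect (A v); [by left|right].
  pose B := [set x | exists a c, A0 a /\ x = a + c *: v].
  have AB : A `<` B.
    split=> [x Ax|BA]; first by exists x, 0; rewrite scale0r addr0; split=> //; left.
    by apply: nAv; apply: BA; exists 0, 1; rewrite scale1r add0r; split=> //; right.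
  have /not_andP[nD|nK] := Amax _ AB.
    case: nD => c _ _ [a [e [Aa ->]]] [a' [e' [Aa' ->]]].
    exists (c *: a + a'), (c * e + e'); split; first exact: A0D.
    by rewrite scalerDr scalerDl scalerA addrACA.
  have [x nx] : exists x, ~ (B x -> K x -> x = 0).
    by apply: contrapT => nex; apply: nK => x Bx Kx;
       apply: contrapT => nx; apply: nex; exists x => /(_ Bx Kx).
  move: nx => /not_implyP[[a [c [Aa xE]]] /not_implyP[Kx /eqP x0]].
  by exists a, c; rewrite -xE.
have A00 : A 0.
  have [//|[a [c [Aa]]]] := key 0.
  rewrite scaler0 addr0 => Ka /eqP a0; case: Aa => // Aa.
  by case: a0; exact: AK.
have A0A a : A0 a -> A a by case=> // ->.
exists A; split=> // v.
have [Av|[a [c [/A0A Aa Kac nz]]]] := key v.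
  by exists v; rewrite subrr; split=> //; exact: subspace0.
have c0 : c != 0.
  apply: contraNneq nz => c0; move: Kac; rewrite c0 scale0r addr0 => Ka.
  by rewrite (AK a).
exists (- c^-1 *: a); split; first by rewrite -[_ *: _]addr0; exact: AD.
have -> : v - - c^-1 *: a = c^-1 *: (a + c *: v).
  by rewrite scaleNr opprK scalerDr scalerA mulVf // scale1r addrC.
exact: subspaceZ.
Qed.

(** [g] picks the preimage lying in a complement of the kernel. Off the image of [f] it takes the
    default value of [xget], so linearity is claimed on the image only. *)
Lemma linear_section E F (f : {linear E -> F}) :
  exists g : F -> E, (forall x, f (g (f x)) = f x) /\
    forall c x y, g (c *: f x + f y) = c *: g (f x) + g (f y).
Proof.
have [|C [Cs CK Cc]] := @complementP E [set x | f x = 0].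
  split=> [|c x y /= fx fy]; first exact: linear0.
  by rewrite /= linearP fx fy scaler0 addr0.
pose g y := xget 0 [set c | C c /\ f c = y].
have gP x : C (g (f x)) /\ f (g (f x)) = f x.
  rewrite /g; case: xgetP => [//|/= none].
  have [c [Cc' /= /eqP]] := Cc x; rewrite linearB /= subr_eq0 => /eqP fE.
  by case: (none c).
have guniq c x : C c -> f c = f x -> g (f x) = c.
  move=> Cc' fE; have [Cg fg] := gP x; apply/eqP; rewrite -subr_eq0; apply/eqP.
  by apply: CK; [exact: subspaceB | rewrite /= linearB /= fg fE subrr].
exists g; split=> [x|c x y]; first exact: (gP x).2.
rewrite -linearP; apply: guniq; first by apply: subspaceP => //; exact: (gP _).1.
by rewrite !linearP !(gP _).2.
Qed.

(** * Exactness and contracting homotopies *)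

Section Complex.
Variables (N : nat -> lmodType k) (d : forall i, {linear N i.+1 -> N i}).
Variables (e : {linear N 0%N -> k^o}) (u : N 0%N).

(** Surjectivity of [e] is kept apart, in the form [e u = 1]. *)
Definition resolution : Prop :=
  [/\ forall x, e x = 0 <-> exists y, d 0 y = x &
      forall i x, d i x = 0 <-> exists y, d i.+1 y = x].

(** The degree 0 identity contracts onto the line of [u]. The normalisation [h 0%N u = 0] is what
    later makes the homotopies of the factors compatible on their common J_0 = k. *)
Definition homotopy (h : forall i, {linear N i -> N i.+1}) : Prop :=
  [/\ h 0%N u = 0, forall x, d 0 (h 0%N x) = x - e x *: u &
      forall i x, d i.+1 (h i.+1 x) + h i (d i x) = x].

Lemma homotopy_resolution h : homotopy h ->
  (forall y, e (d 0 y) = 0) -> (forall i y, d i (d i.+1 y) = 0) -> resolution.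
Proof.
move=> [h1 h0 hS] ed dd; split=> [x|i x]; split=> [x0|[y <-]] //.
  by exists (h 0%N x); rewrite h0 x0 scale0r subr0.
by exists (h i.+1 x); rewrite -[RHS](hS i) x0 linear0 addr0.
Qed.

(** With sections s_i of d_i, the map s_{i+1} (1 - s_i d_i) replaces the recursive s_{i+1} (1 - h_i
    d_i): as consecutive maps compose to 0, h_i and s_i agree on the image of d_i. The sections are
    linear on images only, which suffices because exactness puts x - s_i (d_i x) in the image of
    d_{i+1}. *)
Lemma resolution_homotopy : e u = 1 -> resolution -> exists h, homotopy h.
Proof.
move=> eu [ex0 exS].
pose s i := sval (cid (linear_section (d i))).
have sP i : (forall x, d i (s i (d i x)) = d i x) /\
    forall c x y, s i (c *: d i x + d i y) = c *: s i (d i x) + s i (d i y).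
  exact: svalP (cid (linear_section (d i))).
pose r0 x := x - e x *: u.
have r0l c x y : r0 (c *: x + y) = c *: r0 x + r0 y.
  rewrite /r0 linearP scalerDl scalerBr -scalerA addrACA; congr (_ + _).
  by rewrite opprD.
have r0d x : exists y, d 0 y = r0 x.
  apply/ex0; rewrite /r0 linearB.
  have -> : e (e x *: u) = e x * e u by exact: linearZ.
  by rewrite eu mulr1 subrr.
have h0l : linear (fun x => s 0%N (r0 x)).
  move=> c x y; rewrite r0l; have [x' <-] := r0d x; have [y' <-] := r0d y.
  exact: (sP 0%N).2.
pose r i x := x - s i (d i x).
have rl i c x y : r i (c *: x + y) = c *: r i x + r i y.
  by rewrite /r linearP (sP i).2 scalerBr addrACA opprD.
have rd i x : exists y, d i.+1 y = r i x.
  by apply/exS; rewrite /r linearB /= (sP i).1 subrr.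
have hSl i : linear (fun x => s i.+1 (r i x)).
  move=> c x y; rewrite rl; have [x' <-] := rd i x; have [y' <-] := rd i y.
  exact: (sP i.+1).2.
pose h i : {linear N i -> N i.+1} :=
  match i return {linear N i -> N i.+1} with
  | 0 => mklin h0l | i'.+1 => mklin (hSl i') end.
have s0 i : s i 0 = 0.
  by have := (sP i).2 (-1) 0 0; rewrite linear0 scaler0 addr0 scaleN1r addNr.
exists h; split=> [|x|i x].
- by rewrite mklinE /r0 eu scale1r subrr s0.
- by rewrite mklinE; have [y yE] := r0d x; rewrite -yE (sP 0%N).1 yE.
- rewrite mklinE; have [y yE] := rd i x; rewrite -yE (sP i.+1).1 yE.
  suff -> : h i (d i x) = s i (d i x) by rewrite subrK.
  case: i x y yE => [|i] x y yE /=; rewrite /r0 /r.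
    by have -> : e (d 0 x) = 0; [apply/ex0; exists x | rewrite scale0r subr0].
  by have -> : d i (d i.+1 x) = 0; [apply/exS; exists x | rewrite s0 subr0].
Qed.

End Complex.

End Linear.

Section TensorInduction.
Variables (k : fieldType).

Lemma tens_ind (A : algType k) (M N : lmodType k) (ra : M -> A -> M)
    (la : A -> N -> N) (Q : set (tens ra la)) :
  subspace Q -> (forall m n, Q (pure ra la m n)) -> forall u, Q u.
Proof.
move=> Qs Qp u; rewrite -[u]lpiK; move: (repr u) => x.
rewrite [x]monalgE raddf_sum; apply: subspace_sum => // -[m n] _.
have -> : << x@_(m, n) *g (m, n) >> = x@_(m, n) *: << (m, n) >>.
  by apply/malgP => p; rewrite mcoeffZ !mcoeffU mulrnAr mulr1.
have lZ c y : lpi (tens_rel ra la) (c *: y) = c *: lpi _ y by exact: linearZ.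
change (Q (lpi (tens_rel ra la) (x@_(m, n) *: << (m, n) >>))).
rewrite lZ; apply: subspaceZ => //; exact: Qp.
Qed.

Section TensK.
Variables M N : lmodType k.

Lemma tensk_ind (Q : set (tensk M N)) :
  subspace Q -> (forall m n, Q (purek m n)) -> forall u, Q u.
Proof. exact: tens_ind. Qed.

Lemma tensk_eq (P : lmodType k) (f g : {linear tensk M N -> P}) :
  (forall m n, f (purek m n) = g (purek m n)) -> f =1 g.
Proof. by move=> fg; apply: tensk_ind => //; exact: subspace_eqlin. Qed.

Lemma tensk_eqfun (P : lmodType k) (f g : tensk M N -> P) :
  linear f -> linear g ->
  (forall m n, f (purek m n) = g (purek m n)) -> f =1 g.
Proof. by move=> fl gl; exact: (@tensk_eq P (mklin fl) (mklin gl)). Qed.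

End TensK.

Lemma tlin_ex (M N P : lmodType k) (f : M -> N -> P) (fb : bilin f) :
  exists g : {linear tensk M N -> P}, forall m n, g (purek m n) = f m n.
Proof. by exists (mklin (tliftk_linear fb)) => m n; exact: tliftk_pure. Qed.

Definition tlin (M N P : lmodType k) (f : M -> N -> P) (fb : bilin f) :
  {linear tensk M N -> P} := sval (cid (tlin_ex fb)).

Lemma tlinE (M N P : lmodType k) (f : M -> N -> P) (fb : bilin f) m n :
  tlin fb (purek m n) = f m n.
Proof. exact: svalP (cid (tlin_ex fb)) m n. Qed.

End TensorInduction.

Section SealedTensor.
Variable k : fieldType.
Implicit Types M N P : lmodType k.

(* Only the universal property is exported: letting the unifier unfold the
   quotient construction of tensk makes rewriting in it prohibitively slow. *)
Record tensor_data M N := TensorData {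
  td_mod : lmodType k;
  td_pure : M -> N -> td_mod;
  td_bilin : bilin td_pure;
  td_lift : forall P (f : M -> N -> P), bilin f ->
    exists g : {linear td_mod -> P}, forall m n, g (td_pure m n) = f m n;
  td_ind : forall Q : set td_mod, subspace Q ->
    (forall m n, Q (td_pure m n)) -> forall u, Q u
}.

(** Closed by [Qed] although it carries data: the opaque witness is what keeps the quotient out of
    the unifier's sight. *)
Lemma tensor_exists M N : tensor_data M N.
Proof.
apply: (@TensorData M N (tensk M N) (@purek k M N)).
- exact: purek_bilin.
- by move=> P f fb; exact: tlin_ex.
- exact: tensk_ind.
Qed.

Definition tsr M N : lmodType k := td_mod (tensor_exists M N).

Definition tp M N (m : M) (n : N) : tsr M N := td_pure (tensor_exists M N) m n.

Section Theory.
Variables M N : lmodType k.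

Lemma tpPl c m m' n : tp (c *: m + m') n = c *: tp m n + tp m' n :> tsr M N.
Proof. exact: (td_bilin (tensor_exists M N)).1. Qed.

Lemma tpPr c m n n' : tp m (c *: n + n') = c *: tp m n + tp m n' :> tsr M N.
Proof. exact: (td_bilin (tensor_exists M N)).2. Qed.

Lemma tsr_ind (Q : set (tsr M N)) :
  subspace Q -> (forall m n, Q (tp m n)) -> forall u, Q u.
Proof. exact: td_ind. Qed.

Lemma tsr_eq P (f g : tsr M N -> P) : linear f -> linear g ->
  (forall m n, f (tp m n) = g (tp m n)) -> f =1 g.
Proof.
move=> fl gl fg; apply: tsr_ind => //.
exact: (subspace_eqlin (mklin fl) (mklin gl)).
Qed.

Definition tplin P (f : M -> N -> P) (fb : bilin f) : {linear tsr M N -> P} :=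
  sval (cid (td_lift (tensor_exists M N) fb)).

Lemma tplinE P (f : M -> N -> P) (fb : bilin f) m n : tplin fb (tp m n) = f m n.
Proof. exact: (svalP (cid (td_lift (tensor_exists M N) fb))). Qed.

Definition tpL (n : N) : {linear M -> tsr M N} := mklin (fun c m m' => tpPl c m m' n).

Definition tpR (m : M) : {linear N -> tsr M N} := mklin (fun c n n' => tpPr c m n n').

Lemma tpRE (m : M) n : tpR m n = tp m n. Proof. by []. Qed.

End Theory.

Lemma tpmap_bilin M N M' N' (f : {linear M -> M'}) (g : {linear N -> N'}) :
  bilin (fun m n => tp (f m) (g n)).
Proof. by split=> *; rewrite linearP (tpPl, tpPr). Qed.

Definition tpmap M N M' N' (f : {linear M -> M'}) (g : {linear N -> N'}) :
  {linear tsr M N -> tsr M' N'} := tplin (tpmap_bilin f g).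

Lemma tpmapE M N M' N' (f : {linear M -> M'}) (g : {linear N -> N'}) m n :
  tpmap f g (tp m n) = tp (f m) (g n).
Proof. exact: tplinE. Qed.

End SealedTensor.

(** * The free algebra *)

Lemma scalerAr_regular (k : fieldType) (c : k) (x y : k^o) :
  x * (c *: y) = c *: (x * y).
Proof. exact: mulrCA. Qed.

Lemma lin_comb (k : fieldType) (U W : lmodType k) (f : U -> W) (I : Type)
    (r : seq I) (c : I -> k) (g : I -> U) : linear f ->
  f (\sum_(i <- r) c i *: g i) = \sum_(i <- r) c i *: f (g i).
Proof.
move=> fl; have := linear_sum (mklin fl) r xpredT (fun i => c i *: g i).
by rewrite mklinE => ->; apply: eq_bigr => i _; rewrite linearZ.
Qed.

Section Free.
Variables (k : fieldType) (X : choiceType).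
Local Notation T := {malg k[{fmonom X}]}.
Local Notation V := (gens k X).
Implicit Types (s u : seq X) (t x y : T).

Definition wd s : T := << FMonom s >>.

Lemma mcoeff_monom (c : k) (m m' : {fmonom X}) :
  << c *g m >>@_m' = c *+ (m == m') :> k.
Proof. exact: mcoeffU. Qed.

Lemma malgZU (c c' : k) (m : {fmonom X}) : c *: << c' *g m >> = << c * c' *g m >> :> T.
Proof.
apply/malgP=> m'; rewrite [LHS]mcoeffZ [RHS]mcoeff_monom [X in _ * X]mcoeff_monom.
by rewrite -mulrnAr.
Qed.

Lemma malgUM (c c' : k) (m m' : {fmonom X}) :
  << c *g m >> * << c' *g m' >> = << c * c' *g mmul m m' >> :> T.
Proof.
by rewrite (malgMEw msuppU_le msuppU_le) !big_seq_fset1 !mcoeffUU.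
Qed.

Lemma wd_nil : wd [::] = 1.
Proof. by congr << _ >>; apply: val_inj; rewrite /= fm1. Qed.

Lemma wd_cat s u : wd (s ++ u) = wd s * wd u.
Proof.
by rewrite malgUM mulr1; congr << _ >>; apply: val_inj; rewrite /= fmM.
Qed.

Lemma wd1 a : wd [:: a] = << fmu a >>.
Proof. by congr << _ >>; apply: val_inj; rewrite /= fmU. Qed.

Lemma wd_fm (m : {fmonom X}) : << m >> = wd m.
Proof. by congr << _ >>; rewrite fmK. Qed.

Lemma wdE s u : (wd s)@_(FMonom u) = (s == u)%:R.
Proof. by rewrite /wd mcoeffU. Qed.

Lemma malg_sum t : t = \sum_(m <- msupp t) t@_m *: wd m.
Proof.
by rewrite {1}[t]monalgE; apply: eq_bigr => m _; rewrite -wd_fm malgZU mulr1.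
Qed.

(** The span of the words in [P]. Conditions on length, degree or letters are all phrased this way,
    so that linear statements reduce to single words by [supp_ind]. *)
Definition supp (P : set (seq X)) : set T :=
  [set t | forall w : {fmonom X}, w \in msupp t -> P w].

Lemma supp_coeff P t : supp P t <-> forall u, t@_(FMonom u) != 0 -> P u.
Proof.
split=> [Pt u|Pt w wt]; first by rewrite mcoeff_neq0 => /Pt.
by have := Pt w; rewrite fmK mcoeff_neq0; apply.
Qed.

Lemma supp_subspace P : subspace (supp P).
Proof.
split=> [w|c x y /supp_coeff Px /supp_coeff Py]; first by rewrite msupp0.
apply/supp_coeff => u; rewrite mcoeffD mcoeffZ.
have [x0|/Px//] := eqVneq x@_(FMonom u) 0.
by rewrite x0 mulr0 add0r; exact: Py.
Qed.

Lemma supp_wd (P : set (seq X)) s : P s -> supp P (wd s).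
Proof.
move=> Ps; apply/supp_coeff => u; rewrite wdE.
by case: (s =P u) => [<- //|_]; rewrite /= eqxx.
Qed.

Lemma supp_sub (P Q : set (seq X)) : P `<=` Q -> supp P `<=` supp Q.
Proof. by move=> PQ t Pt w /Pt/PQ. Qed.

Lemma supp_ind P (Q : set T) : subspace Q -> (forall s, P s -> Q (wd s)) ->
  forall t, supp P t -> Q t.
Proof.
move=> Qs Qw t Pt; rewrite [t]malg_sum; apply: subspace_sum_seq => // m mt.
by apply: subspaceZ => //; apply/Qw/Pt.
Qed.

Lemma malg_ind (Q : set T) : subspace Q -> (forall s, Q (wd s)) ->
  forall t, Q t.
Proof. by move=> Qs Qw t; apply: (@supp_ind setT) => // w. Qed.

Lemma malgAr (c : k) x y : x * (c *: y) = c *: (x * y).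
Proof.
rewrite (malgMEw (fsubset_refl _) (msuppZ_le c y)) malgME scaler_sumr.
apply: eq_bigr => m _; rewrite scaler_sumr; apply: eq_bigr => m' _.
by rewrite mcoeffZ malgZU mulrCA.
Qed.

Section LinearExtension.
Variables (U : lmodType k) (g : seq X -> U).

Lemma lext_subproof : linear (fun t => \sum_(m <- msupp t) t@_m *: g m).
Proof.
have lextEw t (d : {fset {fmonom X}}) : (msupp t `<=` d)%fset ->
    \sum_(m <- msupp t) t@_m *: g m = \sum_(m <- d) t@_m *: g m.
  move=> sd; apply: big_fset_incl => // p _ px.
  by rewrite (mcoeff_outdom px) scale0r.
move=> c x y; pose d := (msupp x `|` msupp y `|` msupp (c *: x + y))%fset.
rewrite (@lextEw _ d) ?fsubsetUr // (@lextEw x d); last first.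
  by rewrite /d -fsetUA fsubsetUl.
rewrite (@lextEw y d); last by rewrite /d -fsetUA fsetUCA fsubsetUl.
rewrite scaler_sumr -big_split; apply: eq_bigr => p _ /=.
by rewrite mcoeffD mcoeffZ scalerDl scalerA.
Qed.

Lemma lext_ex : exists f : {linear T -> U}, forall s, f (wd s) = g s.
Proof.
exists (mklin lext_subproof) => s.
by rewrite mklinE msuppU oner_eq0 big_seq_fset1 wdE eqxx scale1r.
Qed.

Definition lext : {linear T -> U} := sval (cid lext_ex).

Lemma lext_wd s : lext (wd s) = g s.
Proof. exact: svalP (cid lext_ex) s. Qed.

End LinearExtension.

Lemma malg_eq (U : lmodType k) (f g : {linear T -> U}) :
  (forall s, f (wd s) = g (wd s)) -> f =1 g.
Proof. by move=> fg; apply: malg_ind => //; exact: subspace_eqlin. Qed.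

Lemma supp_eq P (U : lmodType k) (f g : {linear T -> U}) :
  (forall s, P s -> f (wd s) = g (wd s)) -> forall t, supp P t -> f t = g t.
Proof. by move=> fg; apply: supp_ind => //; exact: subspace_eqlin. Qed.

Section Mult.
Variable D : lalgType k.
Lemma mulRl_subproof (a : D) : linear (fun x : D => x * a).
Proof. by move=> c x y; rewrite mulrDl -scalerAl. Qed.
Definition mulRl a : {linear D -> D} := mklin (mulRl_subproof a).

Hypothesis DAr : forall (c : k) (x y : D), x * (c *: y) = c *: (x * y).
Lemma mulLl_subproof (a : D) : linear (fun x : D => a * x).
Proof. by move=> c x y; rewrite mulrDr DAr. Qed.
Definition mulLl a : {linear D -> D} := mklin (mulLl_subproof a).
End Mult.

Section Eval.
Variables (D : lalgType k) (phi : X -> D).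
Hypothesis DAr : forall (c : k) (x y : D), x * (c *: y) = c *: (x * y).

Definition evl : {linear T -> D} := lext (fun s => \prod_(a <- s) phi a).

Lemma linear_monoid (f : {linear T -> D}) : f 1 = 1 ->
  (forall s u, f (wd s * wd u) = f (wd s) * f (wd u)) -> GRing.monoid_morphism f.
Proof.
move=> f1 fM; split=> // x y.
apply: (malg_eq (f := f \o mulRl y) (g := mulRl (f y) \o f)) x => s.
apply: (malg_eq (f := f \o mulLl malgAr (wd s)) (g := mulLl DAr (f (wd s)) \o f)) y => u.
exact: fM.
Qed.

Lemma evl_monoid : GRing.monoid_morphism evl.
Proof.
apply: linear_monoid => [|s u]; first by rewrite -wd_nil lext_wd big_nil.
by rewrite -wd_cat !lext_wd big_cat.
Qed.

Lemma ev_ex : exists f : {lrmorphism T -> D}, forall s, f (wd s) = \prod_(a <- s) phi a.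
Proof.
pose f : {lrmorphism T -> D} := HB.pack (evl : T -> D) (GRing.Linear.on evl)
  (GRing.isMonoidMorphism.Build T D evl evl_monoid).
by exists f => s; exact: lext_wd.
Qed.

Definition ev : {lrmorphism T -> D} := sval (cid ev_ex).

Lemma ev_wd s : ev (wd s) = \prod_(a <- s) phi a.
Proof. exact: svalP (cid ev_ex) s. Qed.

Lemma ev_gen a : ev (wd [:: a]) = phi a.
Proof. by rewrite ev_wd big_seq1. Qed.

End Eval.

Lemma lrmorph_wd (D : lalgType k) (f : {lrmorphism T -> D}) s :
  f (wd s) = \prod_(a <- s) f (wd [:: a]).
Proof.
elim: s => [|a s IHs]; first by rewrite wd_nil rmorph1 big_nil.
by rewrite -cat1s wd_cat rmorphM /= IHs big_cons.
Qed.

Lemma lrmorph_eq (D : lalgType k) (f g : {lrmorphism T -> D}) :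
  (forall a, f (wd [:: a]) = g (wd [:: a])) -> f =1 g.
Proof.
move=> fg; apply: malg_eq => s; rewrite [LHS]lrmorph_wd [RHS]lrmorph_wd.
by apply: eq_bigr => a _; rewrite fg.
Qed.

Lemma tmul_sub (W1 W2 W : set T) : subspace W ->
  (forall x y, W1 x -> W2 y -> W (x * y)) -> tmul W1 W2 `<=` W.
Proof. by move=> Ws WM; apply: span_sub => // _ [x [y [x1 y2 ->]]]; apply: WM. Qed.

Lemma tmulM (W1 W2 : set T) x y : W1 x -> W2 y -> tmul W1 W2 (x * y).
Proof. by move=> x1 y2; apply: span_incl; exists x, y. Qed.

Lemma supp_mul (P Q : set (seq X)) x y : supp P x -> supp Q y ->
  supp [set s | exists u v, [/\ P u, Q v & s = u ++ v]] (x * y).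
Proof.
move=> Px Qy w /msuppM_le[u [v [/Px Pu /Qy Qv ->]]].
by exists u, v; rewrite fmM.
Qed.

Lemma gens_supp t : V t <-> supp [set s | size s = 1%N] t.
Proof.
split.
  move: t; apply: span_sub; first exact: supp_subspace.
  by move=> _ [a _ <-]; rewrite -wd1; apply: supp_wd.
move: t; apply: supp_ind; first exact: subspace_span.
by move=> [|a [|//]] // _; apply: span_incl; exists a => //; rewrite wd1.
Qed.

Lemma tpowS (W : set T) n : tpow W n.+1 = tmul W (tpow W n).
Proof. by rewrite /tpow big_ord_recl. Qed.

Lemma tpow_supp n t : tpow V n t -> supp [set s | size s = n] t.
Proof.
elim: n t => [|n IHn] t.
  rewrite /tpow big_ord0; move: t; apply: span_sub; first exact: supp_subspace.
  by move=> _ ->; rewrite -wd_nil; apply: supp_wd.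
rewrite tpowS; move: t; apply: tmul_sub; first exact: supp_subspace.
move=> x y /gens_supp Vx /IHn Vy; apply: supp_sub (supp_mul Vx Vy).
by move=> _ [u [v [/= su sv ->]]] /=; rewrite size_cat su sv.
Qed.

Lemma tpow_wd s : tpow V (size s) (wd s).
Proof.
elim: s => [|a s IHs]; first by rewrite /tpow big_ord0 wd_nil; apply: span_incl.
rewrite tpowS -cat1s wd_cat; apply: tmulM; last exact: IHs.
by apply/gens_supp; apply: supp_wd.
Qed.

Lemma tlen_ge_supp n t : tlen_ge k X n t <-> supp [set s | (n <= size s)%N] t.
Proof.
split; move: t.
  apply: span_sub; first exact: supp_subspace.
  by move=> t [i /= ni /tpow_supp]; apply: supp_sub => s /= ->.
apply: supp_ind; first exact: subspace_span.
by move=> s sn; apply: span_incl; exists (size s) => //; exact: tpow_wd.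
Qed.

Lemma mcoeff_linear (m : {fmonom X}) : linear (mcoeff m : T -> k^o).
Proof. by move=> c x y; rewrite mcoeffD mcoeffZ. Qed.

Definition mcl (m : {fmonom X}) : {linear T -> k^o} := mklin (mcoeff_linear m).

(** All words of [x] have length [n], so [u ++ s] can be cut in one place only and the convolution
    has a single term. *)
Lemma coeff_mull n x y u s : supp [set s | size s = n] x -> size u = n ->
  (x * y)@_(FMonom (u ++ s)) = x@_(FMonom u) * y@_(FMonom s).
Proof.
move=> + su; apply: (supp_eq (f := mcl (FMonom (u ++ s)) \o mulRl y)
  (g := mulRl (y@_(FMonom s) : k^o) \o mcl (FMonom u))) => v sv.
apply: (malg_eq (f := mcl (FMonom (u ++ s)) \o mulLl malgAr (wd v))
  (g := mulLl (@scalerAr_regular k) ((wd v)@_(FMonom u) : k^o) \o mcl (FMonom s))) y => w.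
change ((wd v * wd w)@_(FMonom (u ++ s)) =
  (wd v)@_(FMonom u) * (wd w)@_(FMonom s)).
by rewrite -wd_cat !wdE eqseq_cat ?sv ?su // -natrM mulnb.
Qed.

Lemma coeff_mulr n x y u s : supp [set s | size s = n] y -> size u = n ->
  (x * y)@_(FMonom (s ++ u)) = x@_(FMonom s) * y@_(FMonom u).
Proof.
move=> + su; apply: (supp_eq (f := mcl (FMonom (s ++ u)) \o mulLl malgAr x)
  (g := mulLl (@scalerAr_regular k) (x@_(FMonom s) : k^o) \o mcl (FMonom u))) => v sv.
apply: (malg_eq (f := mcl (FMonom (s ++ u)) \o mulRl (wd v))
  (g := mulRl ((wd v)@_(FMonom u) : k^o) \o mcl (FMonom s))) x => w.
change ((wd w * wd v)@_(FMonom (s ++ u)) =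
  (wd w)@_(FMonom s) * (wd v)@_(FMonom u)).
rewrite -wd_cat !wdE -natrM mulnb; congr (nat_of_bool _)%:R.
(* Only the length of the right factor is prescribed. If [w] and [s] differ in length both sides
   vanish, since equal concatenations would force equal lengths. *)
have [sE|sN] := eqVneq (size w) (size s); first by rewrite eqseq_cat.
have wsN : (w == s) = false by apply: contraNF sN => /eqP->.
rewrite wsN /=; apply: contraNF sN => /eqP/(congr1 size).
by rewrite !size_cat sv su => /addIn->.
Qed.

(* V^(l) (x) J (x) V^(m) embeds in T(V): a word of length at least l + m splits
   uniquely, so a tensor is determined by its product. *)
Lemma tensor3_eq0 (J U : lmodType k) (v : {linear J -> T}) l m
    (r : seq (T * J * T)) (F : T -> J -> T -> U) :
  injective v ->
  (forall j b, linear (fun a => F a j b)) ->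
  (forall a b, linear (fun j => F a j b)) ->
  (forall a j, linear (fun b => F a j b)) ->
  (forall q, q \in r -> tpow V l q.1.1 /\ tpow V m q.2) ->
  \sum_(q <- r) q.1.1 * v q.1.2 * q.2 = 0 ->
  \sum_(q <- r) F q.1.1 q.1.2 q.2 = 0.
Proof.
move=> vI Fl Fm Fr rP r0.
(* [c u w] is the vector of [J] standing between the words [u] and [w]. For lengths [l] and [m], the
   coefficients of its image under [v] are those of the total product at the words [u ++ x ++ w],
   hence 0. *)
pose c (u w : {fmonom X}) := \sum_(q <- r) (q.1.1@_u * q.2@_w) *: q.1.2.
have c0 (u w : {fmonom X}) : size u = l -> size w = m -> c u w = 0.
  move=> su sw; apply: vI; rewrite linear0 linear_sum; apply/malgP => x.
  rewrite mcoeff0 raddf_sum /=.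
  have := congr1 (mcoeff (FMonom (u ++ (x ++ w)))) r0.
  rewrite mcoeff0 raddf_sum => E; rewrite -[RHS]E; rewrite !big_seq.
  apply: eq_bigr => q /rP[/tpow_supp ql /tpow_supp qm].
  have E1 : (q.1.1 * v q.1.2 * q.2)@_(FMonom (u ++ (x ++ w))) =
      q.1.1@_u * ((v q.1.2)@_x * q.2@_w).
    by rewrite -mulrA (coeff_mull _ _ ql su) (coeff_mulr _ _ qm sw) !fmK.
  have -> : v ((q.1.1@_u * q.2@_w) *: q.1.2) = (q.1.1@_u * q.2@_w) *: v q.1.2.
    exact: linearZ.
  by rewrite mcoeffZ mulrAC -[LHS]mulrA; symmetry; exact: E1.
have Fw q : F q.1.1 q.1.2 q.2 =
  \sum_(u <- msupp q.1.1) \sum_(w <- msupp q.2)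
     (q.1.1@_u * q.2@_w) *: F (wd u) q.1.2 (wd w).
  transitivity (F (\sum_(m <- msupp q.1.1) q.1.1@_m *: wd m) q.1.2 q.2).
    by rewrite -malg_sum.
  etransitivity; first exact: (@lin_comb k T U (fun a => F a q.1.2 q.2) _
    (msupp q.1.1) (fun m => q.1.1@_m) (fun m : {fmonom X} => wd m) (Fl q.1.2 q.2)).
  apply: eq_bigr => u _.
  have -> : F (wd u) q.1.2 q.2 =
      \sum_(w <- msupp q.2) q.2@_w *: F (wd u) q.1.2 (wd w).
    transitivity (F (wd u) q.1.2 (\sum_(m <- msupp q.2) q.2@_m *: wd m)).
      by rewrite -malg_sum.
    exact: (lin_comb _ _ _ (Fr (wd u) q.1.2)).
  by rewrite scaler_sumr; apply: eq_bigr => w _; rewrite scalerA.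
(* The summands have different supports; indexing them all by the same lists of words allows the sum
   over [r] to move inside. *)
pose du := flatten [seq (msupp q.1.1 : seq {fmonom X}) | q <- r].
pose dw := flatten [seq (msupp q.2 : seq {fmonom X}) | q <- r].
have Fd q : q \in r -> F q.1.1 q.1.2 q.2 =
  \sum_(u <- undup du) \sum_(w <- undup dw)
     (q.1.1@_u * q.2@_w) *: F (wd u) q.1.2 (wd w).
  move=> qr; rewrite Fw.
  have sub (t : T) (d : seq {fmonom X}) (G : {fmonom X} -> U) :
      {subset (msupp t : seq {fmonom X}) <= d} ->
      (forall m0, t@_m0 = 0 -> G m0 = 0) ->
      \sum_(m0 <- msupp t) G m0 = \sum_(m0 <- undup d) G m0.
    move=> sd G0; rewrite [RHS](bigID (mem (msupp t))) /=.
    rewrite [X in _ + X]big1 ?addr0 => [|u]; last first.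
      by rewrite -mcoeff_eq0 => /eqP; exact: G0.
    rewrite -[RHS]big_filter; apply: perm_big; apply: uniq_perm.
    - exact: fset_uniq.
    - by rewrite filter_uniq ?undup_uniq.
    - move=> u; rewrite mem_filter mem_undup.
      by case: (boolP (u \in msupp t)) => //= /sd ->.
  rewrite (@sub _ du) => [|u ut|u u0]; last 2 first.
  - by apply/flatten_mapP; exists q.
  - by rewrite big1 // => w _; rewrite u0 mul0r scale0r.
  apply: eq_bigr => u _; apply: sub => [w wt|w w0].
  - by apply/flatten_mapP; exists q.
  - by rewrite w0 mulr0 scale0r.
rewrite big_seq (eq_bigr _ Fd) -big_seq exchange_big big1 // => u _.
rewrite exchange_big big1 // => w _.
have -> : \sum_(q <- r) (q.1.1@_u * q.2@_w) *: F (wd u) q.1.2 (wd w) =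
    F (wd u) (c u w) (wd w).
  by symmetry; exact: (lin_comb _ _ _ (Fm (wd u) (wd w))).
have [su|su] := eqVneq (size u) l; last first.
  suff -> : c u w = 0 by exact: (linear0 (mklin (Fm _ _))).
  rewrite /c big_seq big1 // => q /rP[/tpow_supp ql _].
  have -> : q.1.1@_u = 0; last by rewrite mul0r scale0r.
  by apply/eqP; rewrite mcoeff_eq0; apply: contra su => /ql/eqP.
have [sw|sw] := eqVneq (size w) m; last first.
  suff -> : c u w = 0 by exact: (linear0 (mklin (Fm _ _))).
  rewrite /c big_seq big1 // => q /rP[_ /tpow_supp qm].
  have -> : q.2@_w = 0; last by rewrite mulr0 scale0r.
  by apply/eqP; rewrite mcoeff_eq0; apply: contra sw => /qm/eqP.
by rewrite c0 //; exact: (linear0 (mklin (Fm _ _))).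
Qed.

End Free.

Arguments relsp {k A} p _.
Arguments deg {k A} p _.
Arguments J {k A} p i _.
Arguments Jeven {k A} p n _.
Arguments Jodd {k A} p n _.
Arguments Jnext {k A} p i E _.

(** * The spaces J *)

Section SpanMap.
Variables (k : fieldType) (U V : lmodType k) (f : {linear U -> V}).

Lemma span_map (P : set U) (Q : set V) :
  (forall x, P x -> Q (f x)) -> forall x, span P x -> span Q (f x).
Proof.
move=> PQ; apply: span_sub; first exact: subspace_preim (subspace_span Q).
by move=> x /PQ/span_incl.
Qed.

End SpanMap.

Section FreeMap.
Variables (k : fieldType) (X Y : choiceType).
Variable f : {lrmorphism {malg k[{fmonom X}]} -> {malg k[{fmonom Y}]}}.
Local Notation maps P Q := (forall t, P t -> Q (f t)).

Lemma tmul_map W1 W1' W2 W2' : maps W1 W1' -> maps W2 W2' ->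
  maps (tmul W1 W2) (tmul W1' W2').
Proof.
move=> f1 f2; apply: span_map => _ [x [y [x1 y2 ->]]].
by exists (f x), (f y); rewrite rmorphM; split; [exact: f1 | exact: f2 |].
Qed.

Lemma tone_map : maps (tone k X) (tone k Y).
Proof. by apply: span_map => _ ->; rewrite /= rmorph1. Qed.

Lemma big_tmul_map n (F : 'I_n -> set _) (F' : 'I_n -> set _) :
  (forall i, maps (F i) (F' i)) ->
  maps (\big[@tmul k X/tone k X]_(i < n) F i) (\big[@tmul k Y/tone k Y]_(i < n) F' i).
Proof.
elim: n F F' => [|n IHn] F F' FF' t.
  by rewrite !big_ord0; exact: tone_map.
rewrite !big_ord_recl; apply: tmul_map; first exact: FF'.
by apply: IHn => i; exact: FF'.
Qed.

Lemma tpow_map W W' n : maps W W' -> maps (tpow W n) (tpow W' n).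
Proof. by move=> WW'; apply: big_tmul_map. Qed.

End FreeMap.

Lemma val_Jsp_linear (k : fieldType) (A : gralg k) (p : presentation A) i :
  linear (fun w : Jsp p i => \val w : {malg k[{fmonom (gen p)}]}).
Proof. by []. Qed.

Definition Jval (k : fieldType) (A : gralg k) (p : presentation A) i :
  {linear Jsp p i -> {malg k[{fmonom (gen p)}]}} := mklin (@val_Jsp_linear k A p i).

Section JMap.
Variables (k : fieldType) (A B : gralg k) (p : presentation A) (q : presentation B).
Variable f : {lrmorphism {malg k[{fmonom (gen p)}]} -> {malg k[{fmonom (gen q)}]}}.
Hypothesis fV : forall t, gens k (gen p) t -> gens k (gen q) (f t).
Hypothesis fR : forall t, relsp p t -> relsp q (f t).

(** An algebra map respects products and spans and sends an intersection into the intersection of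
    the images; so once V goes to V and R to R, J goes to J. This serves both the inclusions and the
    retractions of the free product. *)
Lemma Jnext_map i E E' : (forall n t, (n <= i)%N -> E n t -> E' n (f t)) ->
  forall t, Jnext p i E t -> Jnext q i E' (f t).
Proof.
move=> EE' t [tE tR]; split; last exact: tpow_map tR.
move: t tE {tR}; apply: span_map => t [N /= N0 tN]; exists N => //= n m sn sm.
apply: (tmul_map _ _ (tN n m sn sm)); last exact: tpow_map.
apply: big_tmul_map => j; apply: tmul_map; first exact: tpow_map.
by move=> x; apply: EE'; rewrite -[leqRHS]sn (bigD1 j) //= leq_addr.
Qed.

Lemma Jeven_map n t : Jeven p n t -> Jeven q n (f t).
Proof.
elim/ltn_ind: n t => -[|[|n]] IHn t; [exact: tone_map | exact: fR |].
by rewrite !JevenE //; apply: Jnext_map => m x mn; exact: IHn.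
Qed.

Lemma J_map i t : J p i t -> J q i (f t).
Proof.
rewrite /J; case: odd; last exact: Jeven_map.
case=> tl tr; split.
  by apply: tmul_map tl => // x; exact: Jeven_map.
by apply: tmul_map tr => // x; exact: Jeven_map.
Qed.

Definition JspM i (w : Jsp p i) : Jsp q i :=
  Sub (f (\val w)) (mem_set (J_map (set_mem (valP w)))).

Lemma val_JspM i (w : Jsp p i) : \val (JspM w) = f (\val w).
Proof. exact: SubK. Qed.

Lemma JspM_linear i : linear (@JspM i).
Proof.
move=> c x y; apply: val_inj.
transitivity (f (c *: \val x + \val y)); first exact: val_JspM.
transitivity (c *: f (\val x) + f (\val y)); first exact: linearP.
by rewrite -(val_JspM x) -(val_JspM y).
Qed.

Definition Jmap i : {linear Jsp p i -> Jsp q i} := mklin (@JspM_linear i).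

Lemma val_Jmap i (w : Jsp p i) : \val (Jmap i w) = f (\val w).
Proof. exact: val_JspM. Qed.

End JMap.

(** * Words whose letters lie over one index *)

Section Mono.
Variables (k : fieldType) (S : eqType) (X : choiceType) (col : X -> S).

(** The empty word is excluded: it lies over every index at once and would spoil the decomposition
    by index. *)
Definition mono : set (seq X) :=
  [set s | s <> [::] /\ exists c, forall a, a \in s -> col a = c].

Definition mono2 : set (seq X) := [set s | mono s /\ (2 <= size s)%N].

(* Consecutive windows overlap because m >= 2. *)
Lemma mono_windows N m (s : seq X) : (2 <= m)%N -> size s = (N + m)%N ->
  (forall l, (l <= N)%N -> mono (take m (drop l s))) -> mono s.
Proof.
move=> m2; elim: N s => [|N IHN] s ss H.
  by have := H 0%N isT; rewrite drop0 take_oversize // ss.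
case: s ss H => [//|a s] [ss] H.
have [|sN [c cs]] := IHN s ss; first by move=> l lN; exact: (H l.+1).
split=> //; exists c.
have [_ [c' c's]] := H 0%N isT.
case: m m2 ss {IHN} H c's => [//|[//|m]] _ ss _ /=.
case: s ss sN cs => [//|b s] ss _ cs c's.
have ac : col a = c.
  rewrite (c's a) ?mem_head // -(c's b) ?(cs b) ?mem_head //.
  by rewrite /= !inE eqxx orbT.
by move=> x; rewrite inE => /orP[/eqP->//|/cs].
Qed.

Definition window l N (P : set (seq X)) : set (seq X) :=
  [set s | exists u x v, [/\ size u = l, P x, size v = (N - l)%N & s = u ++ x ++ v]].

(** Relations may have different word lengths, so the middle factor has no fixed size. For a given
    word, however, it has size [m = size s - N] whatever [l] is, and the fixed-length statement
    [mono_windows] applies. *)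
Lemma window_mono N s : (forall l, (l <= N)%N -> window l N mono2 s) -> mono2 s.
Proof.
move=> H; pose m := (size s - N)%N.
have [u [x [v [su [x1 x2] sv sE]]]] := H 0%N isT.
have ss : size s = (N + m)%N.
  by rewrite /m subnKC // sE !size_cat sv subn0 addnA leq_addl.
have mE : m = size x.
  by rewrite /m sE !size_cat su sv subn0 add0n addnK.
split; last by rewrite ss mE (leq_trans x2) // leq_addl.
apply: (@mono_windows N m) => //; first by rewrite mE.
move=> l lN; have [u' [x' [v' [su' [x1' x2'] sv' sE']]]] := H l lN.
suff -> : take m (drop l s) = x' by [].
have -> : m = size x'.
  apply/eqP; rewrite -(eqn_add2l N) -ss sE' !size_cat su' sv'.
  by rewrite addnCA subnKC // addnC.
by rewrite sE' -su' drop_size_cat // take_size_cat.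
Qed.

Lemma window_supp l N (W : set {malg k[{fmonom X}]}) P : (forall t, W t -> supp P t) ->
  forall u x v, tpow (gens k X) l u -> W x -> tpow (gens k X) (N - l) v ->
  supp (window l N P) (u * x * v).
Proof.
move=> WP u x v /tpow_supp su /WP Px /tpow_supp sv.
have := supp_mul (supp_mul su Px) sv; apply: supp_sub.
move=> s [_ [b [[c [d [/= sc Pd ->]]] sb ->]]].
by exists c, d, b; rewrite catA.
Qed.

Lemma tmul_supp_nil W1 W2 : (forall t, W1 t -> supp [set [::] : seq X] t) ->
  (forall t, W2 t -> supp [set [::] : seq X] t) ->
  forall t : {malg k[{fmonom X}]}, tmul W1 W2 t -> supp [set [::] : seq X] t.
Proof.
move=> H1 H2; apply: tmul_sub; first exact: supp_subspace.
move=> x y /H1 xn /H2 yn; apply: supp_sub (supp_mul xn yn).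
by move=> s [u [v [/= -> -> ->]]].
Qed.

Lemma tone_supp_nil (t : {malg k[{fmonom X}]}) : tone k X t -> supp [set [::] : seq X] t.
Proof.
move: t; apply: span_sub; first exact: supp_subspace.
by move=> _ ->; rewrite -wd_nil; exact: supp_wd.
Qed.

(** Handles the padding factors V^(0) (x) J_0 that remain for the tuples used in [Jeven_mono2]:
    together they contribute scalars only. *)
Lemma big_tmul_supp_nil n (F : 'I_n -> set {malg k[{fmonom X}]}) :
  (forall i t, F i t -> supp [set [::] : seq X] t) ->
  forall t, (\big[@tmul k X/tone k X]_(i < n) F i) t -> supp [set [::] : seq X] t.
Proof.
elim: n F => [|n IHn] F HF t; first by rewrite big_ord0; exact: tone_supp_nil.
by rewrite big_ord_recl; apply: tmul_supp_nil; [exact: HF|apply: IHn => i; exact: HF].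
Qed.

End Mono.

Section MonoJ.
Variables (k : fieldType) (S : eqType) (A : gralg k) (p : presentation A).
Variable col : gen p -> S.
Hypothesis Rmono : forall t, relsp p t -> supp (mono col) t.

Lemma Rmono2 t : relsp p t -> supp (mono2 col) t.
Proof.
move=> Rt w wt; split; first exact: Rmono wt.
by have /tlen_ge_supp := rel_ge2 Rt; exact.
Qed.

(* The tuples n = (i+1, 0, ..., 0) and m = (l, 0, ..., 0, N - l) give the windows
   V^(l) (x) J (x) V^(N-l). *)
Lemma Jeven_mono2 i t : Jeven p i.+1 t -> supp (mono2 col) t.
Proof.
elim: i t => [|i IHi] t; first exact: Rmono2.
rewrite JevenE // => -[+ _]; move: t; apply: span_sub; first exact: supp_subspace.
move=> t [N /= N0 tN] w wt; apply: (@window_mono _ _ col N) => l lN.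
pose n j := if j == 0%N then i.+1 else 0%N.
pose m j := if j == 0%N then l else if j == i.+1 then (N - l)%N else 0%N.
have sn : (\sum_(j < i.+1) n j)%N = i.+1.
  by rewrite big_ord_recl big1 ?addn0.
have sm : (\sum_(j < i.+2) m j)%N = N.
  rewrite big_ord_recl big_ord_recr /= big1 => [|j _]; last first.
    by rewrite /m /= /bump /= add1n eqSS ltn_eqF.
  by rewrite /m /bump /= add1n eqxx add0n subnKC.
have := tN n m sn sm; rewrite big_ord_recl.
have -> : m i.+1 = (N - l)%N by rewrite /m eqxx.
move=> tw; move: w wt; rewrite -/(supp _ t); move: t tw {tN}.
apply: tmul_sub; first exact: supp_subspace.
move=> x v xw sv; move: x xw.
have Ps := supp_subspace k (window l N (mono2 col)).
have Pv : subspace [set x | supp (window l N (mono2 col)) (x * v)].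
  exact: (subspace_preim (mulRl v)) Ps.
apply: (tmul_sub Pv) => x e xw ew.
have {ew} en : supp [set [::]] e.
  move: e ew; apply: big_tmul_supp_nil => j; apply: tmul_supp_nil => // y.
    have -> : m (lift ord0 j) = 0%N.
      by rewrite /m /= /bump /= add1n eqSS ltn_eqF.
    by rewrite /tpow big_ord0; exact: tone_supp_nil.
  by rewrite /n /=; exact: tone_supp_nil.
move: x xw; have Pe : subspace [set x | supp (window l N (mono2 col)) (x * e * v)].
  exact: (subspace_preim (mulRl v \o mulRl e)) Ps.
apply: (tmul_sub Pe) => u x uw xw.
have /= := supp_mul (supp_mul (supp_mul (tpow_supp uw) (IHi _ xw)) en) (tpow_supp sv).
apply: supp_sub => s [_ [b [[_ [c [[d [g [/= sd Pg ->]]] -> ->]]] sb ->]]].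
by exists d, g, b; rewrite cats0 catA.
Qed.

(** For odd [i] the two descriptions J_{i-1} (x) V and V (x) J_{i-1} are the windows [l = 0] and
    [l = 1] for [N = 1], so the overlap argument covers this case too. *)
Lemma J_mono2 i t : (1 < i)%N -> J p i t -> supp (mono2 col) t.
Proof.
rewrite /J; case: (boolP (odd i)) => io i1; last first.
  by case: i io i1 => [|[|i]] //= _ _; exact: Jeven_mono2.
have -> : i./2 = (i./2).-1.+1.
  by case: i io i1 => [|[|[|i]]].
move=> [tl tr] w wt; apply: (@window_mono _ _ col 1) => l l1.
have Ps := supp_subspace k (window l 1 (mono2 col)).
suff : supp (window l 1 (mono2 col)) t by apply.
case: l l1 Ps => [|[|//]] _ Ps.
  move: t tr {tl wt}; apply: (tmul_sub Ps) => x v xw /gens_supp sv.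
  apply: supp_sub (supp_mul (Jeven_mono2 xw) sv) => s [c [d [Pc /= sd ->]]].
  by exists [::], c, d.
move: t tl {tr wt}; apply: (tmul_sub Ps) => v x /gens_supp sv xw.
apply: supp_sub (supp_mul sv (Jeven_mono2 xw)) => s [c [d [/= sc Pd ->]]].
by exists c, d, [::]; rewrite cats0.
Qed.

Lemma J1_supp t : J p 1 t <-> gens k (gen p) t.
Proof.
rewrite /J /= /Jodd JevenE0; split=> [[+ _]|Vt].
  move: t; apply: tmul_sub; first exact: subspace_span.
  move=> x y Vx; move: y; apply: span_sub.
    exact: (subspace_preim (mulLl (@malgAr k _) x)) (subspace_span _).
  by move=> _ ->; rewrite /= mulr1.
split; first by rewrite -[t]mulr1; apply: tmulM => //; exact: span_incl.
by rewrite -[t]mul1r; apply: tmulM => //; exact: span_incl.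
Qed.

(** J_1 = V consists of single letters, too short for overlapping windows but trivially over one
    index. *)
Lemma J_mono i t : (0 < i)%N -> J p i t -> supp (mono col) t.
Proof.
case: i => [//|[|i]] _; last first.
  by move=> /(@J_mono2 i.+2 t isT); apply: supp_sub => s [].
move=> /J1_supp/gens_supp; apply: supp_sub => -[|a [|//]] // _.
by split=> //; exists (col a) => b; rewrite inE => /eqP->.
Qed.

End MonoJ.

(** * Quotient algebras *)

Section Lift.
Variable k : fieldType.

Definition mklr (D C : lalgType k) (f : D -> C) (fl : linear f)
    (fm : GRing.monoid_morphism f) : {lrmorphism D -> C} :=
  HB.pack f (GRing.isLinear.Build k D C *:%R f fl)
    (GRing.isMonoidMorphism.Build D C f fm).

Lemma lift_linear (D U V : lmodType k) (q : {linear D -> U}) (f : {linear D -> V}) :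
  (forall b, exists t, q t = b) -> (forall t, q t = 0 -> f t = 0) ->
  exists g : {linear U -> V}, forall t, g (q t) = f t.
Proof.
move=> qs qf; pose h b := sval (cid (qs b)).
have hP b : q (h b) = b by exact: svalP (cid (qs b)).
have fh t : f (h (q t)) = f t.
  by apply/eqP; rewrite -subr_eq0 -linearB qf // linearB /= hP subrr.
have gl : linear (f \o h).
  move=> c b b'; rewrite /= -linearP -[RHS]fh; congr (f (h _)).
  by rewrite linearP /= !hP.
by exists (mklin gl) => t; rewrite mklinE /= fh.
Qed.

Lemma lift_lrmorph (D U C : lalgType k) (q : {lrmorphism D -> U})
    (f : {lrmorphism D -> C}) :
  (forall b, exists t, q t = b) -> (forall t, q t = 0 -> f t = 0) ->
  exists g : {lrmorphism U -> C}, forall t, g (q t) = f t.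
Proof.
move=> qs qf; have [g gE] := lift_linear qs qf.
suff gm : GRing.monoid_morphism g by exists (mklr (linearP g) gm).
split=> [|a b]; first by rewrite -(rmorph1 q) gE rmorph1.
have [[x <-] [y <-]] := (qs a, qs b).
by rewrite -rmorphM !gE rmorphM.
Qed.

End Lift.

Section QuotientAlgebra.
Variables (k : fieldType) (X : choiceType).
Local Notation T := {malg k[{fmonom X}]}.

(** [ts_proper] supplies 1 != 0, which the ring structure on the quotient demands. *)
Record twosided := Twosided {
  ts_set : set T;
  ts_sub : subspace ts_set;
  ts_mull : forall x y, ts_set y -> ts_set (x * y);
  ts_mulr : forall x y, ts_set x -> ts_set (x * y);
  ts_proper : ~ ts_set 1
}.

Variable I : twosided.

Definition qalg : Type := lquot (ts_set I).

HB.instance Definition _ := GRing.Lmodule.on qalg.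

Definition qpi (x : T) : qalg := lpi (ts_set I) x.

Lemma qpiP x y : qpi x = qpi y <-> ts_set I (x - y).
Proof.
split=> [/lpiP|xy]; last by apply/lpiP/span_incl.
by apply: span_sub => //; exact: ts_sub.
Qed.

Lemma qpi_linear : linear qpi. Proof. exact: lpi_linear. Qed.

Lemma qpiK (u : qalg) : qpi (repr u) = u. Proof. exact: lpiK. Qed.

Definition qmul (u v : qalg) : qalg := qpi (repr u * repr v).

Lemma qmul_pi x y : qmul (qpi x) (qpi y) = qpi (x * y).
Proof.
apply/qpiP; set x' := repr _; set y' := repr _.
have -> : x' * y' - x * y = x' * (y' - y) + (x' - x) * y.
  by rewrite mulrBr mulrBl addrA subrK.
apply: (subspaceD (ts_sub I)); [apply: ts_mull | apply: ts_mulr].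
  by apply/qpiP; rewrite qpiK.
by apply/qpiP; rewrite qpiK.
Qed.

Lemma qpiD x y : qpi (x + y) = qpi x + qpi y.
Proof. by have := qpi_linear 1 x y; rewrite !scale1r. Qed.

Lemma qpiZ c x : qpi (c *: x) = c *: qpi x.
Proof. exact: (linZ c x qpi_linear). Qed.

Lemma qmulA : associative qmul.
Proof.
by move=> u v w; rewrite -[u]qpiK -[v]qpiK -[w]qpiK !qmul_pi mulrA.
Qed.

Lemma qmul1 : left_id (qpi 1) qmul.
Proof. by move=> u; rewrite -[u]qpiK qmul_pi mul1r. Qed.

Lemma qmulr1 : right_id (qpi 1) qmul.
Proof. by move=> u; rewrite -[u]qpiK qmul_pi mulr1. Qed.

Lemma qmulDl : left_distributive qmul +%R.
Proof.
by move=> u v w; rewrite -[u]qpiK -[v]qpiK -[w]qpiK -qpiD !qmul_pi -qpiD mulrDl.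
Qed.

Lemma qmulDr : right_distributive qmul +%R.
Proof.
by move=> u v w; rewrite -[u]qpiK -[v]qpiK -[w]qpiK -qpiD !qmul_pi -qpiD mulrDr.
Qed.

Lemma qone_neq0 : qpi 1 != 0 :> qalg.
Proof.
apply/eqP => E; apply: (ts_proper (t := I)); rewrite -[1]subr0.
by apply/qpiP; rewrite E; symmetry; exact: (linear0 (mklin qpi_linear)).
Qed.

HB.instance Definition _ := GRing.Zmodule_isNzRing.Build qalg
  qmulA qmul1 qmulr1 qmulDl qmulDr qone_neq0.

Lemma qpi_ex (u : qalg) : exists x, u = qpi x.
Proof. by exists (repr u); rewrite qpiK. Qed.

Lemma qscalerAl c (u v : qalg) : c *: (u * v) = (c *: u) * v.
Proof.
have [[x ->] [y ->]] := (qpi_ex u, qpi_ex v).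
transitivity (qmul (qpi (c *: x)) (qpi y)); last by rewrite -qpiZ.
by rewrite qmul_pi -scalerAl qpiZ -qmul_pi.
Qed.

HB.instance Definition _ := GRing.Lmodule_isLalgebra.Build k qalg qscalerAl.

Lemma qscalerAr c (u v : qalg) : c *: (u * v) = u * (c *: v).
Proof.
have [[x ->] [y ->]] := (qpi_ex u, qpi_ex v).
transitivity (qmul (qpi x) (qpi (c *: y))); last by rewrite -qpiZ.
by rewrite qmul_pi malgAr qpiZ -qmul_pi.
Qed.

HB.instance Definition _ := GRing.Lalgebra_isAlgebra.Build k qalg qscalerAr.

Lemma qpi_monoid : GRing.monoid_morphism qpi.
Proof. by split=> [|x y]; [|symmetry; exact: qmul_pi]. Qed.

Definition qproj : {lrmorphism T -> qalg} := mklr qpi_linear qpi_monoid.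

Lemma qproj_surj u : exists t, qproj t = u.
Proof. by exists (repr u); exact: qpiK. Qed.

Lemma qproj_eq0 t : qproj t = 0 <-> ts_set I t.
Proof.
change (qpi t = 0 <-> ts_set I t).
by rewrite -{2}[t]subr0 -qpiP (lin0 qpi_linear).
Qed.

End QuotientAlgebra.

Lemma seq_bound (I : eqType) (F : I -> nat) (r : seq I) :
  exists N, forall i, i \in r -> (F i < N)%N.
Proof.
elim: r => [|i r [N rN]]; first by exists 0%N.
exists (maxn (F i).+1 N) => j; rewrite inE leq_max => /orP[/eqP->|/rN->].
  by rewrite leqnn.
by rewrite orbT.
Qed.

(** * Homogeneous components and graded quotients *)

Section HomogeneousComponents.
Variables (k : fieldType) (X : choiceType) (deg : X -> nat).
Local Notation T := {malg k[{fmonom X}]}.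

Definition wdeg (s : seq X) : nat := (\sum_(x <- s) deg x)%N.

Lemma tgr_supp n (t : T) : tgr deg n t <-> supp [set s | wdeg s = n] t.
Proof. by []. Qed.

Definition hcomp n : {linear T -> T} :=
  lext (fun s => if wdeg s == n then wd k s else 0).

Lemma hcomp_wd n s : hcomp n (wd k s) = if wdeg s == n then wd k s else 0.
Proof. exact: lext_wd. Qed.

Lemma hcomp_tgr n t : tgr deg n (hcomp n t).
Proof.
have Ss := supp_subspace k [set s | wdeg s = n].
move: t; apply: malg_ind; first exact: subspace_preim (Ss).
move=> s /=; rewrite hcomp_wd; case: eqP => [sn|_]; last exact: subspace0 Ss.
by apply/tgr_supp; apply: supp_wd.
Qed.

Lemma hcomp_id m n t : tgr deg m t -> hcomp n t = if m == n then t else 0.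
Proof.
move=> tm; case: eqP tm => [->|mn] /tgr_supp tm.
  apply: (supp_eq (f := hcomp n) (g := idfun) _ tm) => s /= sn.
  by rewrite hcomp_wd sn eqxx.
apply: (supp_eq (f := hcomp n) (g := \0) _ tm) => s /= sm.
by rewrite hcomp_wd; case: eqP => // sn; case: mn; rewrite -sm.
Qed.

(** The sum may be taken up to any larger bound; [gr_prj] uses this to get a prescribed degree among
    the summands. *)
Lemma hcomp_sum t :
  exists N, forall M, (N <= M)%N -> t = \sum_(n < M) hcomp n t.
Proof.
have [N tN] := seq_bound (fun w : {fmonom X} => wdeg w) (msupp t).
exists N => M NM; have {}tN : supp [set s | (wdeg s < M)%N] t.
  by move=> w /tN wN; exact: leq_trans wN NM.
move: t tN; apply: supp_ind.
  split=> [|c x y hx hy]; rewrite /mkset.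
    by rewrite big1 // => n _; rewrite linear0.
  transitivity (\sum_(n < M) (c *: hcomp n x + hcomp n y)).
    by rewrite big_split -scaler_sumr -hx -hy.
  by apply: eq_bigr => n _; rewrite linearP.
move=> s /= sM; rewrite (bigD1 (Ordinal sM)) //= hcomp_wd eqxx big1 ?addr0 // => n.
by rewrite hcomp_wd -val_eqE /= eq_sym => /negbTE->.
Qed.

Definition homogeneous (W : set T) := forall n t, W t -> W (hcomp n t).

(** By linearity it is enough to treat [wd u * r * wd v] with [r] a homogeneous relation; such a
    product is homogeneous, so a component of it is either itself or 0. *)
Lemma tideal_homogeneous (R : set T) :
  R `<=` span (\bigcup_n (R `&` tgr deg n)) -> homogeneous (tideal R).
Proof.
move=> Rh n t; have Is : subspace (tideal R) by exact: subspace_span.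
have Hs : subspace [set t | tideal R (hcomp n t)] by exact: subspace_preim (Is).
move: t; apply: (tmul_sub Hs) => y b yR _; move: y yR.
apply: (tmul_sub (subspace_preim (mulRl b) Hs)) => a r _ Rr.
rewrite /mulRl /=; move: r Rr.
suff H : forall r, span (\bigcup_n (R `&` tgr deg n)) r ->
    tideal R (hcomp n (a * r * b)) by move=> r /Rh/H.
apply: (span_sub (subspace_preim (mulRl b \o mulLl (@malgAr k X) a) Hs)).
move=> r [m _ [Rr rm]]; rewrite /=.
have Ha := subspace_preim (mulRl b \o mulRl r) Hs.
move: a; apply: (malg_ind Ha) => u.
have Hb := subspace_preim (mulLl (@malgAr k X) (wd k u * r)) Hs.
move: b {Ha}; apply: (malg_ind Hb) => v.
rewrite /= (@hcomp_id (wdeg u + m + wdeg v)).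
  case: eqP => _; last exact: subspace0.
  by apply: tmulM => //; apply: tmulM.
have {}rm : supp [set s | wdeg s = m] r by [].
have := supp_mul (supp_mul (@supp_wd k X [set u] u erefl) rm) (@supp_wd k X [set v] v erefl).
move=> H; apply/tgr_supp; move: H.
apply: supp_sub => s [_ [_ [[_ [x [-> /= xm ->]]] -> ->]]].
by rewrite /= /wdeg !big_cat /= -xm.
Qed.

End HomogeneousComponents.

Arguments hcomp {k X} deg n.

Section GradedQuotient.
Variables (k : fieldType) (X : choiceType) (deg : X -> nat) (I : twosided k X).
Hypothesis Ih : homogeneous deg (ts_set I).
Local Notation T := {malg k[{fmonom X}]}.

Definition qgr n : set (qalg I) := [set qproj I t | t in tgr deg n].

Lemma qgr_subspace n : subspace (qgr n).
Proof.
have Ss := supp_subspace k [set s | wdeg deg s = n].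
split=> [|c _ _ [x xn <-] [y yn <-]].
  by exists 0; [exact: subspace0 Ss | exact: linear0].
by exists (c *: x + y); [exact: (subspaceP Ss) | exact: linearP].
Qed.

Lemma qgr1 : qgr 0%N 1.
Proof.
exists 1; last exact: rmorph1.
by apply/tgr_supp; rewrite -wd_nil; apply: supp_wd; rewrite /= /wdeg big_nil.
Qed.

Lemma tgrM m n (x y : T) : tgr deg m x -> tgr deg n y -> tgr deg (m + n) (x * y).
Proof.
move=> /tgr_supp xm /tgr_supp yn; apply/tgr_supp.
apply: supp_sub (supp_mul xm yn) => s [u [v [/= um vn ->]]].
by rewrite /= /wdeg big_cat -um -vn.
Qed.

Lemma qgrM m n a b : qgr m a -> qgr n b -> qgr (m + n)%N (a * b).
Proof.
move=> [x xm <-] [y yn <-]; exists (x * y); first exact: tgrM.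
exact: rmorphM.
Qed.

Lemma qgr_span a : exists N (c : nat -> qalg I),
  (forall n, qgr n (c n)) /\ a = \sum_(n < N) c n.
Proof.
have [t <-] := qproj_surj a; have [N tN] := hcomp_sum deg t.
have {}tN := tN N (leqnn N).
exists N, (fun n => qproj I (hcomp deg n t)); split=> [n|].
  by exists (hcomp deg n t) => //; exact: hcomp_tgr.
by rewrite {1}tN; exact: raddf_sum.
Qed.

(** Homogeneous lifts of the [c m] add up to an element of the ideal. Its degree [n] component is
    the lift of [c n], and it stays in the ideal by homogeneity. *)
Lemma qgr_direct N (c : nat -> qalg I) : (forall n, qgr n (c n)) ->
  \sum_(n < N) c n = 0 -> forall n, (n < N)%N -> c n = 0.
Proof.
move=> cq c0 n nN.
pose t n := sval (cid2 (cq n)).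
have tn m : tgr deg m (t m) by exact: (s2valP (cid2 (cq m))).
have tc m : qproj I (t m) = c m by exact: (s2valP' (cid2 (cq m))).
have : ts_set I (\sum_(m < N) t m).
  apply/qproj_eq0; rewrite raddf_sum -[RHS]c0; apply: eq_bigr => m _.
  exact: tc.
move=> /(Ih n); rewrite linear_sum (bigD1 (Ordinal nN)) //= big1 ?addr0 => [|m].
  rewrite (hcomp_id n (tn n)) eqxx => Itn; rewrite -tc.
  exact/qproj_eq0.
rewrite -val_eqE /= => mn; rewrite (hcomp_id n (tn m)).
by rewrite (negbTE mn).
Qed.

Definition qgralg : gralg k :=
  GrAlg qgr_subspace qgr1 qgrM qgr_span qgr_direct.

End GradedQuotient.

Section Ideal.
Variables (k : fieldType) (X : choiceType) (R : set {malg k[{fmonom X}]}).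
Local Notation T := {malg k[{fmonom X}]}.

Lemma tideal_subspace : subspace (tideal R).
Proof. exact: subspace_span. Qed.

Lemma tideal_sub (W : set T) : subspace W ->
  (forall a r b, R r -> W (a * r * b)) -> tideal R `<=` W.
Proof.
move=> Ws WR; apply: (tmul_sub Ws) => y b yR _; move: y yR.
by apply: (tmul_sub (subspace_preim (mulRl b) Ws)) => a r _; exact: WR.
Qed.

Lemma tideal_gen a r b : R r -> tideal R (a * r * b).
Proof. by move=> Rr; apply: tmulM => //; apply: tmulM. Qed.

Lemma tideal_incl r : R r -> tideal R r.
Proof. by move=> /(@tideal_gen 1 r 1); rewrite mul1r mulr1. Qed.

Lemma tideal_mull x y : tideal R y -> tideal R (x * y).
Proof.
move: y; apply: tideal_sub.
  exact: (subspace_preim (mulLl (@malgAr k X) x) tideal_subspace).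
by move=> a r b Rr /=; rewrite !mulrA; exact: tideal_gen.
Qed.

Lemma tideal_mulr x y : tideal R x -> tideal R (x * y).
Proof.
move: x; apply: tideal_sub.
  exact: (subspace_preim (mulRl y) tideal_subspace).
by move=> a r b Rr /=; rewrite -mulrA; exact: tideal_gen.
Qed.

Hypothesis R2 : R `<=` supp [set s | (2 <= size s)%N].

Lemma tideal_ge2 t : tideal R t -> supp [set s | (2 <= size s)%N] t.
Proof.
move: t; apply: tideal_sub; first exact: supp_subspace.
move=> a r b /R2 r2.
have sT (x : T) : supp setT x by [].
apply: supp_sub (supp_mul (supp_mul (sT a) r2) (sT b)).
move=> s [_ [v [[u [w [_ /= w2 ->]]] _ ->]]] /=.
by rewrite !size_cat (leq_trans w2) // -addnA addnCA leq_addr.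
Qed.

Lemma tideal_proper : ~ tideal R 1.
Proof.
move=> /tideal_ge2/supp_coeff/(_ [::]).
rewrite -wd_nil wdE eqxx; have -> : (true%:R : k) != 0 by exact: oner_neq0.
by move=> /(_ isT).
Qed.

Definition tideal_twosided : twosided k X :=
  Twosided tideal_subspace tideal_mull tideal_mulr tideal_proper.

End Ideal.

(** * Presentation of the free product *)

Section FreeProduct.
Variables (k : fieldType) (S : finType) (B : S -> gralg k).
Variable p : forall s, presentation (B s).

Definition fgen : choiceType := {s : S & gen (p s)}.

Local Notation T := {malg k[{fmonom fgen}]}.
Local Notation Ts s := {malg k[{fmonom (gen (p s))}]}.

Definition fin s (g : gen (p s)) : fgen := Tagged (fun s => gen (p s)) g.

Definition iota s : {lrmorphism Ts s -> T} :=
  ev (fun g => wd k [:: fin g] : T) (@malgAr k _).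

(** [untag] sends letters over other indices to its default 0; this is what makes [rho s] an algebra
    retraction of [iota s]. *)
Definition rho s : {lrmorphism T -> Ts s} :=
  ev (fun x : fgen => untag 0 (fun g : gen (p s) => wd k [:: g]) x) (@malgAr k _).

Definition fmono : set (seq fgen) := mono (fun x : fgen => tag x).

Lemma iota_gen s (g : gen (p s)) : iota s (wd k [:: g]) = wd k [:: fin g].
Proof. exact: ev_gen. Qed.

Lemma rho_gen s (g : gen (p s)) : rho s (wd k [:: fin g]) = wd k [:: g].
Proof.
rewrite /rho ev_gen (untagE _ _ (erefl : tag (fin g) = s)).
by congr (wd k [:: _]).
Qed.

Lemma rho_gen_neq s (x : fgen) : tag x != s -> rho s (wd k [:: x]) = 0.
Proof. by move=> xs; rewrite /rho ev_gen untag_dflt. Qed.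

Lemma rhoK s t : rho s (iota s t) = t.
Proof.
apply: (lrmorph_eq (f := rho s \o iota s) (g := idfun)) t => g.
by rewrite /= iota_gen rho_gen.
Qed.

Lemma rho_wd_neq s (u : seq fgen) x : x \in u -> tag x != s -> rho s (wd k u) = 0.
Proof.
elim: u => [//|y u IHu]; rewrite inE -cat1s wd_cat rmorphM /= => /orP[/eqP<-|xu] xs.
  by rewrite rho_gen_neq // mul0r.
by rewrite (IHu xu xs) mulr0.
Qed.

Lemma iota_wd s (u : seq (gen (p s))) : iota s (wd k u) = wd k [seq fin g | g <- u].
Proof.
elim: u => [|g u IHu]; first by rewrite !wd_nil rmorph1.
by rewrite -cat1s wd_cat rmorphM /= IHu iota_gen -wd_cat.
Qed.

Lemma rho_iota_neq s s' t : s' != s -> supp [set u | u <> [::]] t ->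
  rho s' (iota s t) = 0.
Proof.
move=> ss'; apply: (supp_eq (f := rho s' \o iota s) (g := \0)) => -[//|g u] _ /=.
by rewrite iota_wd (@rho_wd_neq _ _ (fin g)) ?mem_head // eq_sym.
Qed.

Lemma iota_mono s t : supp [set u | u <> [::]] t -> supp fmono (iota s t).
Proof.
move: t; apply: supp_ind; first exact: subspace_preim (supp_subspace _ _).
move=> u u0 /=; rewrite iota_wd; apply: supp_wd; split; first by case: u u0.
by exists s => _ /mapP[g _ ->].
Qed.

Lemma iota_rho s (u : seq fgen) : (forall x, x \in u -> tag x = s) ->
  iota s (rho s (wd k u)) = wd k u.
Proof.
elim: u => [|[s' g] u IHu] us; first by rewrite wd_nil !rmorph1.
have s's : s' = s by exact: us (mem_head _ _).
rewrite -cat1s wd_cat !rmorphM /= IHu => [|x xu]; last first.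
  by apply: us; rewrite inE xu orbT.
congr (_ * _); move: g {us IHu}; rewrite s's => g.
by rewrite (@rho_gen s g) iota_gen.
Qed.

(** [iota s \o rho s] fixes the words over [s] and kills every nonempty word over another index, so
    on [fmono] these maps are complementary projections. *)
Lemma mono_sum t : supp fmono t -> t = \sum_s iota s (rho s t).
Proof.
have fl : linear (fun t : T => \sum_s iota s (rho s t)).
  move=> c x y; rewrite scaler_sumr -big_split; apply: eq_bigr => s _.
  by rewrite (linearP (rho s)) (linearP (iota s)).
apply: (supp_eq (f := idfun) (g := mklin fl)) => u [u0 [s us]].
change (wd k u = \sum_s iota s (rho s (wd k u))).
rewrite (bigD1 s) //= iota_rho // big1 ?addr0 // => s' s's.
case: u u0 us => [//|x u] _ us.
rewrite (@rho_wd_neq _ _ x) ?mem_head ?linear0 //.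
by rewrite us ?mem_head // eq_sym.
Qed.

(** The sum of the R_s, described through its projections: [rho s] then carries relations to
    relations by definition, and [mono_sum] recovers the summands. *)
Definition frel : set T :=
  [set t | supp fmono t /\ forall s, relsp (p s) (rho s t)].

Lemma relsp_ge2 s t : relsp (p s) t -> supp [set u | (2 <= size u)%N] t.
Proof. by move=> /rel_ge2/tlen_ge_supp. Qed.

Lemma supp_ne (X : choiceType) m (t : {malg k[{fmonom X}]}) :
  supp [set u | (m < size u)%N] t -> supp [set u | u <> [::]] t.
Proof. by apply: supp_sub => -[]. Qed.

Lemma relsp_ne s t : relsp (p s) t -> supp [set u | u <> [::]] t.
Proof. by move=> /relsp_ge2/supp_ne. Qed.

Lemma frel_subspace : subspace frel.
Proof.
have Ms := supp_subspace k fmono.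
split=> [|c x y [xm xr] [ym yr]].
  by split=> [|s]; [exact: subspace0 Ms | rewrite linear0; exact: subspace0 (rel_subspace _)].
split=> [|s]; first exact: (subspaceP Ms).
by rewrite (linearP (rho s)); exact: (subspaceP (rel_subspace _)).
Qed.

Lemma iota_frel s r : relsp (p s) r -> frel (iota s r).
Proof.
move=> rs; have r0 := relsp_ne rs; split=> [|s']; first exact: iota_mono.
have [->|ss'] := eqVneq s' s; first by rewrite rhoK.
by rewrite rho_iota_neq //; exact: subspace0 (rel_subspace _).
Qed.

Definition fdeg (x : fgen) : nat := deg (p (tag x)) (tagged x).

Lemma iota_tgr s n t : tgr (deg (p s)) n t -> tgr fdeg n (iota s t).
Proof.
move=> /tgr_supp tn; apply/tgr_supp; move: t tn.
apply: supp_ind; first exact: subspace_preim (supp_subspace _ _).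
move=> u /= un; rewrite iota_wd; apply: supp_wd.
by rewrite /= -un /wdeg big_map.
Qed.

Lemma frel_graded : frel `<=` span (\bigcup_n (frel `&` tgr fdeg n)).
Proof.
move=> t [tm tr]; rewrite (mono_sum tm).
apply: subspace_sum => [|s _]; first exact: subspace_span.
apply: (span_map _ (rel_graded (tr s))) => r [n _ [rr rn]].
by exists n => //; split; [exact: iota_frel | exact: iota_tgr].
Qed.

Lemma iota_gens s t : gens k _ t -> gens k _ (iota s t).
Proof.
move=> /gens_supp t1; apply/gens_supp; move: t t1.
apply: supp_ind; first exact: subspace_preim (supp_subspace _ _).
by move=> u /= u1; rewrite iota_wd; apply: supp_wd; rewrite /= size_map.
Qed.

Lemma rho_gens s t : gens k _ t -> gens k _ (rho s t).
Proof.
have Vs (X : choiceType) : subspace (gens k X) by exact: subspace_span.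
move=> /gens_supp; move: t; apply: supp_ind.
  exact: subspace_preim (Vs _).
move=> [|[s' g] [|//]] //= _; have [ss'|ss'] := eqVneq s' s.
  move: g; rewrite ss' => g; rewrite (@rho_gen s g).
  by apply: span_incl; exists g => //; rewrite wd1.
by rewrite rho_gen_neq //; exact: subspace0 (Vs _).
Qed.

Lemma tlen_map (X Y : choiceType)
    (f : {lrmorphism {malg k[{fmonom X}]} -> {malg k[{fmonom Y}]}}) n :
  (forall t, gens k X t -> gens k Y (f t)) ->
  forall t, tlen_ge k X n t -> tlen_ge k Y n (f t).
Proof.
move=> fV; apply: span_map => t [i ni ti]; exists i => //.
exact: tpow_map ti.
Qed.

Lemma frel_ge2 : frel `<=` tlen_ge k fgen 2.
Proof.
move=> t [tm tr]; rewrite (mono_sum tm).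
apply: subspace_sum => [|s _]; first exact: subspace_span.
by apply: (tlen_map (iota_gens (s := s))); apply: rel_ge2.
Qed.

(** [rho s] carries the forbidden sum for [frel] into the one for R_s, so minimality of R_s gives
    [rho s t = 0] for each [s], and [t] is the sum of its components. *)
Lemma frel_min : frel `&` span (tmul (tmul (tlen_ge k fgen 1) frel) setT `|`
    tmul (tmul setT frel) (tlen_ge k fgen 1)) = [set 0].
Proof.
apply/seteqP; split=> [t [[tm tr] tI]|_ ->]; last first.
  by split; [exact: subspace0 frel_subspace | exact: subspace0 (subspace_span _)].
rewrite /= (mono_sum tm) big1 // => s _.
suff -> : rho s t = 0 by rewrite linear0.
suff : [set 0] (rho s t) by [].
rewrite -(rel_min (p s)); split=> //.
have len := tlen_map (@rho_gens s).
apply: span_map tI => x [] xI; [left | right].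
  apply: tmul_map xI => // y; apply: tmul_map; first exact: len.
  by move=> z [_ /(_ s)].
apply: tmul_map xI; last exact: len.
by move=> y; apply: tmul_map => // z [_ /(_ s)].
Qed.

Definition fideal : twosided k fgen :=
  tideal_twosided (R := frel) (fun t tr => (tlen_ge_supp _ _).1 (frel_ge2 tr)).

Lemma fideal_homogeneous : homogeneous fdeg (ts_set fideal).
Proof. exact: (tideal_homogeneous frel_graded). Qed.

Lemma iota_fideal s t : tideal (relsp (p s)) t -> ts_set fideal (iota s t).
Proof.
move: t; apply: tideal_sub.
  exact: (subspace_preim (iota s) (tideal_subspace _)).
move=> a r b /iota_frel rr; rewrite /= !rmorphM.
exact: tideal_gen.
Qed.

End FreeProduct.

Arguments frel {k S B} p _.
Arguments fideal {k S B} p.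
Arguments fdeg {k S B} p x.

(** * Graded algebras covered by a free algebra *)

Section GradedSurjection.
Variables (k : fieldType) (X : choiceType) (deg : X -> nat) (A : gralg k).
Local Notation T := {malg k[{fmonom X}]}.
Variable prj : {lrmorphism T -> A}.
Hypothesis prj_graded : forall n t, tgr deg n t -> gr A n (prj t).
Hypothesis prj_surj : forall a, exists t, prj t = a.

(** The degree [n] part of any preimage works. The images of the components of [t], with [a]
    subtracted in degree [n], are homogeneous and add up to 0, so directness makes each of them
    vanish. *)
Lemma gr_prj n a : gr A n a -> exists2 t, tgr deg n t & prj t = a.
Proof.
move=> an; have [t ta] := prj_surj a; exists (hcomp deg n t).
  exact: hcomp_tgr.
have [N tN] := hcomp_sum deg t; pose M := maxn N n.+1.
have {}tN := tN M (leq_maxl _ _).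
have nM : (n < M)%N by exact: leq_maxr.
pose c m := prj (hcomp deg m t) - (if m == n then a else 0).
have cm m : gr A m (c m).
  apply: (subspaceB (gr_subspace A m)); first by apply: prj_graded; exact: hcomp_tgr.
  by case: eqP => [->//|_]; exact: subspace0 (gr_subspace A m).
have c0 : \sum_(m < M) c m = 0.
  have E : prj t = \sum_(m < M) prj (hcomp deg m t) by rewrite {1}tN linear_sum.
  rewrite sumrB -E ta.
  rewrite (bigD1 (Ordinal nM)) //= eqxx big1 ?addr0 ?subrr // => m.
  by rewrite -val_eqE /= => /negbTE->.
have := gr_direct cm c0 nM; rewrite /c eqxx => /eqP.
by rewrite subr_eq0 => /eqP.
Qed.

Hypothesis deg_gt0 : forall x, (0 < deg x)%N.

Lemma wdeg_eq0 s : wdeg deg s = 0%N -> s = [::].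
Proof.
case: s => [//|x s]; rewrite /wdeg big_cons => /eqP.
by rewrite addn_eq0 => /andP[/eqP x0]; have := deg_gt0 x; rewrite x0.
Qed.

Lemma gr_surj_connected : connected A.
Proof.
apply/seteqP; split=> [a /gr_prj[t /tgr_supp t0 <-]|_ [c _ <-]]; last first.
  exact: (subspaceZ (gr_subspace A 0%N) c (gr1 A)).
have {t0} : supp [set [::]] t by apply: supp_sub t0 => s /wdeg_eq0.
move: t; apply: supp_ind => [|s ->]; last first.
  by exists 1 => //; rewrite wd_nil rmorph1 scale1r.
split=> [|c x y [d _ dx] [e _ ey]]; first by exists 0 => //; rewrite scale0r linear0.
by exists (c * d + e) => //; rewrite (linearP prj) /= -dx -ey scalerDl scalerA.
Qed.

Lemma words_fin (L : seq X) n : exists W : seq (seq X),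
  forall s, (size s <= n)%N -> {subset s <= L} -> s \in W.
Proof.
elim: n => [|n [W HW]]; first by exists [:: [::]] => -[].
exists ([::] :: [seq x :: s | x <- L, s <- W]) => -[|x s] //= ss sL.
rewrite inE; apply/orP; right; apply/allpairsP; exists (x, s); split=> //=.
  by apply: sL; exact: mem_head.
by apply: HW => // y ys; apply: sL; rewrite inE ys orbT.
Qed.

Hypothesis deg_fin : forall n, exists s : seq X, forall x, deg x = n -> x \in s.

(** Letters have positive degree, so a word of degree [n] has length at most [n] and letters of
    degree at most [n]. *)
Lemma wdeg_fin n : exists W : seq (seq X), forall s, wdeg deg s = n -> s \in W.
Proof.
have [L HL] : exists L : seq X, forall x, (deg x <= n)%N -> x \in L.
  elim: n => [|n [L HL]].
    by have [L HL] := deg_fin 0; exists L => x; rewrite leqn0 => /eqP/HL.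
  have [L' HL'] := deg_fin n.+1; exists (L ++ L') => x.
  by rewrite leq_eqVlt mem_cat => /orP[/eqP/HL'->|/HL->]; rewrite ?orbT.
have [W HW] := words_fin L n; exists W => s sn; apply: HW; last first.
  move=> x xs; apply: HL; rewrite -sn /wdeg (big_rem x xs) /=.
  exact: leq_addr.
rewrite -sn /wdeg; elim: s {sn} => [//|x s IHs]; rewrite big_cons /=.
by rewrite -add1n leq_add.
Qed.

Lemma gr_surj_fin : locally_finite A.
Proof.
move=> n; have [W HW] := wdeg_fin n.
exists [seq prj (wd k s) | s <- W & wdeg deg s == n].
apply/seteqP; split=> [a /gr_prj[t /tgr_supp tn <-]|a]; last first.
  move: a; apply: span_sub; first exact: gr_subspace.
  move=> _ /= /mapP[s + ->]; rewrite mem_filter => /andP[/eqP sn _].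
  by apply: prj_graded; apply/tgr_supp; exact: supp_wd.
move: t tn; apply: supp_ind.
  exact: (subspace_preim prj (subspace_span _)).
move=> s /= sn; apply: span_incl; apply/mapP; exists s => //.
by rewrite mem_filter sn eqxx HW.
Qed.

Lemma wdeg_gt0 s : s <> [::] -> (0 < wdeg deg s)%N.
Proof. by rewrite lt0n => s0; apply/eqP => /wdeg_eq0. Qed.

Lemma prj_pos s : s <> [::] -> gr_pos (prj (wd k s)).
Proof.
move=> s0; apply: span_incl; exists (wdeg deg s); first exact: wdeg_gt0.
by apply: prj_graded; apply/tgr_supp; exact: supp_wd.
Qed.

Lemma pos_prj a : gr_pos a -> exists2 t, supp [set s | s <> [::]] t & prj t = a.
Proof.
have Ss := supp_subspace k [set s : seq X | s <> [::]].
move: a; apply: span_sub.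
  split=> [|c _ _ [x sx <-] [y sy <-]].
    by exists 0; [exact: subspace0 Ss | rewrite linear0].
  by exists (c *: x + y); [exact: subspaceP Ss _ _ _ sx sy | rewrite linearP].
move=> a [n /= n0 /gr_prj[t /tgr_supp tn <-]]; exists t => //.
apply: supp_sub tn => s /= sn s0; move: n0.
by rewrite -sn s0 /wdeg big_nil.
Qed.

Hypothesis prj_ker : forall t, prj t = 0 -> supp [set s | (2 <= size s)%N] t.

Let A2 := span [set x | exists a b : A, [/\ gr_pos a, gr_pos b & x = a * b]].

(** A combination of letters that maps into A_{>0} A_{>0} agrees, modulo the kernel, with a
    combination of words of length at least 2. The kernel lies in those lengths as well, so no
    letter can occur. *)
Lemma gr_surj_gens :
  (forall a, gr_pos a -> exists2 v, gens k X v & A2 (a - prj v)) /\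
  (forall v, gens k X v -> A2 (prj v) -> v = 0).
Proof.
have Vs : subspace (gens k X) by exact: subspace_span.
have A2s : subspace A2 by exact: subspace_span.
split=> [_ /pos_prj[t t0 <-]|v /gens_supp v1 v2].
  move: t t0; apply: supp_ind.
    split=> [|c x y [v Vv xv] [w Vw yw]].
      by exists 0; [exact: subspace0 Vs | rewrite linear0 subrr; exact: subspace0 A2s].
    exists (c *: v + w); first exact: subspaceP Vs _ _ _ Vv Vw.
    rewrite (linearP prj) (linearP prj) opprD addrACA -scalerBr.
    exact: subspaceP A2s _ _ _ xv yw.
  move=> [//|x [|y s]] _.
    exists (wd k [:: x]); first by apply/gens_supp; exact: supp_wd.
    by rewrite subrr; exact: subspace0 A2s.
  (* A word of length at least 2 has a decomposable image, so its part in V is 0. *)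
  exists 0; first exact: subspace0 Vs.
  rewrite linear0 subr0; apply: span_incl.
  exists (prj (wd k [:: x])), (prj (wd k (y :: s))); split; try exact: prj_pos.
  by rewrite -rmorphM -wd_cat.
have Ss := supp_subspace k [set s : seq X | (2 <= size s)%N].
have [t t2 tv] : exists2 t, supp [set s : seq X | (2 <= size s)%N] t & prj t = prj v.
  move: (prj v) v2; apply: span_sub.
    split=> [|c _ _ [x sx <-] [y sy <-]].
      by exists 0; [exact: subspace0 Ss | rewrite linear0].
    by exists (c *: x + y); [exact: subspaceP Ss _ _ _ sx sy | rewrite linearP].
  move=> _ [_ [_ [/pos_prj[t t0 <-] /pos_prj[u u0 <-] ->]]].
  exists (t * u); last exact: rmorphM.
  apply: supp_sub (supp_mul t0 u0) => _ [[|x s] [[|y w] [//= _ _ ->]]] //=.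
  by rewrite size_cat /= addnS.
have v2' : supp [set s | (2 <= size s)%N] v.
  rewrite -[v](subrK t); apply: (subspaceD Ss) => //.
  by apply: prj_ker; rewrite linearB /= tv subrr.
apply/malgP => w; rewrite mcoeff0; apply/eqP; rewrite mcoeff_eq0; apply/negP => wv.
by have := v2' w wv; rewrite /= (v1 w wv).
Qed.

End GradedSurjection.

(** * The coproduct as a quotient of the free algebra *)

Section Coproduct.
Variables (k : fieldType) (S : finType) (B : S -> gralg k).
Variable p : forall s, presentation (B s).
Variables (A : gralg k) (inj : forall s, {lrmorphism B s -> A}).
Hypothesis A_coprod : is_coproduct inj.

Local Notation T := {malg k[{fmonom (fgen p)}]}.

Definition fprj : {lrmorphism T -> A} :=
  ev (fun x : fgen p => inj (tag x) (proj (p (tag x)) (wd k [:: tagged x])))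
    (fun c x y => esym (scalerAr c x y)).

Lemma fprj_gen (x : fgen p) :
  fprj (wd k [:: x]) = inj (tag x) (proj (p (tag x)) (wd k [:: tagged x])).
Proof. exact: ev_gen. Qed.

Lemma fprj_iota s t : fprj (iota p s t) = inj s (proj (p s) t).
Proof.
apply: (lrmorph_eq (f := fprj \o iota p s) (g := inj s \o proj (p s))) t => g.
by rewrite /= iota_gen fprj_gen.
Qed.

Lemma fprj_graded n t : tgr (fdeg p) n t -> gr A n (fprj t).
Proof.
move=> /tgr_supp tn; move: t tn; apply: supp_ind.
  exact: (subspace_preim fprj (gr_subspace A n)).
move=> u /= un; rewrite -{}un; elim: u => [|x u IHu].
  by rewrite wd_nil rmorph1 /wdeg big_nil; exact: gr1.
rewrite -cat1s wd_cat rmorphM /wdeg big_cat /= big_seq1.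
apply: grM => //; rewrite fprj_gen; apply: A_coprod.1; apply: proj_graded.
by apply/tgr_supp; apply: supp_wd; rewrite /= /wdeg big_seq1.
Qed.

Lemma fprj_fideal t : tideal (frel p) t -> fprj t = 0.
Proof.
have Z : subspace [set 0 : A].
  by split=> // c x y /= -> ->; rewrite scaler0 addr0.
move: t; apply: (tideal_sub (subspace_preim fprj Z)).
move=> a r b [rm rr]; rewrite /= !rmorphM /= (mono_sum rm) linear_sum big1.
  by rewrite mulr0 mul0r.
move=> s _ /=; rewrite fprj_iota; have -> : proj (p s) (rho p s r) = 0.
  by apply/proj_ker; apply: tideal_incl.
exact: linear0.
Qed.

Local Notation C := (qgralg (@fideal_homogeneous k S B p)).
Local Notation qp := (qproj (fideal p)).

(** The concrete algebra [C], the quotient of T(V) by the ideal of [frel], receives the [B s] and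
    hence [A]. Compatibility with the projections from T(V) is what bounds the kernel of [fprj]. *)
Lemma coprod_model : exists2 g : {lrmorphism A -> C}, graded g &
  forall t, g (fprj t) = qp t.
Proof.
have fP s : exists f : {lrmorphism B s -> C}, forall t, f (proj (p s) t) = qp (iota p s t).
  apply: (lift_lrmorph (q := proj (p s)) (f := qp \o iota p s)) => [|u u0].
    exact: proj_surj.
  by apply/qproj_eq0; apply: iota_fideal; apply/proj_ker.
pose f s := sval (cid (fP s)).
have fE s u : f s (proj (p s) u) = qp (iota p s u) by exact: svalP (cid (fP s)) u.
have [|g [gg gE _]] := A_coprod.2 C f.
  move=> s n b /(gr_prj (@proj_graded _ _ (p s)) (@proj_surj _ _ (p s)))[u un <-].
  by rewrite fE; exists (iota p s u) => //; exact: iota_tgr.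
exists g => // u.
apply: (lrmorph_eq (f := g \o fprj) (g := qp)) u => x /=.
rewrite fprj_gen gE fE iota_gen; congr (qproj _ (wd k [:: _])).
by case: x.
Qed.

Lemma fprj_eq0 t : fprj t = 0 -> tideal (frel p) t.
Proof.
have [g _ gE] := coprod_model.
by move=> t0; apply/(qproj_eq0 (fideal p)); rewrite -gE t0 linear0.
Qed.

(** The composite of [A -> C] with the map [C -> A] induced by [fprj] fixes the images of the [B s],
    so it is the identity by uniqueness; and elements of [C] lift to T(V). *)
Lemma fprj_surj a : exists t, fprj t = a.
Proof.
have [g gg gE] := coprod_model.
have [h hE] : exists h : {lrmorphism C -> A}, forall t, h (qp t) = fprj t.
  apply: (lift_lrmorph (q := qp) (f := fprj)); first exact: qproj_surj.
  by move=> t /qproj_eq0/fprj_fideal.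
have hg : graded h by move=> n _ [t tn <-]; rewrite hE; exact: fprj_graded.
(* [A] itself serves as test object: [h \o g] and the identity both have to equal [g0]. *)
have [g0 [_ _ g0U]] := A_coprod.2 A inj A_coprod.1.
have hgE : h (g a) = a.
  transitivity (g0 a); last first.
    by symmetry; apply: (g0U idfun).
  apply: (g0U (h \o g)) => [n b bn|s b] /=; first by apply/hg/gg.
  have [u <-] := proj_surj (p s) b.
  by rewrite -fprj_iota gE hE.
have [t tE] := qproj_surj (I := fideal p) (g a).
by exists t; rewrite -hE tE.
Qed.

Lemma fdeg_gt0 x : (0 < fdeg p x)%N. Proof. exact: deg_gt0. Qed.

Lemma fdeg_fin n : exists r : seq (fgen p), forall x, fdeg p x = n -> x \in r.
Proof.
have rP s := cid (deg_fin (p s) n).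
exists (flatten [seq [seq fin g | g <- sval (rP s)] | s <- enum S]) => -[s g] sg.
apply/flatten_mapP; exists s; first by rewrite mem_enum.
by apply/mapP; exists g => //; apply: (svalP (rP s)).
Qed.

Lemma fprj_ker t : fprj t = 0 <-> tideal (frel p) t.
Proof. by split; [exact: fprj_eq0 | exact: fprj_fideal]. Qed.

Definition fpres : presentation A :=
  Presentation fdeg_gt0 fdeg_fin (@frel_subspace _ _ _ p) (@frel_graded _ _ _ p)
    (@frel_ge2 _ _ _ p) (@frel_min _ _ _ p) fprj_graded fprj_surj fprj_ker
    (gr_surj_gens fprj_graded fprj_surj fdeg_gt0
      (fun t t0 => tideal_ge2 (fun r rr => (tlen_ge_supp _ _).1 (frel_ge2 rr)) (fprj_eq0 t0))).

Lemma coprod_connected : connected A.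
Proof. exact: gr_surj_connected fprj_graded fprj_surj fdeg_gt0. Qed.

Lemma coprod_fin : locally_finite A.
Proof. exact: gr_surj_fin fprj_graded fprj_surj fdeg_gt0 fdeg_fin. Qed.

End Coproduct.

(** * The left complex *)

Section Augmentation.
Variables (k : fieldType) (A : gralg k) (p : presentation A).
Local Notation T := {malg k[{fmonom (gen p)}]}.

Lemma gr_pos_proj t : supp [set s | s <> [::]] t -> gr_pos (proj p t).
Proof.
move: t; apply: supp_ind => [|s s0].
  exact: (subspace_preim (proj p) (subspace_span _)).
exact: (prj_pos (@proj_graded _ _ p) (@deg_gt0 _ _ p)).
Qed.

Lemma proj_ker_ge2 t : proj p t = 0 -> supp [set s | (2 <= size s)%N] t.
Proof.
move=> /proj_ker; apply: tideal_ge2 => r /rel_ge2 rr.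
exact/tlen_ge_supp.
Qed.

(** [aug] is selected by [xget]. The constant coefficient is the only scalar that fits, because
    elements of positive degree lift to combinations of nonempty words and the kernel of [proj] has
    words of length at least 2 only. *)
Lemma augE t : aug (proj p t) = t@_(FMonom [::]).
Proof.
have E c : gr_pos (proj p t - c%:A) <-> c = t@_(FMonom [::]).
  split=> [|->].
    move=> /(pos_prj (@proj_graded _ _ p) (@proj_surj _ _ p)) [u u0 uE].
    have /proj_ker_ge2/supp_coeff/(_ [::]) : proj p (t - c *: wd k [::] - u) = 0.
      by rewrite 2!linearB linearZ /= wd_nil rmorph1 uE subrr.
    rewrite mcoeffB mcoeffB mcoeffZ wdE eqxx mulr1.
    have -> : u@_(FMonom [::]) = 0.
      by apply/eqP/negPn/negP => /((supp_coeff _ _).1 u0).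
    rewrite subr0 => H; apply/eqP; rewrite eq_sym -subr_eq0.
    by apply/negPn/negP => /H.
  have -> : (t@_(FMonom [::]))%:A = proj p (t@_(FMonom [::]) *: wd k [::]).
    by rewrite linearZ /= wd_nil rmorph1.
  rewrite -linearB; apply: gr_pos_proj; apply/supp_coeff => u.
  rewrite mcoeffB mcoeffZ wdE => + u0; rewrite u0 eqxx.
  by rewrite mulr1 subrr eqxx.
rewrite /aug; case: xgetP => [c _ /E//|none].
by case: (none t@_(FMonom [::])); apply/E.
Qed.

Lemma aug_linear : linear (@aug k A : A -> k^o).
Proof.
move=> c a b; have [[t <-] [u <-]] := (proj_surj p a, proj_surj p b).
by rewrite -linearP !augE mcoeffD mcoeffZ.
Qed.

Lemma augM (a b : A) : aug (a * b) = aug a * aug b.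
Proof.
have [[t <-] [u <-]] := (proj_surj p a, proj_surj p b).
rewrite -rmorphM !augE.
have sT : tpow (gens k (gen p)) 0 1 by rewrite /tpow big_ord0; apply: span_incl.
have E (x : T) : x@_(FMonom [::]) = x@_mone.
  by congr (x@_ _); apply/val_inj; rewrite /= fm1.
by rewrite !E; exact: (rmorphM (mcoeff mone)).
Qed.

Lemma aug1 : aug (1 : A) = 1.
Proof. by rewrite -(rmorph1 (proj p)) augE -wd_nil wdE eqxx. Qed.

End Augmentation.

(** * Free bimodules and their reduction by the right augmentation *)

Section BimoduleTensor.
Variables (k : fieldType) (A : algType k) (J KJ LJ : lmodType k).
Variables (bm : A -> J -> A -> KJ) (la : A -> KJ -> KJ) (ra : KJ -> A -> KJ).
Variables (ep : A -> k) (pl : KJ -> k^o -> LJ).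

(* KJ is A (x) J (x) A. *)
Record bimodule_tensor : Prop := BimoduleTensor {
  bt_lin1 : forall w b, linear (fun a => bm a w b);
  bt_lin2 : forall a b, linear (fun w => bm a w b);
  bt_lin3 : forall a w, linear (fun b => bm a w b);
  bt_la : forall a, linear (la a);
  bt_ra : forall a, linear (fun x => ra x a);
  bt_labm : forall a a' w b, la a (bm a' w b) = bm (a * a') w b;
  bt_rabm : forall a' w b a, ra (bm a' w b) a = bm a' w (b * a);
  bt_ind : forall Q : set KJ, subspace Q -> (forall a w b, Q (bm a w b)) -> forall x, Q x;
  bt_lift : forall (P : lmodType k) (f : A -> J -> A -> P),
    (forall w b, linear (fun a => f a w b)) ->
    (forall a b, linear (fun w => f a w b)) ->
    (forall a w, linear (fun b => f a w b)) ->
    exists g : {linear KJ -> P}, forall a w b, g (bm a w b) = f a w b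
}.

(* LJ is KJ (x)_A k. *)
Record left_tensor : Prop := LeftTensor {
  lt_lin1 : forall c, linear (fun x => pl x c);
  lt_lin2 : forall x, linear (pl x);
  lt_bal : forall x a c, pl (ra x a) c = pl x (ep a * c);
  lt_ind : forall Q : set LJ, subspace Q -> (forall x c, Q (pl x c)) -> forall u, Q u;
  lt_lift : forall (P : lmodType k) (f : KJ -> k^o -> P),
    (forall c, linear (fun x => f x c)) -> (forall x, linear (f x)) ->
    (forall x a c, f (ra x a) c = f x (ep a * c)) ->
    exists g : {linear LJ -> P}, forall x c, g (pl x c) = f x c
}.

Hypothesis BTH : bimodule_tensor.

Lemma bt_eq (P : lmodType k) (f g : KJ -> P) : linear f -> linear g ->
  (forall a w b, f (bm a w b) = g (bm a w b)) -> f =1 g.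
Proof.
move=> fl gl fg; apply: bt_ind => //.
exact: (subspace_eqlin (mklin fl) (mklin gl)).
Qed.

Hypothesis epl : linear (ep : A -> k^o).
Hypothesis epM : forall a b, ep (a * b) = ep a * ep b.
Hypothesis ep1 : ep 1 = 1.

(** K (x)_A k is modelled by A (x) J, and this is the quotient map from K read in the model. [LtoN]
    and [NtoL] below are the mutually inverse identifications. *)
Lemma KtoN_ex : exists f : {linear KJ -> tsr A J},
  forall a w b, f (bm a w b) = ep b *: tp a w.
Proof.
apply: bt_lift => // [w b|a b|a w] c x y.
- by rewrite tpPl scalerDr !scalerA mulrC.
- by rewrite tpPr scalerDr !scalerA mulrC.
- by rewrite epl scalerDl scalerA.
Qed.

Definition KtoN : {linear KJ -> tsr A J} := sval (cid KtoN_ex).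

Lemma KtoNE a w b : KtoN (bm a w b) = ep b *: tp a w.
Proof. exact: (svalP (cid KtoN_ex)). Qed.

Lemma NtoK_bilin : bilin (fun a w => bm a w 1).
Proof. by split=> *; [exact: bt_lin1 | exact: bt_lin2]. Qed.

Definition NtoK : {linear tsr A J -> KJ} := tplin NtoK_bilin.

Lemma NtoKE a w : NtoK (tp a w) = bm a w 1. Proof. exact: tplinE. Qed.

Definition lactN (a : A) : {linear tsr A J -> tsr A J} :=
  tpmap (mulLl (fun c x y => esym (scalerAr c x y)) a) idfun.

Lemma lactNE a a' w : lactN a (tp a' w) = tp (a * a') w.
Proof. exact: tpmapE. Qed.

Lemma KtoN_ract x a : KtoN (ra x a) = ep a *: KtoN x.
Proof.
apply: (bt_eq (f := fun x => KtoN (ra x a)) (g := fun x => ep a *: KtoN x)) x.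
- by move=> c x y; rewrite bt_ra // (linearP KtoN).
- by move=> c x y; rewrite (linearP KtoN) scalerDr !scalerA mulrC.
- by move=> e w b; rewrite bt_rabm // !KtoNE epM scalerA mulrC.
Qed.

Lemma KtoN_lact x a : KtoN (la a x) = lactN a (KtoN x).
Proof.
apply: (bt_eq (f := fun x => KtoN (la a x)) (g := fun x => lactN a (KtoN x))) x.
- by move=> c x y; rewrite bt_la // (linearP KtoN).
- by move=> c x y; rewrite (linearP KtoN) (linearP (lactN a)).
- by move=> e w b; rewrite bt_labm // !KtoNE lZ lactNE.
Qed.

Lemma NtoK_lact y a : NtoK (lactN a y) = la a (NtoK y).
Proof.
apply: (tsr_eq (f := fun y => NtoK (lactN a y)) (g := fun y => la a (NtoK y))) y.
- by move=> c x y; rewrite (linearP (lactN a)) (linearP NtoK).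
- by move=> c x y; rewrite (linearP NtoK) bt_la.
- by move=> a' w; rewrite lactNE !NtoKE bt_labm.
Qed.

Lemma NtoKK : cancel NtoK KtoN.
Proof.
apply: (tsr_eq (f := fun y => KtoN (NtoK y)) (g := idfun)) => //.
  by move=> c x y; rewrite (linearP NtoK) (linearP KtoN).
by move=> a w; rewrite NtoKE KtoNE ep1 scale1r.
Qed.

Hypothesis LTH : left_tensor.

Lemma LtoN_ex : exists f : {linear LJ -> tsr A J},
  forall x c, f (pl x c) = (c : k) *: KtoN x.
Proof.
apply: lt_lift => // [c e x y|x e c c'|x a c].
- by rewrite (linearP KtoN) scalerDr !scalerA mulrC.
- by rewrite scalerDl scalerA.
- by rewrite KtoN_ract scalerA mulrC.
Qed.

Definition LtoN : {linear LJ -> tsr A J} := sval (cid LtoN_ex).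

Lemma LtoNE x c : LtoN (pl x c) = (c : k) *: KtoN x.
Proof. exact: (svalP (cid LtoN_ex)). Qed.

Lemma NtoL_linear : linear (fun y => pl (NtoK y) 1).
Proof. by move=> c x y; rewrite (linearP NtoK) lt_lin1. Qed.

Definition NtoL : {linear tsr A J -> LJ} := mklin NtoL_linear.

Lemma NtoLE y : NtoL y = pl (NtoK y) 1. Proof. by []. Qed.

Lemma NtoLK : cancel NtoL LtoN.
Proof. by move=> y; rewrite NtoLE LtoNE scale1r NtoKK. Qed.

Lemma LtoNK : cancel LtoN NtoL.
Proof.
apply: lt_ind => //; first exact: (subspace_eqlin (NtoL \o LtoN) idfun).
move=> x c; rewrite LtoNE lZ NtoLE.
apply: (bt_eq (f := fun x => c *: pl (NtoK (KtoN x)) 1) (g := fun x => pl x c)) x.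
- move=> e x y; rewrite (linearP KtoN) (linearP NtoK) lt_lin1 // scalerDr !scalerA.
  by rewrite mulrC.
- exact: lt_lin1.
move=> a w b; rewrite KtoNE lZ NtoKE.
rewrite (linZ (f := fun x => pl x 1)); last exact: lt_lin1.
(* The right factor is written [1 * b], and [b] is moved across the tensor sign over [A], where it
   acts on k as [ep b]. *)
rewrite scalerA -{2}[b]mul1r -bt_rabm // lt_bal //.
have -> : ep b * c = (c * ep b : k) *: (1 : k^o) by rewrite mulrC; symmetry; exact: mulr1.
by rewrite (linZ (f := pl _)) //; exact: lt_lin2.
Qed.

Lemma pl1 x : pl x 1 = NtoL (KtoN x).
Proof. by rewrite -[LHS]LtoNK LtoNE scale1r. Qed.

Lemma la_linearl x : linear (fun a => la a x).
Proof.
move=> c a a'.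
apply: (bt_eq (f := fun x => la (c *: a + a') x) (g := fun x => c *: la a x + la a' x)) x.
- exact: bt_la.
- by move=> e x y; rewrite !bt_la // scalerDr !scalerA mulrC addrACA scalerDr !scalerA.
- by move=> e w b; rewrite !bt_labm // mulrDl -scalerAl bt_lin1.
Qed.

Lemma ra_linearr x : linear (fun b => ra x b).
Proof.
move=> c a a'.
apply: (bt_eq (f := fun x => ra x (c *: a + a')) (g := fun x => c *: ra x a + ra x a')) x.
- exact: bt_ra.
- by move=> e x y; rewrite !bt_ra // scalerDr !scalerA mulrC addrACA scalerDr !scalerA.
- by move=> e w b; rewrite !bt_rabm // mulrDr -scalerAr bt_lin3.
Qed.

Lemma laA a b x : la a (la b x) = la (a * b) x.
Proof.
apply: (bt_eq (f := fun x => la a (la b x)) (g := fun x => la (a * b) x)) x.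
- by move=> c x y; rewrite !bt_la.
- exact: bt_la.
- by move=> c w e; rewrite !bt_labm // mulrA.
Qed.

Lemma raA a b x : ra (ra x a) b = ra x (a * b).
Proof.
apply: (bt_eq (f := fun x => ra (ra x a) b) (g := fun x => ra x (a * b))) x.
- by move=> c x y; rewrite !bt_ra.
- exact: bt_ra.
- by move=> c w e; rewrite !bt_rabm // mulrA.
Qed.

Lemma lara a b x : la a (ra x b) = ra (la a x) b.
Proof.
apply: (bt_eq (f := fun x => la a (ra x b)) (g := fun x => ra (la a x) b)) x.
- by move=> c x y; rewrite bt_ra // bt_la.
- by move=> c x y; rewrite bt_la // bt_ra.
- by move=> c w e; rewrite bt_rabm // !bt_labm // bt_rabm.
Qed.

Lemma la1 x : la 1 x = x.
Proof.
apply: (bt_eq (f := fun x => la 1 x) (g := idfun)) x => //.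
  exact: bt_la.
by move=> c w e; rewrite bt_labm // mul1r.
Qed.

Lemma ra1 x : ra x 1 = x.
Proof.
apply: (bt_eq (f := fun x => ra x 1) (g := idfun)) x => //.
  exact: bt_ra.
by move=> c w e; rewrite bt_rabm // mulr1.
Qed.

End BimoduleTensor.

Section BimoduleExtension.
Variables (k : fieldType) (A : algType k) (J KJ J' KJ' : lmodType k).
Variables (bm : A -> J -> A -> KJ) (la : A -> KJ -> KJ) (ra : KJ -> A -> KJ).
Variables (bm' : A -> J' -> A -> KJ') (la' : A -> KJ' -> KJ') (ra' : KJ' -> A -> KJ').
Hypothesis BTH : bimodule_tensor bm la ra.
Hypothesis BTH' : bimodule_tensor bm' la' ra'.

(** A (x) J (x) A is the free bimodule on J: a linear map on J extends by [a] on the left and [b] on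
    the right. *)
Lemma bimodule_extension (D : {linear J -> KJ'}) :
  exists f : {linear KJ -> KJ'}, [/\ forall a w b, f (bm a w b) = ra' (la' a (D w)) b,
    forall a x, f (la a x) = la' a (f x) & forall x a, f (ra x a) = ra' (f x) a].
Proof.
have [f fE] : exists f : {linear KJ -> KJ'},
    forall a w b, f (bm a w b) = ra' (la' a (D w)) b.
  apply: (bt_lift BTH) => [w b|a b|a w] c x y.
  - by rewrite (la_linearl BTH') (bt_ra BTH').
  - by rewrite (linearP D) (bt_la BTH') (bt_ra BTH').
  - exact: (ra_linearr BTH').
exists f; split=> // [a x|x a].
  apply: (bt_eq BTH (f := fun x => f (la a x)) (g := fun x => la' a (f x))) x.
  - by move=> c x y; rewrite (bt_la BTH) (linearP f).
  - by move=> c x y; rewrite (linearP f) (bt_la BTH').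
  - by move=> c w b; rewrite (bt_labm BTH) !fE (lara BTH') (laA BTH').
apply: (bt_eq BTH (f := fun x => f (ra x a)) (g := fun x => ra' (f x) a)) x.
- by move=> c x y; rewrite (bt_ra BTH) (linearP f).
- by move=> c x y; rewrite (linearP f) (bt_ra BTH').
- by move=> c w b; rewrite (bt_rabm BTH) !fE (raA BTH').
Qed.

End BimoduleExtension.

Section LeftComplex.
Variables (k : fieldType) (A : algType k) (J KK LL : nat -> lmodType k).
Variables (bm : forall i, A -> J i -> A -> KK i).
Variables (la : forall i, A -> KK i -> KK i) (ra : forall i, KK i -> A -> KK i).
Variables (ep : A -> k) (pl : forall i, KK i -> k^o -> LL i).
Hypothesis BTH : forall i, bimodule_tensor (@bm i) (@la i) (@ra i).
Hypothesis epl : linear (ep : A -> k^o).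
Hypothesis epM : forall a b, ep (a * b) = ep a * ep b.
Hypothesis ep1 : ep 1 = 1.
Hypothesis LTH : forall i, left_tensor (@ra i) ep (@pl i).
Variable d : forall i, {linear KK i.+1 -> KK i}.
Hypothesis dla : forall i a x, d i (la a x) = la a (d i x).

(** This is d (x)_A k seen on A (x) J_i. *)
Definition dN i : {linear tsr A (J i.+1) -> tsr A (J i)} :=
  KtoN (BTH i) epl \o (d i \o NtoK (BTH i.+1)).

Lemma dN_lact i a y : dN i (lactN (J i.+1) a y) = lactN (J i) a (dN i y).
Proof. by rewrite /dN /= (NtoK_lact (BTH _)) dla (KtoN_lact (BTH _)). Qed.

Lemma dN_tp i a (w : J i.+1) :
  dN i (tp a w) = lactN (J i) a (KtoN (BTH i) epl (d i (bm 1 w 1))).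
Proof. by rewrite -{1}[a]mulr1 -lactNE dN_lact /dN /= NtoKE. Qed.

Variable v : {linear J 0%N -> k^o}.

Lemma augN_bilin : bilin (fun (a : A) (w : J 0%N) => (ep a * v w : k^o)).
Proof.
split=> [c a a' w|c a w w']; first by rewrite epl mulrDl; congr (_ + _); rewrite -[LHS]mulrA.
by rewrite (linearP v) mulrDr; congr (_ + _); exact: mulrCA.
Qed.

Definition augN : {linear tsr A (J 0%N) -> k^o} := tplin augN_bilin.

Lemma augNE a w : augN (tp a w) = ep a * v w. Proof. exact: tplinE. Qed.

Variable dLL : forall i, LL i.+1 -> LL i.
Hypothesis dLLE : forall i x c, dLL (pl x c) = pl (d i x) c.
Variable aL : {linear LL 0%N -> k^o}.
Hypothesis aLE : forall a w b c, aL (pl (bm a w b) c) = ep a * v w * ep b * c.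
Variable w1 : J 0%N.
Hypothesis vw1 : v w1 = 1.

Lemma augN_one : augN (tp 1 w1) = 1.
Proof. by rewrite augNE ep1 vw1 mulr1. Qed.

Lemma dLL_NtoL i y : dLL (NtoL (BTH i.+1) (LTH i.+1) y) = NtoL (BTH i) (LTH i) (dN i y).
Proof. by rewrite NtoLE dLLE (pl1 (BTH i) epl epM (LTH i)). Qed.

Lemma aL_NtoL y : aL (NtoL (BTH 0) (LTH 0) y) = augN y.
Proof.
apply: (tsr_eq (f := fun y => aL (NtoL (BTH 0) (LTH 0) y)) (g := augN)) y.
- by move=> c x y; rewrite (linearP (NtoL (BTH 0) (LTH 0))) (linearP aL).
- exact: linearP.
- by move=> a w; rewrite augNE NtoLE NtoKE aLE ep1 !mulr1.
Qed.

(** [NtoL] is an isomorphism commuting with differentials and augmentations, so exactness transfers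
    to A (x) J_i. Surjectivity onto k is witnessed by multiples of [tp 1 w1]. *)
Lemma left_complexP :
  [/\ forall c : k, exists u, aL u = c,
      forall u, aL u = 0 <-> exists v, dLL v = u &
      forall (i : nat) (u : LL i.+1), dLL u = 0 <-> exists v, dLL v = u] <->
  resolution dN augN.
Proof.
pose NL i := NtoL (BTH i) (LTH i).
have LN i u : exists y, NL i y = u.
  by exists (LtoN (BTH i) epl epM (LTH i) u); exact: LtoNK.
have NI i : injective (NL i) by exact: can_inj (NtoLK (BTH i) epl epM ep1 (LTH i)).
have N0 i y : NL i y = 0 <-> y = 0.
  by split=> [|->]; [rewrite -(linear0 (NL i)) => /NI | exact: linear0].
have LNd i y : (exists v, dLL v = NL i y) <-> exists x, dN i x = y.
  split=> [[u]|[x <-]]; last by exists (NL i.+1 x); exact: dLL_NtoL.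
  by have [x <-] := LN _ u; rewrite dLL_NtoL => /NI <-; exists x.
split=> [[_ r0 rS]|[r0 rS]].
  split=> [y|i y]; first by rewrite -aL_NtoL r0; exact: LNd.
  by rewrite -N0 -dLL_NtoL rS; exact: LNd.
split=> [c|u|i u].
- exists (NL 0 (c *: tp 1 w1)); rewrite aL_NtoL lZ augN_one; exact: mulr1.
- by have [y <-] := LN _ u; rewrite aL_NtoL r0; symmetry; exact: LNd.
- by have [y <-] := LN _ u; rewrite dLL_NtoL N0 rS; symmetry; exact: LNd.
Qed.

End LeftComplex.

Section Instances.
Variables (k : fieldType) (A : gralg k) (p : presentation A).

Lemma K_tensor i : bimodule_tensor (@bim _ _ p i) (@lactK _ _ p i) (@ractK _ _ p i).
Proof.
have [pl pr] := purek_bilin A (Jsp p i).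
have [ql qr] := purek_bilin (tensk A (Jsp p i)) A.
split=> [w b c a a'|a b c w w'|a w c b b'|a|a|a a' w b|a' w b a|Q Qs Qb|P f f1 f2 f3].
- by rewrite /bim pl ql.
- by rewrite /bim pr ql.
- exact: qr.
- exact: (tliftk_linear (@lactK_bilin _ _ p i a)).
- exact: (tliftk_linear (@ractK_bilin _ _ p i a)).
- exact: lactK_bim.
- exact: ractK_bim.
- apply: tensk_ind => // y b; move: y.
  apply: tensk_ind => [|a w]; last exact: Qb.
  split=> [|c y y' Qy Qy']; rewrite /mkset.
    have := ql (-1) 0 0 b; rewrite scaler0 addr0 scaleN1r addNr => ->.
    exact: subspace0 Qs.
  by rewrite ql; exact: (subspaceP Qs).
have fb b : bilin (fun a w => f a w b) by split=> *; [exact: f1 | exact: f2].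
have [f' [f'l f'E]] : exists f' : tensk A (Jsp p i) -> A -> P,
    (forall b, linear (fun y => f' y b)) /\ forall a w b, f' (purek a w) b = f a w b.
  exists (fun y b => tlin (fb b) y); split=> [b|a w b]; first exact: linearP.
  exact: tlinE.
have f'b : bilin f'.
  split=> [c y y' b|c y b b']; first exact: f'l.
  apply: (tensk_eqfun (f := fun y => f' y (c *: b + b'))
    (g := fun y => c *: f' y b + f' y b')) y => [|e x y|a w].
  - exact: f'l.
  - rewrite (f'l b) (f'l b') scalerDr !scalerA mulrC.
    by rewrite addrACA [in RHS]scalerDr !scalerA.
  - by rewrite 3!f'E; exact: f3.
exists (tlin f'b) => a w b; rewrite -f'E; exact: tlinE.
Qed.

Lemma L_tensor i : left_tensor (@ractK _ _ p i) (@aug k A)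
  (fun x c => pure (N := k^o) (@ractK _ _ p i) (fun a c => aug a * c) x c : L p i).
Proof.
have [pl pr pb] := pure_balanced (N := k^o) (@ractK _ _ p i) (fun a c => aug a * c).
split=> [c e x x'|x e c c'|x a c|Q Qs Qp|P f f1 f2 fb].
- exact: pl.
- exact: pr.
- exact: pb.
- exact: tens_ind.
have bal : balanced (N := k^o) (@ractK _ _ p i) (fun a c => aug a * c) f.
  by split=> *; [exact: f1 | exact: f2 | exact: fb].
by exists (mklin (tlift_linear bal)) => x c; exact: tlift_pure.
Qed.

Lemma mcoeff1_linear : linear (fun w : Jsp p 0 => (\val w)@_mone : k^o).
Proof. by move=> c x y; rewrite val_Jsp_linear mcoeffD mcoeffZ. Qed.

Definition J0val : {linear Jsp p 0 -> k^o} := mklin mcoeff1_linear.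

(** [augL] is a bare function made of nested lifts; checking bilinearity and balancedness at each
    level gives it a linear structure and its values on pure tensors. *)
Lemma augL_ex : exists f : {linear L p 0 -> k^o}, f =1 @augL _ _ p /\
  forall a w b c, f (pure (N := k^o) (@ractK _ _ p 0) (fun a c => aug a * c) (bim a w b) c : L p 0) =
    aug a * J0val w * aug b * c.
Proof.
pose f1 (a : A) (w : Jsp p 0) : k^o := aug a * (\val w)@_mone.
have f1b : bilin f1.
  split=> [c a a' w|c a w w']; first by rewrite /f1 (aug_linear p) mulrDl; congr (_ + _); rewrite -[LHS]mulrA.
  by rewrite /f1 (mcoeff1_linear c w w') mulrDr; congr (_ + _); exact: mulrCA.
pose f2 (y : tensk A (Jsp p 0)) (b : A) : k^o := tliftk f1 y * aug b.
have f2b : bilin f2.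
  split=> [c y y' b|c y b b']; first by rewrite /f2 (tliftk_linear f1b) mulrDl; congr (_ + _); rewrite -[LHS]mulrA.
  by rewrite /f2 (aug_linear p) mulrDr; congr (_ + _); exact: mulrCA.
have [g [gE gbE]] : exists g : {linear K p 0 -> k^o},
    (g : K p 0 -> k^o) = tliftk f2 /\
    forall a w b, g (bim a w b) = aug a * J0val w * aug b.
  exists (mklin (tliftk_linear f2b)); split=> // a w b.
  by rewrite mklinE /bim (tliftk_pure _ _ f2b) /f2 (tliftk_pure _ _ f1b).
have gl e x y : g (e *: x + y) = e * g x + g y by exact: linearP.
have gr : forall x a, g (ractK x a) = (g x * aug a : k^o).
  move=> x a; apply: (bt_eq (K_tensor 0) (f := fun x => g (ractK x a))
    (g := fun x => (g x * aug a : k^o))) x.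
  - by move=> e x y; rewrite (bt_ra (K_tensor 0)); exact: linearP.
  - by move=> e x y; rewrite gl [LHS]mulrDl; congr (_ + _); exact/esym/mulrA.
  - by move=> e w b; rewrite ractK_bim [LHS]gbE [X in _ = X * _]gbE (augM p) mulrA.
have bal : balanced (N := k^o) (@ractK _ _ p 0) (fun a c => aug a * c)
    (fun (x : K p 0) (c : k^o) => (g x * c : k^o)).
  split=> [c x x' e|c x e e'|a x c].
  - by rewrite gl [LHS]mulrDl; congr (_ + _); exact/esym/mulrA.
  - by rewrite mulrDr; congr (_ + _); exact: mulrCA.
  - by rewrite gr mulrA.
exists (mklin (tlift_linear bal)); split=> [u|a w b c].
  by rewrite mklinE gE.
rewrite mklinE tlift_pure //; congr (_ * _); exact: gbE.
Qed.

Lemma J0_1 : (1 : {malg k[{fmonom (gen p)}]}) \in @J_pred _ _ p 0.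
Proof. by apply/mem_set; apply: span_incl. Qed.

Definition Jone : Jsp p 0 := Sub 1 J0_1.

Lemma J0val_one : J0val Jone = 1.
Proof. exact: mcoeffUU. Qed.

Variable d : forall i, {linear K p i.+1 -> K p i}.
Hypothesis dbim : forall i, bimodule_map (d i).

Definition ldN := dN K_tensor (aug_linear p) d.
Definition laugN := augN (aug_linear p) J0val.

Lemma left_resolutionP : left_resolution d <-> resolution ldN laugN.
Proof.
have [aL [aLE aLp]] := augL_ex.
pose dLL i (u : L p i.+1) : L p i := dL d u.
have dLE i x c : dLL i (pure (N := k^o) (@ractK _ _ p i.+1) (fun a c => aug a * c) x c) =
    pure (N := k^o) (@ractK _ _ p i) (fun a c => aug a * c) (d i x) c by exact: dL_pure.
have := left_complexP K_tensor (aug_linear p) (augM p) (aug1 p) L_tensor dLE aLp J0val_one.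
have -> : (aL : L p 0 -> k^o) = @augL _ _ p by apply/funext.
exact.
Qed.

End Instances.

Lemma tone_coeff (k : fieldType) (X : choiceType) (t : {malg k[{fmonom X}]}) :
  tone k X t -> t = t@_mone *: 1.
Proof.
apply: (span_sub (W := [set t | t = t@_mone *: 1])) t => [|_ ->].
  split=> [|c x y xE yE]; first by rewrite /= mcoeff0 scale0r.
  by rewrite /= mcoeffD mcoeffZ scalerDl -scalerA -xE -yE.
by rewrite /= [1@_mone]mcoeffUU scale1r.
Qed.

Section LeftComplexOfPresentation.
Variables (k : fieldType) (A : gralg k) (p : presentation A).
Variable d : forall i, {linear K p i.+1 -> K p i}.
Hypothesis dbim : forall i, bimodule_map (d i).

Lemma ldN_lact i a y : ldN d i (lactN (Jsp p i.+1) a y) = lactN (Jsp p i) a (ldN d i y).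
Proof. by apply: dN_lact => j a' x; exact: (dbim j).1. Qed.

Lemma ldN_tp i a (w : Jsp p i.+1) : ldN d i (tp a w) =
  lactN (Jsp p i) a (KtoN (K_tensor p i) (aug_linear p) (d i (bim 1 w 1))).
Proof. by apply: dN_tp => j a' x; exact: (dbim j).1. Qed.

Lemma laugNE a w : laugN p (tp a w) = aug a * J0val p w.
Proof. exact: augNE. Qed.

Lemma laugN_one : laugN p (tp 1 (Jone p)) = 1.
Proof. by rewrite laugNE (aug1 p) J0val_one mulr1. Qed.

Lemma J0_scale (w : Jsp p 0) : w = (J0val p w : k) *: Jone p.
Proof.
apply: val_inj; transitivity ((J0val p w : k) *: \val (Jone p)); last first.
  by symmetry; exact: (lZ (Jval p 0) (J0val p w) (Jone p)).
by rewrite mklinE; exact: (tone_coeff (set_mem (valP w))).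
Qed.

End LeftComplexOfPresentation.

(** * The bimodule complex of the free product *)

Section LinearSums.
Variables (k : fieldType) (I : finType).

Lemma sum_linear (U V : lmodType k) (F : I -> {linear U -> V}) :
  linear (fun x => \sum_i F i x).
Proof.
move=> c x y; rewrite scaler_sumr -big_split; apply: eq_bigr => i _.
exact: linearP.
Qed.

Variables (U : I -> lmodType k) (V : lmodType k) (F : forall i, {linear U i -> V}).

Lemma sum_linB (x a b : forall i, U i) : (forall i, x i = a i - b i) ->
  \sum_i F i (x i) = \sum_i F i (a i) - \sum_i F i (b i).
Proof.
by move=> xE; rewrite -sumrB; apply: eq_bigr => i _; rewrite xE linearB.
Qed.

Lemma sum_lin2 M (x : forall i, U i) (a : forall i, nat -> nat -> U i) :
  (forall i, x i = \sum_(n < M) \sum_(l < n.+1) a i n l) ->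
  \sum_i F i (x i) = \sum_(n < M) \sum_(l < n.+1) \sum_i F i (a i n l).
Proof.
move=> xE; under eq_bigr do rewrite xE linear_sum.
rewrite exchange_big; apply: eq_bigr => n _.
under eq_bigr do rewrite linear_sum.
exact: exchange_big.
Qed.

End LinearSums.

Section TensorSplit.
Variables (k : fieldType) (X : choiceType) (J U : lmodType k).
Local Notation T := {malg k[{fmonom X}]}.
Local Notation V := (gens k X).
Variables (I : finType) (f : I -> {linear T -> T}) (g : I -> {linear J -> J}).
Variables (v : {linear J -> T}) (F : T -> J -> T -> U).
Hypothesis vI : injective v.
Hypothesis F1 : forall j b, linear (fun a => F a j b).
Hypothesis F2 : forall a b, linear (fun j => F a j b).
Hypothesis F3 : forall a j, linear (fun b => F a j b).
Hypothesis fV : forall i n t, tpow V n t -> tpow V n (f i t).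
Hypothesis fM : forall i x y, f i (x * y) = f i x * f i y.
Hypothesis vg : forall i j, v (g i j) = f i (v j).

(** The difference of the two sides comes from a tensor whose product is 0, and [tensor3_eq0] says
    that such a tensor is 0. Individual terms of [r] need not be fixed by the projections. *)
Lemma tensor3_split l m (r : seq (T * J * T)) :
  (forall q, q \in r -> tpow V l q.1.1 /\ tpow V m q.2) ->
  \sum_(q <- r) q.1.1 * v q.1.2 * q.2 =
    \sum_i f i (\sum_(q <- r) q.1.1 * v q.1.2 * q.2) ->
  \sum_(q <- r) F q.1.1 q.1.2 q.2 =
    \sum_i \sum_(q <- r) F (f i q.1.1) (g i q.1.2) (f i q.2).
Proof.
move=> rP rE; apply/eqP; rewrite -subr_eq0; apply/eqP.
(* The sign sits in the first factor, so that the difference is again a sum over one list of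
   tensors. *)
pose r' := [seq (- f i q.1.1, g i q.1.2, f i q.2) | i <- index_enum I, q <- r].
have FN a j b : F (- a) j b = - F a j b.
  by have := linZ (-1) a (F1 j b); rewrite /= !scaleN1r.
have -> : \sum_(q <- r) F q.1.1 q.1.2 q.2 -
    \sum_i \sum_(q <- r) F (f i q.1.1) (g i q.1.2) (f i q.2) =
    \sum_(q <- r ++ r') F q.1.1 q.1.2 q.2.
  rewrite big_cat; congr (_ + _); rewrite /r' big_allpairs_dep /= -sumrN.
  apply: eq_bigr => i _; rewrite -sumrN; apply: eq_bigr => q _.
  by rewrite FN.
apply: (@tensor3_eq0 _ _ _ _ v l m) => // [q|].
  rewrite mem_cat => /orP[/rP//|/allpairsP[[i q'] [/= _ /rP[q1 q2] ->]]] /=.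
  split; last exact: fV.
  apply: (subspaceN (W := tpow V l)); last exact: fV.
  case: (l) => [|n]; last by rewrite tpowS; exact: subspace_span.
  by rewrite /tpow big_ord0; exact: subspace_span.
rewrite big_cat /= [X in X + _]rE /r' big_allpairs_dep /= -big_split big1 // => i _.
rewrite linear_sum -big_split big1 // => q _ /=.
by rewrite !fM vg !mulNr subrr.
Qed.

End TensorSplit.

Section FreeComplex.
Variables (k : fieldType) (S : finType) (B : S -> gralg k).
Variable p : forall s, presentation (B s).
Variables (A : gralg k) (inj : forall s, {lrmorphism B s -> A}).
Hypothesis A_coprod : is_coproduct inj.

Local Notation pA := (fpres p A_coprod).
Local Notation T := {malg k[{fmonom (gen pA)}]}.
Local Notation V := (gens k (gen pA)).

Lemma iota_rel s t : relsp (p s) t -> relsp pA (iota p s t).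
Proof. exact: iota_frel. Qed.

Lemma rho_rel s t : relsp pA t -> relsp (p s) (rho p s t).
Proof. by case=> _; exact. Qed.

Definition Jiota s i : {linear Jsp (p s) i -> Jsp pA i} :=
  @Jmap _ _ _ (p s) pA (iota p s) (@iota_gens _ _ _ p s) (@iota_rel s) i.

Definition Jrho s i : {linear Jsp pA i -> Jsp (p s) i} :=
  @Jmap _ _ _ pA (p s) (rho p s) (@rho_gens _ _ _ p s) (@rho_rel s) i.

Lemma val_Jiota s i (w : Jsp (p s) i) : \val (Jiota s i w) = iota p s (\val w).
Proof. exact: val_Jmap. Qed.

Lemma val_Jrho s i (w : Jsp pA i) : \val (Jrho s i w) = rho p s (\val w).
Proof. exact: val_Jmap. Qed.

Lemma Jrho_iota s i w : Jrho s i (Jiota s i w) = w.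
Proof. by apply: val_inj; rewrite val_Jrho val_Jiota rhoK. Qed.

Lemma Jsp_mem (C : gralg k) (q : presentation C) i (w : Jsp q i) : J q i (\val w).
Proof. exact: set_mem (valP w). Qed.

Lemma J_ne s i t : (0 < i)%N -> J (p s) i t -> supp [set u | u <> [::]] t.
Proof.
move=> i0 Jt.
have Rm r : relsp (p s) r -> supp (mono (fun=> tt)) r.
  move=> /relsp_ne; apply: supp_sub => u u0; split=> //.
  by exists tt.
by have := J_mono Rm i0 Jt; apply: supp_sub => u [].
Qed.

Lemma Jrho_iota_neq s s' i w : (0 < i)%N -> s' != s -> Jrho s' i (Jiota s i w) = 0.
Proof.
move=> i0 ss'; apply: val_inj; rewrite val_Jrho val_Jiota.
rewrite rho_iota_neq //; exact: J_ne i0 (Jsp_mem w).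
Qed.

Lemma Rmono t : relsp pA t -> supp (fmono (p := p)) t.
Proof. by case. Qed.

Lemma JA_mono i t : (0 < i)%N -> J pA i t -> supp (fmono (p := p)) t.
Proof. exact: (J_mono (p := pA) Rmono). Qed.

(** In positive degree the words of an element of [J] lie over single indices, and its component
    over [s] belongs to J_i(B_s) because [rho s] maps J to J. *)
Lemma Jiota_sum i (w : Jsp pA i) : (0 < i)%N -> w = \sum_s Jiota s i (Jrho s i w).
Proof.
move=> i0; apply: val_inj; rewrite [LHS](mono_sum (JA_mono i0 (Jsp_mem w))).
transitivity (\sum_s \val (Jiota s i (Jrho s i w))).
  by apply: eq_bigr => s _; rewrite val_Jiota val_Jrho.
by symmetry; exact: (linear_sum (Jval pA i)).
Qed.

Lemma iotaK_ex s i : exists f : {linear K (p s) i -> K pA i},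
  forall a w b, f (bim a w b) = bim (inj s a) (Jiota s i w) (inj s b).
Proof.
apply: (bt_lift (K_tensor (p s) i)
  (f := fun a w b => bim (inj s a) (Jiota s i w) (inj s b))) => [w b|a b|a w] c x y.
- by rewrite linearP (bt_lin1 (K_tensor pA i)).
- by rewrite linearP (bt_lin2 (K_tensor pA i)).
- by rewrite linearP (bt_lin3 (K_tensor pA i)).
Qed.

Definition iotaK s i : {linear K (p s) i -> K pA i} := sval (cid (iotaK_ex s i)).

Lemma iotaK_bim s i a w b :
  iotaK s i (bim a w b) = bim (inj s a) (Jiota s i w) (inj s b).
Proof. exact: (svalP (cid (iotaK_ex s i))). Qed.

Variable d : forall s i, {linear K (p s) i.+1 -> K (p s) i}.
Hypothesis dP : forall s, is_delta (d s).

Lemma dgen_ex i : exists f : {linear Jsp pA i.+1 -> K pA i},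
  forall w, f w = \sum_s iotaK s i (d s i (bim 1 (Jrho s i.+1 w) 1)).
Proof.
pose g s : {linear Jsp (p s) i.+1 -> K (p s) i.+1} :=
  mklin (bt_lin2 (K_tensor (p s) i.+1) 1 1).
by exists (mklin (sum_linear (fun s => iotaK s i \o (d s i \o (g s \o Jrho s i.+1))))).
Qed.

Definition dgen i : {linear Jsp pA i.+1 -> K pA i} := sval (cid (dgen_ex i)).

Lemma dgenE i w : dgen i w = \sum_s iotaK s i (d s i (bim 1 (Jrho s i.+1 w) 1)).
Proof. exact: (svalP (cid (dgen_ex i))). Qed.

Lemma dA_ex i : exists f : {linear K pA i.+1 -> K pA i}, [/\
    forall a w b, f (bim a w b) = ractK (lactK a (dgen i w)) b,
    forall a x, f (lactK a x) = lactK a (f x) & forall x a, f (ractK x a) = ractK (f x) a].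
Proof. exact: (bimodule_extension (K_tensor pA i.+1) (K_tensor pA i) (dgen i)). Qed.

Definition dA i : {linear K pA i.+1 -> K pA i} := sval (cid (dA_ex i)).

Lemma dA_bimodule i : bimodule_map (dA i).
Proof. by rewrite /dA; case: cid => f []. Qed.

Lemma dA1 i w : dA i (bim 1 w 1) = \sum_s iotaK s i (d s i (bim 1 (Jrho s i.+1 w) 1)).
Proof.
rewrite /dA; case: cid => f [fE _ _] /=.
by rewrite fE (la1 (K_tensor pA i)) (ra1 (K_tensor pA i)) dgenE.
Qed.

(** [Jrho] annihilates the element at all indices other than [s], so one summand survives; this is
    the chain map property of [iotaK s] on generators. *)
Lemma dA_iota s i w : dA i (bim 1 (Jiota s i.+1 w) 1) = iotaK s i (d s i (bim 1 w 1)).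
Proof.
rewrite dA1 (bigD1 s) // Jrho_iota big1 => [|s' ss']; first exact: addr0.
rewrite Jrho_iota_neq //.
rewrite (lin0 (f := fun w => bim 1 w 1)); last exact: (bt_lin2 (K_tensor (p s') i.+1)).
by rewrite !linear0.
Qed.

Lemma projA_iota s t : proj pA (iota p s t) = inj s (proj (p s) t).
Proof. exact: fprj_iota. Qed.

(** The list [r] may contain tensors mixing several indices. Only its total product is known to lie
    in [fmono], and that is enough for the mixed tensors to cancel. *)
Lemma bim_split i l m (r : seq (T * Jsp pA i * T)) :
  (forall q, q \in r -> tpow V l q.1.1 /\ tpow V m q.2) ->
  supp (fmono (p := p)) (\sum_(q <- r) q.1.1 * \val q.1.2 * q.2) ->
  \sum_(q <- r) bim (proj pA q.1.1) q.1.2 (proj pA q.2) =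
  \sum_s iotaK s i (\sum_(q <- r)
    bim (proj (p s) (rho p s q.1.1)) (Jrho s i q.1.2) (proj (p s) (rho p s q.2))).
Proof.
move=> rP rm.
have -> : \sum_(q <- r) bim (proj pA q.1.1) q.1.2 (proj pA q.2) =
  \sum_s \sum_(q <- r) bim (proj pA (iota p s (rho p s q.1.1)))
     (Jiota s i (Jrho s i q.1.2)) (proj pA (iota p s (rho p s q.2))).
  apply: (@tensor3_split k (fgen p) (Jsp pA i) (K pA i) S
    (fun s => iota p s \o rho p s) (fun s => Jiota s i \o Jrho s i) (Jval pA i)
    (fun a j b => bim (proj pA a) j (proj pA b)) _ _ _ _ _ _ _ l m) => //.
  - exact: val_inj.
  - by move=> j b c x y; rewrite linearP (bt_lin1 (K_tensor pA i)).
  - by move=> a b; exact: (bt_lin2 (K_tensor pA i)).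
  - by move=> a j c x y; rewrite linearP (bt_lin3 (K_tensor pA i)).
  - move=> s n t /= tn; apply: (tpow_map (@iota_gens _ _ _ p s)).
    exact: (tpow_map (@rho_gens _ _ _ p s)).
  - by move=> s x y /=; rewrite !rmorphM.
  - by rewrite {1}(mono_sum rm).
apply: eq_bigr => s _; rewrite linear_sum; apply: eq_bigr => q _.
by rewrite !projA_iota; symmetry; exact: iotaK_bim.
Qed.

End FreeComplex.

Arguments iotaK {k S B p A inj} A_coprod s i.
Arguments Jiota {k S B p A inj} A_coprod s i.
Arguments Jrho {k S B p A inj} A_coprod s i.
Arguments dA {k S B p A inj} A_coprod d i.

(** * The assembled maps satisfy the defining formulas of the differential *)

Section FreeDelta.
Variables (k : fieldType) (S : finType) (B : S -> gralg k).
Variable p : forall s, presentation (B s).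
Variables (A : gralg k) (inj : forall s, {lrmorphism B s -> A}).
Hypothesis A_coprod : is_coproduct inj.

Local Notation pA := (fpres p A_coprod).
Local Notation T := {malg k[{fmonom (gen pA)}]}.
Local Notation V := (gens k (gen pA)).

Variable d : forall s i, {linear K (p s) i.+1 -> K (p s) i}.
Hypothesis dP : forall s, is_delta (d s).

Lemma tpow0_1 : tpow V 0 1.
Proof. by rewrite /tpow big_ord0; apply: span_incl. Qed.

Lemma tpow1 t : V t -> tpow V 1 t.
Proof.
by move=> Vt; rewrite tpowS -[t]mulr1; apply: tmulM => //; exact: tpow0_1.
Qed.

Lemma dA_odd : delta_odd (dA A_coprod d).
Proof.
move=> j w r r' rV wr rV' wr'; rewrite dA1.
have wm : supp (fmono (p := p)) (\val w) := JA_mono (ltn0Sn _) (Jsp_mem w).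
pose a s := \sum_(q <- r) bim (proj (p s) (rho p s q.1)) (Jrho A_coprod s j.*2 q.2) 1.
pose b s := \sum_(q <- r') bim 1 (Jrho A_coprod s j.*2 q.1) (proj (p s) (rho p s q.2)).
have E s : d s j.*2 (bim 1 (Jrho A_coprod s j.*2.+1 w) 1) = a s - b s.
  have [_ dodd _] := dP s.
  (* Applying [rho s] termwise to the given decompositions of [w] yields decompositions of its
     component over [s], to which the formula for [B s] applies. *)
  rewrite (dodd j _ [seq (rho p s q.1, Jrho A_coprod s j.*2 q.2) | q <- r]
    [seq (Jrho A_coprod s j.*2 q.1, rho p s q.2) | q <- r']).
  - by rewrite !big_map.
  - by move=> _ /mapP[q qr ->]; apply: rho_gens; exact: rV.
  - rewrite val_Jrho wr linear_sum big_map; apply: eq_bigr => q _.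
    by rewrite [LHS]rmorphM [\val (Jrho _ _ _ _)]val_Jrho.
  - by move=> _ /mapP[q qr ->]; apply: rho_gens; exact: rV'.
  - rewrite val_Jrho wr' linear_sum big_map; apply: eq_bigr => q _.
    by rewrite [LHS]rmorphM [\val (Jrho _ _ _ _)]val_Jrho.
rewrite (sum_linB (fun s => iotaK A_coprod s j.*2) E); congr (_ - _).
  (* Padding with 1 puts the left half in V (x) J (x) V^(0) and, further down, the right half in
     V^(0) (x) J (x) V, the shape required by [bim_split]. *)
  transitivity (\sum_(q <- [seq (q.1, q.2, 1) | q <- r])
     bim (proj pA q.1.1) q.1.2 (proj pA q.2)); last first.
    by rewrite big_map; apply: eq_bigr => q _; rewrite rmorph1.
  rewrite (@bim_split _ _ _ _ _ _ A_coprod _ 1 0) => [|_ /mapP[q qr ->]|]; last 2 first.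
  - by split; [apply: tpow1; exact: (rV q) | exact: tpow0_1].
  - by rewrite big_map; under eq_bigr do rewrite mulr1; rewrite -wr.
  apply: eq_bigr => s _; congr (iotaK A_coprod s _ _); rewrite /a big_map.
  by apply: eq_bigr => q _; rewrite !rmorph1.
transitivity (\sum_(q <- [seq (1, q.1, q.2) | q <- r'])
   bim (proj pA q.1.1) q.1.2 (proj pA q.2)); last first.
  by rewrite big_map; apply: eq_bigr => q _; rewrite rmorph1.
rewrite (@bim_split _ _ _ _ _ _ A_coprod _ 0 1) => [|_ /mapP[q qr ->]|]; last 2 first.
- by split; [exact: tpow0_1 | apply: tpow1; exact: (rV' q)].
- by rewrite big_map; under eq_bigr do rewrite mul1r; rewrite -wr'.
apply: eq_bigr => s _; congr (iotaK A_coprod s _ _); rewrite /b big_map.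
by apply: eq_bigr => q _; rewrite !rmorph1.
Qed.

Section EvenMono.
Variables (j : nat) (w : Jsp pA j.*2.+2) (M : nat) (wN : nat -> T).
Variable t : nat -> nat -> seq (T * Jsp pA j.*2.+1 * T).
Hypothesis wE : \val w = \sum_(N < M) wN N.
Hypothesis tP : forall N l, (N < M)%N -> (l <= N)%N ->
  (forall q, q \in t N l -> tpow V l q.1.1 /\ tpow V (N - l)%N q.2) /\
  wN N = \sum_(q <- t N l) q.1.1 * \val q.1.2 * q.2.

Lemma even_window N l P : (N < M)%N -> (l <= N)%N ->
  (forall t, J pA j.*2.+1 t -> supp P t) -> supp (window l N P) (wN N).
Proof.
move=> NM lN JP; have [h1 ->] := tP NM lN.
apply: subspace_sum_seq => [|q qt]; first exact: supp_subspace.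
have [q1 q2] := h1 q qt.
exact: (window_supp JP) q1 (Jsp_mem q.1.2) q2.
Qed.

(** The components [wN N] come from an arbitrary decomposition, so each needs its own argument. For
    [j > 0] the windows overlap. For [j = 0] the middle factor is a single letter and they do not;
    but then [wN N] has words of length [N + 1] only, so it is a length component of [w], whose
    words are known to be in [fmono]. *)
Lemma even_mono N : (N < M)%N -> supp (fmono (p := p)) (wN N).
Proof.
move=> NM; have [j0|j1] := posnP j; last first.
  have Jm x : J pA j.*2.+1 x -> supp (mono2 (fun x : fgen p => tag x)) x.
    by apply: (J_mono2 (p := pA) (@Rmono _ _ _ p _ _ A_coprod)); rewrite ltnS double_gt0.
  move=> u uw; suff [] : mono2 (fun x : fgen p => tag x) u by [].
  apply: (@window_mono _ _ _ N) => l lN.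
  exact: (even_window NM lN Jm) uw.
have Js N' : (N' < M)%N -> supp [set u | size u = N'.+1] (wN N').
  move=> NM'; have J1 x : J pA j.*2.+1 x -> supp [set u | size u = 1%N] x.
    by rewrite j0 => /J1_supp/gens_supp.
  apply: supp_sub (even_window NM' (leq0n _) J1) => _ [a [b [c [/= a0 b1 c0 ->]]]] /=.
  by rewrite !size_cat a0 b1 c0 subn0.
(* Words of the other components have other lengths, so the coefficient of [u] in [w] is its
   coefficient in [wN N], hence nonzero. *)
move=> u uw; apply: (JA_mono (ltn0Sn _) (Jsp_mem w)); rewrite -mcoeff_neq0 wE.
rewrite linear_sum (bigD1 (Ordinal NM)) //= big1 ?addr0 ?mcoeff_neq0 // => N' NN'.
apply/eqP; rewrite mcoeff_eq0; apply/negP => /(Js _ (ltn_ord N')) /= uN'.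
have /= uN := Js _ NM _ uw.
by move: NN'; rewrite -val_eqE /= -eqSS -uN' -uN eqxx.
Qed.

End EvenMono.

Lemma dA_even : delta_even (dA A_coprod d).
Proof.
move=> j w M wN t wE tP; rewrite dA1.
pose a s N l := \sum_(q <- t N l)
  bim (proj (p s) (rho p s q.1.1)) (Jrho A_coprod s j.*2.+1 q.1.2) (proj (p s) (rho p s q.2)).
have E s : d s j.*2.+1 (bim 1 (Jrho A_coprod s j.*2.+2 w) 1) =
    \sum_(N < M) \sum_(l < N.+1) a s N l.
  have [_ _ deven] := dP s.
  rewrite (deven j _ M (fun N => rho p s (wN N)) (fun N l =>
    [seq (rho p s q.1.1, Jrho A_coprod s j.*2.+1 q.1.2, rho p s q.2) | q <- t N l])).
  - apply: eq_bigr => N _; apply: eq_bigr => l _; exact: big_map.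
  - by rewrite val_Jrho wE linear_sum.
  - move=> N l NM lN; have [h1 h2] := tP N l NM lN; split.
      move=> _ /mapP[q qt ->] /=; have [q1 q2] := h1 q qt.
      by split; apply: (tpow_map (@rho_gens _ _ _ p s)).
    rewrite h2 linear_sum big_map; apply: eq_bigr => q _.
    by rewrite !rmorphM [\val (Jrho _ _ _ _)]val_Jrho.
rewrite (sum_lin2 (fun s => iotaK A_coprod s j.*2.+1) E).
apply: eq_bigr => N _; apply: eq_bigr => l _.
have lN : (l <= N)%N by rewrite -ltnS.
have [h1 h2] := tP N l (ltn_ord N) lN; symmetry.
apply: (@bim_split _ _ _ _ _ _ A_coprod _ l (N - l)) => //.
by rewrite -h2; exact: even_mono wE tP _ (ltn_ord N).
Qed.

Lemma dA_delta : is_delta (dA A_coprod d).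
Proof. by split; [move=> i; exact: dA_bimodule | exact: dA_odd | exact: dA_even]. Qed.

End FreeDelta.

(** * Gluing contracting homotopies *)

Section Theta.
Variables (k : fieldType) (S : finType) (B : S -> gralg k).
Variable p : forall s, presentation (B s).
Variables (A : gralg k) (inj : forall s, {lrmorphism B s -> A}).
Hypothesis A_coprod : is_coproduct inj.

Local Notation T := {malg k[{fmonom (fgen p)}]}.
Local Notation prj := (fprj p inj).

Variable s : S.
Local Notation M := (tsr A (B s)).

Lemma mu_bilin : bilin (fun (a : A) (b : B s) => a * inj s b).
Proof.
split=> [c a a' b|c a b b']; first by rewrite mulrDl scalerAl.
by rewrite linearP mulrDr scalerAr.
Qed.

Definition mu : {linear M -> A} := tplin mu_bilin.

Lemma muE a b : mu (tp a b) = a * inj s b. Proof. exact: tplinE. Qed.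

Lemma mu1 a : mu (tp a 1) = a.
Proof. by rewrite muE rmorph1 mulr1. Qed.

Definition rmulM (b : B s) : {linear M -> M} := tpmap idfun (mulRl b).

Lemma rmulME b a b' : rmulM b (tp a b') = tp a (b' * b).
Proof. exact: tpmapE. Qed.

Lemma rmulM_linear m : linear (fun b => rmulM b m).
Proof.
move=> c b b'; apply: (tsr_eq (f := rmulM (c *: b + b'))
  (g := fun m => c *: rmulM b m + rmulM b' m)) m => [|e x y|a b''].
- exact: linearP.
- by rewrite (linearP (rmulM b)) (linearP (rmulM b')) scalerDr !scalerA mulrC addrACA
    [in RHS]scalerDr !scalerA.
- by rewrite !rmulME mulrDr -scalerAr tpPr.
Qed.

(* T acts on A (x) B_s on the right so that mu is equivariant, letters over s
   acting on the second factor; theta is the orbit map of 1 (x) 1. *)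
Definition stepM (x : fgen p) (m : M) : M :=
  if tag x == s then rmulM (proj (p s) (rho p s (wd k [:: x]))) m
  else tp (mu m * prj (wd k [:: x])) 1.

Lemma stepM_linear x : linear (stepM x).
Proof.
move=> c m m'; rewrite /stepM; case: eqP => _; first exact: linearP.
by rewrite linearP mulrDl -scalerAl tpPl.
Qed.

Definition actw (m : M) (u : seq (fgen p)) : M := foldl (fun m x => stepM x m) m u.

Lemma actw_linear u : linear (actw^~ u).
Proof.
elim: u => [|x u IHu] c m m' //=.
by rewrite -IHu; congr actw; exact: stepM_linear.
Qed.

Definition act (m : M) : {linear T -> M} := lext (actw m).

Lemma act_wd m u : act m (wd k u) = actw m u. Proof. exact: lext_wd. Qed.

Lemma act_linear t : linear (fun m => act m t).
Proof.
move=> c m m'.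
have fl : linear (fun t => c *: act m t + act m' t).
  move=> e x y; rewrite (linearP (act m)) (linearP (act m')) scalerDr !scalerA mulrC.
  by rewrite addrACA [in RHS]scalerDr !scalerA.
apply: (malg_eq (f := act _) (g := mklin fl)) t => u.
by rewrite mklinE !act_wd actw_linear.
Qed.

Lemma actM m t t' : act m (t * t') = act (act m t) t'.
Proof.
apply: (malg_eq (f := act m \o mulRl t') (g := mklin (act_linear t') \o act m)) t => u.
apply: (malg_eq (f := act m \o mulLl (@malgAr k _) (wd k u)) (g := act (act m (wd k u)))) t' => v.
by rewrite /= -wd_cat !act_wd /actw foldl_cat.
Qed.

Lemma mu_act m t : mu (act m t) = mu m * prj t.
Proof.
apply: (malg_eq (f := mu \o act m) (g := mulLl (fun c x y => esym (scalerAr c x y)) (mu m) \o prj)) t => u.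
rewrite /= act_wd; elim: u m => [|x u IHu] m; first by rewrite wd_nil rmorph1 mulr1.
rewrite -cat1s wd_cat rmorphM /= IHu mulrA; congr (_ * _).
rewrite /stepM; case: eqP => [xs|_]; last by rewrite mu1.
apply: (tsr_eq (f := fun m => mu (rmulM (proj (p s) (rho p s (wd k [:: x]))) m))
  (g := fun m => mu m * prj (wd k [:: x]))) m => [c y z|c y z|a b].
- by rewrite linearP linearP.
- by rewrite linearP mulrDl -scalerAl.
rewrite rmulME !muE rmorphM mulrA; congr (_ * _).
by rewrite /= -(fprj_iota inj) iota_rho // => y; rewrite inE => /eqP->.
Qed.

Lemma act_iota m t : act m (iota p s t) = rmulM (proj (p s) t) m.
Proof.
apply: (malg_eq (f := act m \o iota p s) (g := mklin (rmulM_linear m) \o proj (p s))) t => u.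
rewrite /= iota_wd act_wd; elim: u m => [|g u IHu] m /=.
  rewrite wd_nil rmorph1.
  apply: (tsr_eq (f := idfun) (g := rmulM 1)) m => // [|a b]; first exact: linearP.
  by rewrite rmulME mulr1.
rewrite IHu -cat1s wd_cat rmorphM /stepM eqxx rho_gen.
apply: (tsr_eq (f := fun m => rmulM (proj (p s) (wd k u)) (rmulM (proj (p s) (wd k [:: g])) m))
  (g := rmulM (proj (p s) (wd k [:: g]) * proj (p s) (wd k u)))) m => [c y z||a b].
- by rewrite (linearP (rmulM (proj (p s) (wd k [:: g])))) (linearP (rmulM _)).
- exact: linearP.
- by rewrite !rmulME mulrA.
Qed.

(** The first letter over [s'] multiplies everything into the left factor and resets the right one
    to 1; later letters only extend the left factor. The empty word, which acts as the identity, has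
    to be kept out. *)
Lemma act_iota_neq m s' t : s' != s -> supp [set u | u <> [::]] t ->
  act m (iota p s' t) = tp (mu m * prj (iota p s' t)) 1.
Proof.
move=> ss' tn.
have fl : linear (fun a : A => tp (mu m * a) 1 : M).
  by move=> c a a'; rewrite mulrDr -scalerAr tpPl.
apply: (supp_eq (f := act m \o iota p s') (g := mklin fl \o (prj \o iota p s')) _ tn) => u u0.
change (act m (iota p s' (wd k u)) = tp (mu m * prj (iota p s' (wd k u))) 1).
rewrite iota_wd act_wd; elim: u u0 m {fl tn} => [//|g u IHu] _ m.
have E : stepM (fin g) m = tp (mu m * prj (wd k [:: fin g])) 1.
  by rewrite /stepM (negbTE ss').
case: u IHu => [|g' u] IHu; first exact: E.
transitivity (actw (stepM (fin g) m) [seq fin g0 | g0 <- g' :: u]); first by [].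
rewrite IHu; last by [].
rewrite E mu1 -[_ * _ * _]mulrA -(rmorphM prj) /= -wd_cat.
reflexivity.
Qed.

(** A relation of [B s] acts as right multiplication by its image 0, and a relation of another
    factor as multiplication of the left factor by 0. *)
Lemma act_frel m r : frel p r -> act m r = 0.
Proof.
move=> [rm rr]; rewrite (mono_sum rm) linear_sum big1 // => s' _ /=.
have pr : proj (p s') (rho p s' r) = 0 by apply/proj_ker; apply: tideal_incl.
have [E|ss'] := eqVneq s' s.
  subst s'; rewrite act_iota pr.
  exact: (lin0 (rmulM_linear m)).
rewrite act_iota_neq //; last exact: relsp_ne.
rewrite (fprj_iota inj) pr linear0 mulr0.
exact: (lin0 (fun c a a' => tpPl c a a' 1)).
Qed.

Lemma act_tideal m t : tideal (frel p) t -> act m t = 0.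
Proof.
have Z : subspace [set 0 : M] by split=> // c x y /= -> ->; rewrite scaler0 addr0.
move: t; apply: (tideal_sub (subspace_preim (act m) Z)) => a r b rr /=.
by rewrite !actM (act_frel _ rr) (lin0 (act_linear b)).
Qed.

Lemma theta_ex : exists f : {linear A -> M}, forall t, f (prj t) = act (tp 1 1) t.
Proof.
apply: (lift_linear (q := prj) (f := act (tp 1 1))) => [|t].
  exact: fprj_surj A_coprod.
by move=> /(fprj_eq0 A_coprod)/act_tideal.
Qed.

Definition theta : {linear A -> M} := sval (cid theta_ex).

Lemma thetaE t : theta (prj t) = act (tp 1 1) t.
Proof. exact: (svalP (cid theta_ex)). Qed.

Lemma theta1 : theta 1 = tp 1 1.
Proof. by have := thetaE (wd k [::]); rewrite act_wd wd_nil rmorph1. Qed.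

Lemma mu_theta a : mu (theta a) = a.
Proof.
have [t <-] := fprj_surj p A_coprod a.
by rewrite thetaE mu_act mu1 !mul1r.
Qed.

Lemma theta_mulr a b : theta (a * inj s b) = rmulM b (theta a).
Proof.
have [t <-] := fprj_surj p A_coprod a; have [u <-] := proj_surj (p s) b.
by rewrite -(fprj_iota inj) -(rmorphM prj) /= !thetaE actM act_iota.
Qed.

(** As [aug b = 0], a lift of [b] has no constant term; it consists of nonempty words, to which
    [act_iota_neq] applies. *)
Lemma theta_other s' a (b : B s') : s' != s -> aug b = 0 ->
  theta (a * inj s' b) = tp (a * inj s' b) 1.
Proof.
have [t <-] := fprj_surj p A_coprod a; have [u <-] := proj_surj (p s') b.
move=> ss'; rewrite augE => u0; rewrite -(fprj_iota inj) -(rmorphM prj) /= !thetaE actM.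
rewrite act_iota_neq // => [|w wu w0].
  by rewrite mu_act mu1 !mul1r rmorphM.
by move: wu; rewrite -mcoeff_neq0 -[w]fmK w0 u0 eqxx.
Qed.

Lemma fprj_rcons u (x : fgen p) :
  prj (wd k (rcons u x)) = prj (wd k u) * inj (tag x) (proj (p (tag x)) (wd k [:: tagged x])).
Proof. by rewrite -cats1 wd_cat rmorphM /= (fprj_gen inj). Qed.

Lemma aug_gen (x : fgen p) : aug (proj (p (tag x)) (wd k [:: tagged x])) = 0.
Proof. by rewrite augE wdE. Qed.

(** By induction on the last letter: one over [s] extends [b], any other resets [b] to 1. The
    elements [a] found here, from which [theta] detaches nothing, do the work of a basis of [A] over
    [B s]. *)
Lemma theta_split u : exists a b, theta (prj (wd k u)) = tp a b /\ theta a = tp a 1.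
Proof.
elim/last_ind: u => [|u [s' g] [a [b [E Ea]]]].
  by exists 1, 1; rewrite wd_nil rmorph1 theta1.
rewrite fprj_rcons /=; have [ss'|ss'] := eqVneq s' s.
  subst s'; exists a, (b * proj (p s) (wd k [:: g])).
  by rewrite theta_mulr E rmulME.
set a' := _ * _; have Ea' : theta a' = tp a' 1.
  by apply: theta_other => //; exact: (aug_gen (fin g)).
by exists a', 1.
Qed.

End Theta.

Section LeftAction.
Variables (k : fieldType) (A : algType k) (J : lmodType k).

Lemma lactN_linearl (y : tsr A J) : linear (fun a => lactN J a y).
Proof.
move=> c a a'; apply: (tsr_eq (f := lactN J (c *: a + a'))
  (g := fun y => c *: lactN J a y + lactN J a' y)) y => [|e x y|b w].
- exact: linearP.
- rewrite (linearP (lactN J a)) (linearP (lactN J a')) scalerDr !scalerA mulrC addrACA.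
  by rewrite [in RHS]scalerDr !scalerA.
- by rewrite !lactNE mulrDl -scalerAl tpPl.
Qed.

End LeftAction.

(** * Chain maps from the left complexes of the factors *)

Section FreeResolution.
Variables (k : fieldType) (S : finType) (B : S -> gralg k).
Variable p : forall s, presentation (B s).
Variables (A : gralg k) (inj : forall s, {lrmorphism B s -> A}).
Hypothesis A_coprod : is_coproduct inj.

Local Notation pA := (fpres p A_coprod).
Local Notation T := {malg k[{fmonom (gen pA)}]}.
Local Notation prj := (fprj p inj).
Local Notation NA i := (tsr A (Jsp pA i)).
Local Notation NB s i := (tsr (B s) (Jsp (p s) i)).
Local Notation actA i := (lactN (Jsp pA i)).

Variable d : forall s i, {linear K (p s) i.+1 -> K (p s) i}.
Hypothesis dP : forall s, is_delta (d s).

Lemma dbim s i : bimodule_map (d s i).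
Proof. by have [h _ _] := dP s; exact: h. Qed.

Local Notation dNA := (ldN (dA A_coprod d)).

Lemma dAbim i : bimodule_map (dA A_coprod d i).
Proof. exact: dA_bimodule. Qed.

Definition iotaN s i : {linear NB s i -> NA i} := tpmap (inj s) (Jiota A_coprod s i).

Lemma iotaNE s i b w : iotaN s i (tp b w) = tp (inj s b) (Jiota A_coprod s i w).
Proof. exact: tpmapE. Qed.

Lemma iota_coeff0 s (t : {malg k[{fmonom (gen (p s))}]}) :
  (iota p s t)@_(FMonom [::]) = t@_(FMonom [::]).
Proof.
apply: (malg_eq (f := mcl k (FMonom ([::] : seq (fgen p))) \o iota p s)
  (g := mcl k (FMonom ([::] : seq (gen (p s)))))) t => u.
change ((iota p s (wd k u))@_(FMonom [::]) = (wd k u)@_(FMonom [::])).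
by rewrite iota_wd !wdE; case: u.
Qed.

Lemma aug_inj s (b : B s) : aug (inj s b) = aug b.
Proof.
have [t <-] := proj_surj (p s) b.
rewrite -(projA_iota A_coprod) (augE (p := pA)) (augE (p := p s)); exact: iota_coeff0.
Qed.

Lemma KtoN_iota s i x :
  KtoN (K_tensor pA i) (aug_linear pA) (iotaK A_coprod s i x) =
  iotaN s i (KtoN (K_tensor (p s) i) (aug_linear (p s)) x).
Proof.
apply: (bt_eq (K_tensor (p s) i)
  (f := KtoN (K_tensor pA i) (aug_linear pA) \o iotaK A_coprod s i)
  (g := iotaN s i \o KtoN (K_tensor (p s) i) (aug_linear (p s)))) x.
- exact: linearP.
- exact: linearP.
- by move=> a w b; rewrite /= iotaK_bim !KtoNE lZ iotaNE aug_inj.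
Qed.

Lemma iotaN_lact s i b y :
  iotaN s i (lactN (Jsp (p s) i) b y) = actA i (inj s b) (iotaN s i y).
Proof.
apply: (tsr_eq (f := iotaN s i \o lactN (Jsp (p s) i) b)
  (g := actA i (inj s b) \o iotaN s i)) y => [||e w].
- exact: linearP.
- exact: linearP.
- by rewrite /= lactNE !iotaNE lactNE rmorphM.
Qed.

Lemma dNA_iota s i y : dNA i (iotaN s i.+1 y) = iotaN s i (ldN (d s) i y).
Proof.
apply: (tsr_eq (f := dNA i \o iotaN s i.+1) (g := iotaN s i \o ldN (d s) i)) y => [||b w].
- exact: linearP.
- exact: linearP.
change (dNA i (iotaN s i.+1 (tp b w)) = iotaN s i (ldN (d s) i (tp b w))).
rewrite iotaNE; transitivity (actA i (inj s b)
  (KtoN (K_tensor pA i) (aug_linear pA) (dA A_coprod d i (bim 1 (Jiota A_coprod s i.+1 w) 1)))).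
  exact: (ldN_tp dAbim).
rewrite (dA_iota A_coprod d) KtoN_iota -iotaN_lact.
by congr (iotaN s i _); symmetry; exact: (ldN_tp (dbim s)).
Qed.

Lemma laugN_iota s y : laugN pA (iotaN s 0 y) = laugN (p s) y.
Proof.
apply: (tsr_eq (f := laugN pA \o iotaN s 0) (g := laugN (p s))) y => [||b w].
- exact: linearP.
- exact: linearP.
rewrite /= iotaNE !laugNE aug_inj; congr (_ * _).
have E (t : {malg k[{fmonom (gen (p s))}]}) : t@_mone = t@_(FMonom [::]).
  by congr (t@_ _); apply/val_inj; rewrite /= fm1.
have E' (t : T) : t@_mone = t@_(FMonom [::]).
  by congr (t@_ _); apply/val_inj; rewrite /= fm1.
rewrite !mklinE val_Jiota E E'; exact: iota_coeff0.
Qed.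

Lemma laugN_lact a (y : NA 0) : laugN pA (actA 0 a y) = aug a * laugN pA y.
Proof.
apply: (tsr_eq (f := laugN pA \o actA 0 a)
  (g := fun y => (aug a * laugN pA y : k^o))) y => [|c x y|b w].
- exact: linearP.
- by rewrite (linearP (laugN pA)) mulrDr; congr (_ + _); exact: mulrCA.
- by rewrite /= lactNE !laugNE (augM pA) mulrA.
Qed.

Lemma dNA_lact i a y : dNA i (actA i.+1 a y) = actA i a (dNA i y).
Proof. exact: (ldN_lact dAbim). Qed.

Lemma tp_iota s i a w :
  tp a (Jiota A_coprod s i w) = actA i a (iotaN s i (tp 1 w)) :> NA i.
Proof. by rewrite iotaNE lactNE rmorph1 mulr1. Qed.

(** The left factor is reduced to words so that [theta_split] can be applied; positivity of [i]
    gives the splitting of the right factor by [Jiota_sum]. *)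
Lemma NA_ind i (Q : set (NA i)) : (0 < i)%N -> subspace Q ->
  (forall u s w, Q (tp (prj (wd k u)) (Jiota A_coprod s i w))) -> forall x, Q x.
Proof.
move=> i0 Qs QJ; apply: (tsr_ind Qs) => a w.
rewrite (Jiota_sum w i0) -tpRE linear_sum; apply: (subspace_sum Qs) => s _.
have [t <-] := fprj_surj p A_coprod a.
apply: (malg_ind (subspace_preim (tpL _ (Jiota A_coprod s i (Jrho A_coprod s i w)) \o prj) Qs)).
by move=> u; exact: QJ.
Qed.

(** The spanning tensors are left multiples of elements of the form [iotaN s _ _]; left linearity
    and [dNA_iota] move the computation to [B s]. *)
Lemma dNA_dNA i y : (forall s i y, ldN (d s) i (ldN (d s) i.+1 y) = 0) ->
  dNA i (dNA i.+1 y) = 0.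
Proof.
move=> dd; apply: (NA_ind (i := i.+2) (Q := [set y | dNA i (dNA i.+1 y) = 0])) y => // [|u s w].
  exact: (subspace_eqlin (dNA i \o dNA i.+1) \0).
change (dNA i (dNA i.+1 (tp (prj (wd k u)) (Jiota A_coprod s i.+2 w))) = 0).
rewrite tp_iota dNA_lact dNA_iota dNA_lact dNA_iota dd.
by rewrite (linear0 (iotaN s i)) linear0.
Qed.

Lemma laugN_dNA y : (forall s y, laugN (p s) (ldN (d s) 0 y) = 0) ->
  laugN pA (dNA 0 y) = 0.
Proof.
move=> ed; apply: (NA_ind (i := 1) (Q := [set y | laugN pA (dNA 0 y) = 0])) y => // [|u s w].
  exact: (subspace_eqlin (laugN pA \o dNA 0) \0).
change (laugN pA (dNA 0 (tp (prj (wd k u)) (Jiota A_coprod s 1 w))) = 0).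
by rewrite tp_iota dNA_lact dNA_iota laugN_lact laugN_iota ed mulr0.
Qed.

End FreeResolution.

Lemma aug_sub (k : fieldType) (B : gralg k) (p : presentation B) (b : B) :
  aug (b - (aug b)%:A) = 0.
Proof.
pose f : {linear B -> k^o} := mklin (aug_linear p).
suff : f (b - (aug b)%:A) = 0 by [].
rewrite linearB (lZ f) {2}/f mklinE (aug1 p) /f mklinE.
by rewrite [_ *: _]mulr1 subrr.
Qed.

(** * The glued homotopy *)

Section GluedHomotopy.
Variables (k : fieldType) (S : finType) (B : S -> gralg k).
Variable p : forall s, presentation (B s).
Variables (A : gralg k) (inj : forall s, {lrmorphism B s -> A}).
Hypothesis A_coprod : is_coproduct inj.

Local Notation pA := (fpres p A_coprod).
Local Notation NA i := (tsr A (Jsp pA i)).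
Local Notation NB s i := (tsr (B s) (Jsp (p s) i)).
Local Notation actA i := (lactN (Jsp pA i)).
Local Notation th s := (theta p A_coprod s).
Local Notation iotaN s i := (iotaN p A_coprod s i).
Local Notation iJ s i := (Jiota A_coprod s i).
Local Notation rJ s i := (Jrho A_coprod s i).

Variable h : forall s i, {linear NB s i -> NB s i.+1}.

Lemma glue_bilin s i (w : Jsp (p s) i) :
  bilin (fun a b => actA i.+1 a (iotaN s i.+1 (h s i (tp b w)))).
Proof.
split=> [c a a' b|c a b b']; first exact: lactN_linearl.
rewrite tpPl (linearP (h s i)) (linearP (iotaN s i.+1)).
exact: linearP.
Qed.

(** This is 1 (x) h_s with the vector of J_i(B_s) frozen, followed by the map into A (x)
    J_{i+1}(A). *)
Definition glue s i w : {linear tsr A (B s) -> NA i.+1} := tplin (@glue_bilin s i w).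

Lemma glueE s i w a b :
  glue w (tp a b) = actA i.+1 a (iotaN s i.+1 (h s i (tp b w))).
Proof. exact: tplinE. Qed.

Lemma glue_linear s i m : linear (fun w : Jsp (p s) i => glue w m).
Proof.
move=> c w w'; apply: (tsr_eq (f := glue (c *: w + w'))
  (g := fun m => c *: glue w m + glue w' m)) m => [|e x y|a b].
- exact: linearP.
- rewrite (linearP (glue w)) (linearP (glue w')) scalerDr !scalerA mulrC addrACA.
  by rewrite [in RHS]scalerDr !scalerA.
- rewrite !glueE tpPr (linearP (h s i)) (linearP (iotaN s i.+1)).
  exact: linearP.
Qed.

Lemma hA_bilin i : bilin (fun a (w : Jsp pA i) => \sum_s glue (rJ s i w) (th s a)).
Proof.
split=> [c a a' w|c a w w'].
  exact: (sum_linear (fun s => glue (rJ s i w) \o th s)).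
exact: (sum_linear (fun s => mklin (@glue_linear s i (th s a)) \o rJ s i)).
Qed.

Definition hA i : {linear NA i -> NA i.+1} := tplin (hA_bilin i).

Lemma hAE i a w : hA i (tp a w) = \sum_s glue (rJ s i w) (th s a).
Proof. exact: tplinE. Qed.

Lemma theta_mul s a b : th s a = tp a 1 -> th s (a * inj s b) = tp a b.
Proof. by move=> aE; rewrite theta_mulr aE rmulME mul1r. Qed.

(** In positive degree [Jrho] kills J_i(B_s) at every other index, so only the summand of [s]
    remains, and there [theta] returns [tp a b]. *)
Lemma hA_pos s i a y : (0 < i)%N -> th s a = tp a 1 ->
  hA i (actA i a (iotaN s i y)) = actA i.+1 a (iotaN s i.+1 (h s i y)).
Proof.
move=> i0 aE; apply: (tsr_eq (f := hA i \o (actA i a \o iotaN s i))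
  (g := actA i.+1 a \o (iotaN s i.+1 \o h s i))) y => [||b w].
- exact: linearP.
- exact: linearP.
change (hA i (actA i a (iotaN s i (tp b w))) = actA i.+1 a (iotaN s i.+1 (h s i (tp b w)))).
rewrite iotaNE lactNE hAE (bigD1 s) // big1 => [|s' ss'].
  by rewrite Jrho_iota (theta_mul b aE) glueE; exact: addr0.
by rewrite Jrho_iota_neq // (lin0 (@glue_linear s' i _)).
Qed.

Hypothesis h_one : forall s, h s 0 (tp 1 (Jone (p s))) = 0.

Lemma glue_one s a : glue (Jone (p s)) (tp a 1) = 0.
Proof. by rewrite glueE h_one (linear0 (iotaN s 1)) linear0. Qed.

Lemma Jrho_one s : rJ s 0 (Jone pA) = Jone (p s).
Proof. by apply: val_inj; rewrite val_Jrho /= rmorph1. Qed.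

Lemma Jiota_one s : iJ s 0 (Jone (p s)) = Jone pA.
Proof. by apply: val_inj; rewrite val_Jiota /= rmorph1. Qed.

(** In degree 0 the vector [Jone] survives every [Jrho], so all indices contribute. At an index
    other than [s], only the scalar part of [b] matters, by the normalisation; this produces the
    term with [aug b]. *)
Lemma hA0_one s a b : th s a = tp a 1 ->
  hA 0 (tp (a * inj s b) (Jone pA)) =
  actA 1 a (iotaN s 1 (h s 0 (tp b (Jone (p s))))) + aug b *: hA 0 (tp a (Jone pA)).
Proof.
move=> aE; rewrite !hAE.
under eq_bigr do rewrite Jrho_one.
under [in RHS]eq_bigr do rewrite Jrho_one.
(* On the right the summand of [s] is 0, because [theta] detaches nothing from [a] and [h_one]
   applies; on the left it is the term with [h s 0]. *)
rewrite [in LHS](bigD1 s) // [in RHS](bigD1 s) //= aE glue_one add0r.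
rewrite (theta_mul b aE) glueE; congr (_ + _).
rewrite scaler_sumr; apply: eq_bigr => s' ss'.
pose b0 := b - (aug b)%:A.
have b00 : aug b0 = 0 by exact: aug_sub (p s) b.
(* The part [b0] lies in the augmentation ideal, so [theta] at [s'] sends [a * inj s b0] to a tensor
   ending in 1, which [glue_one] kills. *)
have -> : a * inj s b = aug b *: a + a * inj s b0.
  rewrite -[in LHS](subrK (aug b)%:A b) -/b0 rmorphD mulrDr addrC; congr (_ + _).
  transitivity (a * (aug b *: 1)); last by rewrite -scalerAr mulr1.
  by congr (a * _); rewrite -(rmorph1 (inj s)); exact: linearZ.
rewrite (linearP (th s')) (linearP (glue _)) theta_other //; last by rewrite eq_sym.
by rewrite glue_one; exact: addr0.
Qed.

(** The defect compared with [hA_pos] is a multiple of the augmentation of [y], so it disappears on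
    boundaries and on the augmentation ideal. *)
Lemma hA0 s a y : th s a = tp a 1 ->
  hA 0 (actA 0 a (iotaN s 0 y)) =
  actA 1 a (iotaN s 1 (h s 0 y)) + (laugN (p s) y : k) *: hA 0 (tp a (Jone pA)).
Proof.
move=> aE; apply: (tsr_eq (f := hA 0 \o (actA 0 a \o iotaN s 0))
  (g := fun y => actA 1 a (iotaN s 1 (h s 0 y)) +
    (laugN (p s) y : k) *: hA 0 (tp a (Jone pA)))) y => [|c x y|b w].
- exact: linearP.
- rewrite (linearP (h s 0)) (linearP (iotaN s 1)) (linearP (actA 1 a)).
  rewrite (linearP (laugN (p s))) scalerDl -scalerA addrACA; congr (_ + _).
  by rewrite scalerDr.
change (hA 0 (actA 0 a (iotaN s 0 (tp b w))) = actA 1 a (iotaN s 1 (h s 0 (tp b w))) +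
    (laugN (p s) (tp b w) : k) *: hA 0 (tp a (Jone pA))).
rewrite (J0_scale w); move: (J0val _ w : k) => c.
rewrite -tpRE (lZ (tpR _ _) c) tpRE.
rewrite (lZ (iotaN s 0)) (lZ (actA 0 a)) (lZ (hA 0)).
rewrite (lZ (h s 0)) (lZ (iotaN s 1)) (lZ (actA 1 a)) (lZ (laugN (p s))) iotaNE lactNE Jiota_one.
rewrite hA0_one // laugNE J0val_one mulr1 scalerDr scalerA.
reflexivity.
Qed.

End GluedHomotopy.

Section FreeHomotopy.
Variables (k : fieldType) (S : finType) (B : S -> gralg k).
Variable p : forall s, presentation (B s).
Variables (A : gralg k) (inj : forall s, {lrmorphism B s -> A}).
Hypothesis A_coprod : is_coproduct inj.

Local Notation pA := (fpres p A_coprod).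
Local Notation prj := (fprj p inj).
Local Notation NA i := (tsr A (Jsp pA i)).
Local Notation NB s i := (tsr (B s) (Jsp (p s) i)).
Local Notation actA i := (lactN (Jsp pA i)).
Local Notation th s := (theta p A_coprod s).
Local Notation iotaN s i := (iotaN p A_coprod s i).

Variable d : forall s i, {linear K (p s) i.+1 -> K (p s) i}.
Hypothesis dP : forall s, is_delta (d s).
Local Notation dNA := (ldN (dA A_coprod d)).

Variable h : forall s i, {linear NB s i -> NB s i.+1}.
Hypothesis hP : forall s,
  homotopy (ldN (d s)) (laugN (p s)) (tp 1 (Jone (p s))) (h s).

Lemma h_one s : h s 0 (tp 1 (Jone (p s))) = 0.
Proof. by have [] := hP s. Qed.

Lemma tp_wd u s i (w : Jsp (p s) i) : exists a y, th s a = tp a 1 /\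
  tp (prj (wd k u)) (Jiota A_coprod s i w) = actA i a (iotaN s i y).
Proof.
have [a [b [uE aE]]] := theta_split A_coprod s u.
exists a, (tp b w); split=> //.
by rewrite iotaNE lactNE -[prj _](mu_theta p A_coprod s) uE muE.
Qed.

Lemma hA_pos_homotopy i x : (forall s y, laugN (p s) (ldN (d s) 0 y) = 0) ->
  dNA i.+1 (hA A_coprod h i.+1 x) + hA A_coprod h i (dNA i x) = x.
Proof.
move=> ed; pose f : {linear NA i.+1 -> NA i.+1} :=
  (dNA i.+1 \o hA A_coprod h i.+1) \+ (hA A_coprod h i \o dNA i).
apply: (NA_ind (i := i.+1) (Q := [set x | f x = idfun x])) x => // [|u s w].
  exact: subspace_eqlin.
have [a [y [aE yE]]] := tp_wd u w; rewrite yE.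
change (dNA i.+1 (hA A_coprod h i.+1 (actA i.+1 a (iotaN s i.+1 y))) +
  hA A_coprod h i (dNA i (actA i.+1 a (iotaN s i.+1 y))) = actA i.+1 a (iotaN s i.+1 y)).
rewrite hA_pos // !dNA_lact !(dNA_iota A_coprod dP).
(* For [i = 0] the defect term of [hA0] carries the augmentation of a boundary, which is 0 by
   [ed]. *)
have -> : hA A_coprod h i (actA i a (iotaN s i (ldN (d s) i y))) =
    actA i.+1 a (iotaN s i.+1 (h s i (ldN (d s) i y))).
  case: i y {w f yE} => [|i] y; last exact: hA_pos.
  by rewrite (hA0 h_one) // ed scale0r addr0.
rewrite -(linearD (actA i.+1 a)) -(linearD (iotaN s i.+1)).
by have [_ _ ->] := hP s.
Qed.

(** For a nonempty word the index [s] of the last letter is the right one: the word then maps to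
    [a'] times an element of the augmentation ideal of [B s], so the augmentation and the defect of
    [hA0] both vanish and the degree 0 identity of [h s] finishes. *)
Lemma hA_zero_homotopy x :
  dNA 0 (hA A_coprod h 0 x) = x - (laugN pA x : k) *: tp 1 (Jone pA).
Proof.
have gl : linear (fun x => x - (laugN pA x : k) *: tp 1 (Jone pA)).
  move=> c y z; rewrite (linearP (laugN pA)) scalerDl -scalerA opprD addrACA.
  by rewrite scalerBr.
apply: (tsr_eq (f := dNA 0 \o hA A_coprod h 0) (g := mklin gl)) x => [||a w].
- exact: linearP.
- exact: linearP.
rewrite (J0_scale w); move: (J0val _ w : k) => c.
rewrite -tpRE (lZ (tpR _ _) c) tpRE (lZ (dNA 0 \o hA A_coprod h 0)) (lZ (mklin gl)).
congr (_ *: _); have [t <-] := fprj_surj p A_coprod a.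
apply: (malg_eq (f := (dNA 0 \o hA A_coprod h 0) \o (tpL A (Jone pA) \o prj))
  (g := mklin gl \o (tpL A (Jone pA) \o prj))) t => u.
change (dNA 0 (hA A_coprod h 0 (tp (prj (wd k u)) (Jone pA))) =
  tp (prj (wd k u)) (Jone pA) -
  (laugN pA (tp (prj (wd k u)) (Jone pA)) : k) *: tp 1 (Jone pA)).
(* A case distinction on the last letter. On the empty word both sides are 0: the left by
   normalisation, the right since [tp 1 Jone] has augmentation 1. *)
elim/last_ind: u => [|u x _].
  rewrite wd_nil rmorph1 laugN_one scale1r subrr hAE big1 ?linear0 // => s _.
  by rewrite Jrho_one theta1 (glue_one A_coprod h_one).
set s := tag x; have [a' [b [uE aE]]] := theta_split A_coprod s u.
rewrite fprj_rcons -/s; set b' := proj (p s) _.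
have -> : prj (wd k u) = a' * inj s b.
  by rewrite -[LHS](mu_theta p A_coprod s) uE muE.
have b0 : aug (b * b') = 0 by rewrite (augM (p s)) /b' aug_gen mulr0.
have -> : tp (a' * inj s b * inj s b') (Jone pA) =
    actA 0 a' (iotaN s 0 (tp (b * b') (Jone (p s)))).
  by rewrite iotaNE Jiota_one lactNE -mulrA rmorphM.
rewrite (hA0 h_one) // laugN_lact laugN_iota laugNE b0 mul0r mulr0 !scale0r addr0 subr0.
rewrite dNA_lact (dNA_iota A_coprod dP).
have [_ -> _] := hP s.
by rewrite laugNE b0 mul0r scale0r subr0.
Qed.

End FreeHomotopy.

Theorem proposition3p29 (k : fieldType) (S : finType) (B : S -> gralg k)
    (B_conn : forall s, connected (B s))
    (B_fin : forall s, locally_finite (B s))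
    (B_Koszul : forall s, multi_Koszul (B s))
    (A : gralg k) (inj : forall s, {lrmorphism B s -> A})
    (A_coprod : is_coproduct inj) :
  multi_Koszul A.
Proof.
(* A presentation and a differential are chosen for every factor; the presentation of [A] and its
   differential are built from these choices. *)
have /all_sig[p pP] s : {p : presentation (B s) |
    exists d : forall i, {linear K p i.+1 -> K p i}, is_delta d /\ left_resolution d}.
  by apply: cid; have [] := B_Koszul s.
have /all_sig2[d dP dR] s : {d : forall i, {linear K (p s) i.+1 -> K (p s) i} |
    is_delta d & left_resolution d}.
  by apply: cid2; have [d [dP dR]] := pP s; exists d.
have res s : resolution (ldN (d s)) (laugN (p s)).
  by apply/(left_resolutionP (dbim dP s)); exact: dR.
(* [is_delta] does not say that consecutive maps compose to 0; this is read off from exactness of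
   the complexes of the factors. *)
have ed s y : laugN (p s) (ldN (d s) 0 y) = 0.
  by have [E _] := res s; apply/E; exists y.
have dd s i y : ldN (d s) i (ldN (d s) i.+1 y) = 0.
  by have [_ E] := res s; apply/E; exists y.
have /all_sig[h hP] s : {h : forall i, {linear tsr (B s) (Jsp (p s) i) ->
      tsr (B s) (Jsp (p s) i.+1)} |
    homotopy (ldN (d s)) (laugN (p s)) (tp 1 (Jone (p s))) h}.
  by apply/cid/resolution_homotopy; [exact: laugN_one | exact: res].
split; [exact: (coprod_connected p A_coprod) | exact: (coprod_fin p A_coprod) |].
exists (fpres p A_coprod), (dA A_coprod d); split; first exact: dA_delta.
apply/(left_resolutionP (dAbim A_coprod d)).
apply: (homotopy_resolution (u := tp 1 (Jone (fpres p A_coprod))) (h := hA A_coprod h)).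
- split=> [|x|i x].
  + rewrite hAE big1 // => s _.
    by rewrite Jrho_one theta1 (glue_one A_coprod (h_one hP)).
  + exact: hA_zero_homotopy.
  + exact: hA_pos_homotopy.
- by move=> y; apply: (laugN_dNA dP).
- by move=> i y; apply: (dNA_dNA dP).
Qed.
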